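(* Let $\Phi_n:\mathfrak{so}(n,\mathbb{C})\to\mathbb{C}^{r_{n-1}}\oplus\mathbb{C}^{r_n}$ be the orthogonal partial Kostant-Wallach map. Case I: Suppose $n=2l$. Then $\Phi_n^{-1}(0,0)=\mathrm{Ad}(K)\mathfrak{n}_+$ is irreducible, where $\mathfrak{n}_+=[\mathfrak{b}_+,\mathfrak{b}_+]$ and $Q_+=K\cdot\mathfrak{b}_+$ is the unique closed $K$-orbit in the flag variety $\mathcal{B}$. Case II: Suppose $n=2l+1$. Then $\Phi_n^{-1}(0,0)=\mathrm{Ad}(K)\mathfrak{n}_+\cup\mathrm{Ad}(K)\mathfrak{n}_-$ has two irreducible components, where $\mathfrak{n}_\pm=[\mathfrak{b}_\pm,\mathfrak{b}_\pm]$ and $Q_\pm=K\cdot\mathfrak{b}_\pm$ are the two closed $K$-orbits in $\mathcal{B}$.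
   Context: Let $\beta(x,y)=x^TS_ny$ on $\mathbb{C}^n$, with $S_n$ the matrix with ones on the skew diagonal and zeros elsewhere, $G=SO(n,\mathbb{C})$ and $\mathfrak{g}=\mathfrak{so}(n,\mathbb{C})$ the group (determinant one) and Lie algebra of $\beta$. Let $l=\lfloor n/2\rfloor$; write $e_{-j}=e_{n+1-j}$ for $1\le j\le l$ and $e_0=e_{l+1}$ if $n=2l+1$. Let $\theta$ be the involution given by conjugation by the linear map $s$ where: if $n=2l+1$, $s(e_0)=-e_0$ and $s$ fixes all $e_{\pm j}$; if $n=2l$, $s$ interchanges $e_l$ and $e_{-l}$ and fixes the other basis vectors. $K=(G^\theta)^0\cong SO(n-1,\mathbb{C})$, $\mathfrak{k}=\mathfrak{g}^\theta\cong\mathfrak{so}(n-1,\mathbb{C})$, and $x_{\mathfrak{k}}$ is the projection of $x$ onto $\mathfrak{k}$ along the $-1$-eigenspace of $\theta$. With $r_m=\lfloor m/2\rfloor$, $\mathfrak g_n=\mathfrak g$, $\mathfrak g_{n-1}=\mathfrak k$, $G_n=G$, $G_{n-1}=K$, let $f_{m,1},\dots,f_{m,r_m}$ be algebraically independent homogeneous generators of $\mathbb{C}[\mathfrak{g}_m]^{G_m}$ for $m=n-1,n$. Then $\Phi_n(x)=(f_{n-1,1}(x_{\mathfrak{k}}),\dots,f_{n-1,r_{n-1}}(x_{\mathfrak{k}}),f_{n,1}(x),\dots,f_{n,r_n}(x))$. $\mathcal{B}$ is the variety of Borel subalgebras of $\mathfrak{g}$; $\mathfrak{b}_+$ is the Borel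 subalgebra of upper triangular matrices in $\mathfrak{g}$. For $n=2l+1$, $\mathfrak{b}_-:=s_{\alpha_l}(\mathfrak{b}_+)=\mathrm{Ad}(\dot{s}_{\alpha_l})\mathfrak{b}_+$, where $\dot{s}_{\alpha_l}\in G$ is a representative of the reflection in the short simple root $\alpha_l=\epsilon_l$ of the diagonal Cartan subalgebra ($\epsilon_l(\mathrm{diag}[a_1,\dots,a_l,0,-a_l,\dots,-a_1])=a_l$). *)

(* Defs.v *)
From HB Require Import structures.
From mathcomp Require Import all_boot all_order all_algebra.
From mathcomp Require Import boolp classical_sets reals.
From mathcomp Require Export mpoly.
From mathcomp Require Export complex.

Set Implicit Arguments.
Unset Strict Implicit.
Unset Printing Implicit Defensive.

Import GRing.Theory passmx.

Local Open Scope classical_set_scope.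
Local Open Scope ring_scope.

Section Zariski.
Variable F : fieldType.

Definition meval_mx p q (P : {mpoly F[p * q]}) (x : 'M[F]_(p, q)) : F :=
  P.@[fun i => mxvec x 0 i].

Definition zclosed p q (Z : set 'M[F]_(p, q)) : Prop :=
  exists S : set {mpoly F[p * q]},
    Z = [set x | forall P, S P -> meval_mx P x = 0].

Definition zirreducible p q (X : set 'M[F]_(p, q)) : Prop :=
  X !=set0 /\
  forall Z1 Z2, zclosed Z1 -> zclosed Z2 ->
    X `<=` Z1 `|` Z2 -> X `<=` Z1 \/ X `<=` Z2.

Definition zirr_component p q (X Y : set 'M[F]_(p, q)) : Prop :=
  [/\ Y `<=` X, zirreducible Y &
      forall Y', Y' `<=` X -> zirreducible Y' -> Y `<=` Y' -> Y' = Y].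

Definition zconnected p q (X : set 'M[F]_(p, q)) : Prop :=
  forall Z1 Z2, zclosed Z1 -> zclosed Z2 ->
    X `<=` Z1 `|` Z2 -> X `&` Z1 `&` Z2 = set0 -> X `<=` Z1 \/ X `<=` Z2.

Definition identity_component n (H : set 'M[F]_n) : set 'M[F]_n :=
  [set g | exists X, [/\ zconnected X, X `<=` H, X 1%:M & X g]].

End Zariski.

Section LieAlgebra.
Variables (F : fieldType) (n : nat).
Implicit Types (g x y : 'M[F]_n) (U V b : {vspace 'M[F]_n}).

Definition Ad g : 'End('M[F]_n) := linfun (mulmxr (invmx g) \o mulmx g).

Definition Ad_sat (H X : set 'M[F]_n) : set 'M[F]_n :=
  [set y | exists2 g, H g & exists2 x, X x & y = Ad g x].

Definition orbit_vs (H : set 'M[F]_n) b : set {vspace 'M[F]_n} :=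
  [set c | exists2 g, H g & c = (Ad g @: b)%VS].

Definition lieb x y : 'M[F]_n := x *m y - y *m x.

Definition lie_prod U V : {vspace 'M[F]_n} :=
  <<[seq lieb x y | x <- vbasis U, y <- vbasis V]>>%VS.

Definition lie_subalgebra V : Prop := (lie_prod V V <= V)%VS.

Definition lie_solvable V : Prop :=
  exists k, iter k (fun U => lie_prod U U) V = 0%VS.

Definition borel V : set {vspace 'M[F]_n} :=
  [set b | [/\ (b <= V)%VS, lie_subalgebra b, lie_solvable b &
      forall c, (c <= V)%VS -> lie_subalgebra c -> lie_solvable c ->
        (b <= c)%VS -> c = b]].

(* The variety of Borel subalgebras is topologized as a subset of the
   Grassmannians Gr(d, 'M_n), and each Gr(d, 'M_n) as the quotient by GL_d of
   the variety of linearly independent d-tuples in 'M_n (a tuple is written as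
   the rows of a d x n^2 matrix). *)
Definition row_span d (M : 'M[F]_(d, n * n)) : {vspace 'M[F]_n} :=
  <<[seq vec_mx (row i M) | i <- enum 'I_d]>>%VS.

Definition grass_closed (Z : set {vspace 'M[F]_n}) : Prop :=
  forall d, exists2 A : set 'M[F]_(d, n * n), zclosed A &
    forall M, row_free M -> (A M <-> Z (row_span M)).

Definition borel_closed V (Q : set {vspace 'M[F]_n}) : Prop :=
  exists2 Z, grass_closed Z & Q = borel V `&` Z.

Definition closed_orbit (H : set 'M[F]_n) V (Q : set {vspace 'M[F]_n}) : Prop :=
  borel_closed V Q /\ exists2 b, borel V b & Q = orbit_vs H b.

(* A polynomial function on the subspace V is a function on 'M_n considered
   only through its values on V. *)
Definition polyfun V (phi : 'M[F]_n -> F) : Prop :=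
  exists P : {mpoly F[n * n]}, forall x, x \in V -> phi x = meval_mx P x.

Definition homogeneous_polyfun V (phi : 'M[F]_n -> F) : Prop :=
  exists d, exists2 P : {mpoly F[n * n]}, P \is d.-homog &
    forall x, x \in V -> phi x = meval_mx P x.

Definition invariant_polyfun V (H : set 'M[F]_n) (phi : 'M[F]_n -> F) : Prop :=
  polyfun V phi /\
  forall g x, H g -> x \in V -> phi (Ad g x) = phi x.

Definition basic_invariants V (H : set 'M[F]_n) r
    (f : 'I_r -> 'M[F]_n -> F) : Prop :=
  [/\ forall i, invariant_polyfun V H (f i),
      forall i, homogeneous_polyfun V (f i),
      forall P : {mpoly F[r]},
        (forall x, x \in V -> P.@[fun i => f i x] = 0) -> P = 0 &
      forall phi, invariant_polyfun V H phi ->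
        exists P : {mpoly F[r]}, forall x, x \in V -> phi x = P.@[fun i => f i x]].

End LieAlgebra.

Section Orthogonal.
Variables (F : fieldType) (n : nat).

(* The basis vector e_j (1 <= j) has 0-based index j - 1, hence e_{-j} has index
   n - j, and e_0 has index l = n./2 when n is odd. *)

Definition skew_mx : 'M[F]_n := \matrix_(i, j) (j == rev_ord i)%:R.

Definition SO : set 'M[F]_n :=
  [set g | g^T *m skew_mx *m g = skew_mx /\ \det g = 1].

Definition so : {vspace 'M[F]_n} :=
  lker (linfun ((mulmxr skew_mx \o trmx) \+ mulmx skew_mx)).

Definition swap_mid (l k : nat) : nat :=
  if k == l.-1 then l else if k == l then l.-1 else k.

Definition s_mx : 'M[F]_n :=
  if odd n then \matrix_(i, j) ((-1) ^+ (i == n./2 :> nat) *+ (i == j))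
  else \matrix_(i, j) (i == swap_mid n./2 j :> nat)%:R.

Definition theta : 'End('M[F]_n) := Ad s_mx.

Definition kalg : {vspace 'M[F]_n} := (so :&: leigenspace theta 1)%VS.

Definition palg : {vspace 'M[F]_n} := (so :&: leigenspace theta (-1))%VS.

Definition Kgrp : set 'M[F]_n :=
  identity_component [set g | SO g /\ theta g = g].

Definition proj_k (x : 'M[F]_n) : 'M[F]_n := daddv_pi kalg palg x.

Definition rk (m : nat) : nat := m./2.

(* fk plays the role of (f_{n-1,i}) and f that of (f_{n,i}). *)
Definition Phi (fk : 'I_(rk n.-1) -> 'M[F]_n -> F) (f : 'I_(rk n) -> 'M[F]_n -> F)
    (x : 'M[F]_n) : 'rV[F]_(rk n.-1) * 'rV[F]_(rk n) :=
  (\row_i fk i (proj_k x), \row_i f i x).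

Definition Phi_fiber0 (fk : 'I_(rk n.-1) -> 'M[F]_n -> F)
    (f : 'I_(rk n) -> 'M[F]_n -> F) : set 'M[F]_n :=
  [set x | x \in so /\ Phi fk f x = (0, 0)].

Definition b_plus : {vspace 'M[F]_n} :=
  (so :&: \sum_(p : 'I_n * 'I_n | (p.1 <= p.2)%N) <[delta_mx p.1 p.2]>)%VS.

Definition nilrad (b : {vspace 'M[F]_n}) : set 'M[F]_n :=
  [set x | x \in lie_prod b b].

(* The coordinate function epsilon_j on diagonal matrices, 1 <= j. *)
Definition epsilon (j : nat) (x : 'M[F]_n) : F :=
  \sum_(i < n | i.+1 == j) x i i.

(* For n = 2l + 1, the coroot of alpha_l = epsilon_l is twice the element
   E_l - E_{-l} dual to epsilon_l. *)
Definition coroot_short : 'M[F]_n :=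
  diag_mx (\row_(i < n) (((i.+1 == n./2)%N)%:R *+ 2 - ((i == n - n./2 :> nat)%N)%:R *+ 2)).

(* w represents the reflection s_{alpha_l}, which acts on the diagonal Cartan
   subalgebra by h |-> h - alpha_l(h) alpha_l^vee. *)
Definition represents_s_short (w : 'M[F]_n) : Prop :=
  SO w /\ forall h, h \in so -> is_diag_mx h ->
            Ad w h = h - epsilon n./2 h *: coroot_short.

Definition b_minus (w : 'M[F]_n) : {vspace 'M[F]_n} := (Ad w @: b_plus)%VS.

End Orthogonal.

Arguments skew_mx {F} n.
Arguments SO F n : clear implicits.
Arguments so F n : clear implicits.
Arguments s_mx F n : clear implicits.
Arguments theta F n : clear implicits.
Arguments kalg F n : clear implicits.
Arguments palg F n : clear implicits.
Arguments Kgrp F n : clear implicits.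
Arguments b_plus F n : clear implicits.

(* Main.v *)
Require Import Defs.
From mathcomp Require Import all_boot all_order all_algebra.
From mathcomp Require Import boolp classical_sets reals.
From mathcomp Require Import mpoly complex.
From mathcomp Require Import ring zify.

Set Implicit Arguments.
Unset Strict Implicit.
Unset Printing Implicit Defensive.

Import Order.TTheory GRing.Theory Num.Theory.

Local Open Scope classical_set_scope.
Local Open Scope ring_scope.

(** Let v span the (-1)-eigenspace of s, so that theta is conjugation by the
    reflection in v and K consists of the isometries of determinant one fixing v;
    by the Cartan-Dieudonne theorem K is generated by rational curves of products
    of two reflections, hence irreducible.

    If x lies in the zero fiber then x and A = x_k are nilpotent. Comparing the
    resolvents of x and A shows that u = x v generates under A a totally isotropic
    subspace of the orthogonal of v on which x and A agree. Extending it vector by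
    vector, with Witt's theorem to move each new vector into the standard flag, puts
    x in Ad(h) n_+ for an isometry h fixing v; conversely n_+ is contracted to 0 by
    a torus in K. For n even h can be taken in K. For n odd there are two cosets,
    and they are separated by the polynomial det [u, A u, ..., A^(l-1) u, e_0, e_-l,
    ..., e_-1], whose vanishing on Ad(K) x cuts out Ad(K) n_- in the fiber.

    By Lie's theorem the Borel subalgebras are the stabilizers of maximal isotropic
    flags. A flag vector not orthogonal to v can be degenerated into one that is by
    a torus in K, so a closed K-orbit contains a flag orthogonal to v; and those
    flags are cut out by the closed condition B(x v, x v) = 0 on x in [b, b]. *)

(** * Regular functions and the Zariski topology *)

(** The generators are never computed. They vanish at 0 and det(t - x) is a polynomial in them,
    which turns the zero fiber into nilpotency of x and x_k.

    What shapes the proof is the coset of K that contains h. The orthogonal of v has dimension n -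
    1. For n even an isotropic flag in it leaves an anisotropic line, and the reflection in that
    line normalizes n_+ and has determinant -1. For n = 2l + 1 no such line is left, and the maximal
    isotropic subspaces fall into two families. The induction that builds the flag therefore carries
    a dichotomy. Either u lies in the span of the first l - 1 flag vectors; then x has no component
    along alpha_l, so that exchanging e_l and e_-l keeps it in n_+, and x lies in both pieces. Or
    the vectors A^k u span the isotropic subspace, and the determinant is nonzero at Ad(h) x. On the
    other coset the determinant acquires as a factor the upper left l x l minor of an isometry g
    with g v = v and det g = -1, and that minor is 0. *)

Section FunctionAlgebras.
Variables (F : fieldType) (T : Type).
Implicit Types (A : set (T -> F)).

(** Isolates what sums, products, determinants and iterates require, so that one set of closure
    lemmas serves polynomial functions of a matrix, polynomials in one variable, and rational
    functions with a fixed denominator. *)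
Definition function_algebra A : Prop :=
  [/\ forall c, A (fun=> c),
      forall f g, A f -> A g -> A (fun t => f t + g t) &
      forall f g, A f -> A g -> A (fun t => f t * g t)].

Definition entries_in A p q (phi : T -> 'M[F]_(p, q)) : Prop :=
  forall i j, A (fun t => phi t i j).

Variable A : set (T -> F).
Hypothesis algA : function_algebra A.

Lemma algebra_cst c : A (fun=> c). Proof. by have [h _ _] := algA; apply: h. Qed.
Lemma algebra_add f g : A f -> A g -> A (fun t => f t + g t).
Proof. by have [_ h _] := algA; apply: h. Qed.
Lemma algebra_mul f g : A f -> A g -> A (fun t => f t * g t).
Proof. by have [_ _ h] := algA; apply: h. Qed.

Lemma algebra_sum I (r : seq I) (P : pred I) (f : I -> T -> F) :
  (forall i, P i -> A (f i)) -> A (fun t => \sum_(i <- r | P i) f i t).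
Proof.
move=> Af; elim: r => [|i r IHr].
  by under eq_fun do rewrite big_nil; apply: algebra_cst.
under eq_fun do rewrite big_cons.
by case Pi: (P i) => //; apply: algebra_add => //; apply: Af.
Qed.

Lemma algebra_prod I (r : seq I) (P : pred I) (f : I -> T -> F) :
  (forall i, P i -> A (f i)) -> A (fun t => \prod_(i <- r | P i) f i t).
Proof.
move=> Af; elim: r => [|i r IHr].
  by under eq_fun do rewrite big_nil; apply: algebra_cst.
under eq_fun do rewrite big_cons.
by case Pi: (P i) => //; apply: algebra_mul => //; apply: Af.
Qed.

Lemma algebra_exp f k : A f -> A (fun t => f t ^+ k).
Proof.
move=> Af; elim: k => [|k IHk]; first exact: algebra_cst.
by under eq_fun do rewrite exprS; apply: algebra_mul.
Qed.

Lemma algebra_opp f : A f -> A (fun t => - f t).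
Proof.
move=> Af; under eq_fun do rewrite -mulN1r.
by apply: algebra_mul => //; apply: algebra_cst.
Qed.

Lemma entries_cst p q (M : 'M[F]_(p, q)) : entries_in A (fun=> M).
Proof. by move=> i j; apply: algebra_cst. Qed.

Lemma entries_add p q (f g : T -> 'M[F]_(p, q)) :
  entries_in A f -> entries_in A g -> entries_in A (fun t => f t + g t).
Proof.
move=> Af Ag i j; under eq_fun do rewrite mxE.
exact: algebra_add (Af i j) (Ag i j).
Qed.

Lemma entries_opp p q (f : T -> 'M[F]_(p, q)) :
  entries_in A f -> entries_in A (fun t => - f t).
Proof.
by move=> Af i j; under eq_fun do rewrite mxE; apply: algebra_opp.
Qed.

Lemma entries_sub p q (f g : T -> 'M[F]_(p, q)) :
  entries_in A f -> entries_in A g -> entries_in A (fun t => f t - g t).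
Proof. by move=> Af Ag; apply: entries_add => //; apply: entries_opp. Qed.

Lemma entries_mul p q r (f : T -> 'M[F]_(p, q)) (g : T -> 'M[F]_(q, r)) :
  entries_in A f -> entries_in A g -> entries_in A (fun t => f t *m g t).
Proof.
move=> Af Ag i j; under eq_fun do rewrite mxE.
by apply: algebra_sum => k _; apply: algebra_mul.
Qed.

Lemma entries_scale p q (f : T -> F) (g : T -> 'M[F]_(p, q)) :
  A f -> entries_in A g -> entries_in A (fun t => f t *: g t).
Proof.
move=> Af Ag i j; under eq_fun do rewrite mxE.
exact: algebra_mul.
Qed.

Lemma entries_tr p q (f : T -> 'M[F]_(p, q)) :
  entries_in A f -> entries_in A (fun t => (f t)^T).
Proof. by move=> Af i j; under eq_fun do rewrite mxE. Qed.

Lemma entries_sum p q I (r : seq I) (P : pred I) (f : I -> T -> 'M[F]_(p, q)) :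
  (forall i, P i -> entries_in A (f i)) ->
  entries_in A (fun t => \sum_(i <- r | P i) f i t).
Proof.
move=> Af i j; under eq_fun do rewrite summxE.
by apply: algebra_sum => k Pk; apply: Af.
Qed.

Lemma entries_iter p (f : T -> 'M[F]_p) q (g : T -> 'M[F]_(p, q)) k :
  entries_in A f -> entries_in A g ->
  entries_in A (fun t => iter k (mulmx (f t)) (g t)).
Proof. by move=> Af Ag; elim: k => //= k IHk; apply: entries_mul. Qed.

Lemma algebra_det p (f : T -> 'M[F]_p) :
  entries_in A f -> A (fun t => \det (f t)).
Proof.
move=> Af; apply: algebra_sum => s _.
apply: algebra_mul; first exact: algebra_cst.
exact: algebra_prod.
Qed.

Lemma algebra_meval p q (f : T -> 'M[F]_(p, q)) (P : {mpoly F[p * q]}) :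
  entries_in A f -> A (fun t => meval_mx P (f t)).
Proof.
move=> Af; rewrite /meval_mx.
elim/mpolyind: P => [|c m P _ _ IHP].
  by under eq_fun do rewrite meval0; apply: algebra_cst.
under eq_fun do rewrite mevalD mevalZ mevalX.
apply: algebra_add => //; apply: algebra_mul; first exact: algebra_cst.
apply: algebra_prod => i _; apply: algebra_exp.
by case/mxvec_indexP: i => i j; under eq_fun do rewrite mxvecE; apply: Af.
Qed.

End FunctionAlgebras.

Section Regular.
Variable F : fieldType.

Definition regular p q : set ('M[F]_(p, q) -> F) :=
  [set f | exists P, forall x, f x = meval_mx P x].
Arguments regular : clear implicits.

Lemma regular_algebra p q : function_algebra (regular p q).
Proof.
split=> [c|f g [P fP] [Q gQ]|f g [P fP] [Q gQ]].
- by exists c%:MP => x; rewrite /meval_mx mevalC.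
- by exists (P + Q) => x; rewrite /meval_mx mevalD fP gQ.
- by exists (P * Q) => x; rewrite /meval_mx mevalM fP gQ.
Qed.

Lemma regular_entry p q (i : 'I_p) (j : 'I_q) : regular p q (fun x => x i j).
Proof. by exists 'X_(mxvec_index i j) => x; rewrite /meval_mx mevalXU mxvecE. Qed.

Lemma entries_id p q : entries_in (regular p q) id.
Proof. by move=> i j; apply: regular_entry. Qed.

Lemma zclosed_bigcap p q (I : Type) (Z : I -> set 'M[F]_(p, q)) :
  (forall i, zclosed (Z i)) -> zclosed [set x | forall i, Z i x].
Proof.
move=> Zc; exists [set P | exists i S, [/\ Z i = [set x | forall P, S P -> meval_mx P x = 0] & S P]].
apply/seteqP; split=> x /= Zx.
  by move=> P [i [S [ZS SP]]]; move: (Zx i); rewrite ZS; apply.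
move=> i; case: (Zc i) => S ZS; rewrite ZS => P SP.
by apply: Zx; exists i, S.
Qed.

Lemma zclosed_bigcap_cond p q (I : Type) (C : I -> Prop) (Z : I -> set 'M[F]_(p, q)) :
  (forall i, C i -> zclosed (Z i)) -> zclosed [set x | forall i, C i -> Z i x].
Proof.
move=> Zc.
have -> : [set x | forall i, C i -> Z i x] = [set x | forall i : {i | C i}, Z (sval i) x].
  by apply/seteqP; split=> x /= Zx => [[i Ci] //=|i Ci]; [exact: Zx | exact: (Zx (exist _ i Ci))].
by apply: zclosed_bigcap => -[i Ci]; apply: Zc.
Qed.

Lemma zclosed_setI p q (Z1 Z2 : set 'M[F]_(p, q)) :
  zclosed Z1 -> zclosed Z2 -> zclosed (Z1 `&` Z2).
Proof.
move=> Z1c Z2c.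
have -> : Z1 `&` Z2 = [set x | forall b : bool, (if b then Z1 else Z2) x].
  apply/seteqP; split=> x /=; first by move=> [? ?] [].
  by move=> Zx; split; [apply: (Zx true) | apply: (Zx false)].
by apply: zclosed_bigcap => -[].
Qed.

Lemma zclosed_eq0 p q (f : 'M[F]_(p, q) -> F) :
  regular p q f -> zclosed [set x | f x = 0].
Proof.
move=> [P fP]; exists [set P]; apply/seteqP; split=> x /=.
  by move=> fx0 _ ->; rewrite -fP.
by move=> /(_ P erefl); rewrite -fP.
Qed.

Lemma zclosed_preimage p q p' q' (phi : 'M[F]_(p, q) -> 'M[F]_(p', q')) Z :
  entries_in (regular p q) phi -> zclosed Z -> zclosed (phi @^-1` Z).
Proof.
move=> phiR [S ->]; apply: zclosed_bigcap_cond => P _.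
by apply: zclosed_eq0; apply: algebra_meval phiR; apply: regular_algebra.
Qed.

Lemma zclosed_mx_eq p q p' q' (phi psi : 'M[F]_(p, q) -> 'M[F]_(p', q')) :
  entries_in (regular p q) phi -> entries_in (regular p q) psi ->
  zclosed [set x | phi x = psi x].
Proof.
move=> phiR psiR.
have -> : [set x | phi x = psi x] =
    [set x | forall ij : 'I_p' * 'I_q', phi x ij.1 ij.2 - psi x ij.1 ij.2 = 0].
  apply/seteqP; split=> x /= => [-> ij|eqx]; first by rewrite subrr.
  by apply/matrixP => i j; apply/eqP; rewrite -subr_eq0 (eqx (i, j)).
apply: zclosed_bigcap => -[i j] /=; apply: zclosed_eq0.
apply: algebra_add (phiR i j) _; first exact: regular_algebra.
by apply: algebra_opp; [apply: regular_algebra | apply: psiR].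
Qed.

Lemma zirreducible_connected p q (X : set 'M[F]_(p, q)) :
  zirreducible X -> zconnected X.
Proof. by move=> [_ irrX] Z1 Z2 Z1c Z2c sXZ _; apply: irrX. Qed.

(** Regularity in each argument separately is enough, and no product variety is formed: the x whose
    whole slice f x Y lies in Z form a closed set, and irreducibility of Y makes two such sets cover
    X. *)
Lemma zirreducible_image2 p q p1 q1 p2 q2
    (f : 'M[F]_(p1, q1) -> 'M[F]_(p2, q2) -> 'M[F]_(p, q)) X Y :
  (forall x, X x -> entries_in (regular p2 q2) (f x)) ->
  (forall y, Y y -> entries_in (regular p1 q1) (f^~ y)) ->
  zirreducible X -> zirreducible Y ->
  zirreducible [set z | exists2 x, X x & exists2 y, Y y & z = f x y].
Proof.
move=> fr fl [[x0 Xx0] irrX] [[y0 Yy0] irrY]; split.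
  by exists (f x0 y0), x0 => //; exists y0.
move=> Z1 Z2 Z1c Z2c sZ.
pose slice (Z : set 'M[F]_(p, q)) := [set x | forall y, Y y -> Z (f x y)].
have slice_closed Z : zclosed Z -> zclosed (slice Z).
  move=> Zc; apply: zclosed_bigcap_cond => y Yy.
  exact: (zclosed_preimage (fl y Yy)).
have Xslice : X `<=` slice Z1 `|` slice Z2.
  move=> x Xx; apply: irrY; try exact: (zclosed_preimage (fr x Xx)).
  by move=> y Yy; apply: sZ; exists x => //; exists y.
have [sX|sX] := irrX _ _ (slice_closed _ Z1c) (slice_closed _ Z2c) Xslice.
  by left=> _ [x Xx [y Yy ->]]; apply: sX.
by right=> _ [x Xx [y Yy ->]]; apply: sX.
Qed.

Lemma zirreducible_set1 p q (x : 'M[F]_(p, q)) : zirreducible [set x].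
Proof.
split; first by exists x.
move=> Z1 Z2 _ _ sxZ; case: (sxZ x erefl) => Zx; [left|right] => y ->; exact: Zx.
Qed.

Lemma zirreducible_directed p q (X : set 'M[F]_(p, q)) :
  X !=set0 ->
  (forall x y, X x -> X y -> exists Y, [/\ zirreducible Y, Y `<=` X, Y x & Y y]) ->
  zirreducible X.
Proof.
move=> X0 dirX; split=> // Z1 Z2 Z1c Z2c sXZ.
apply: contrapT => /not_orP[] /existsNP[x /not_implyP[Xx Z1x]].
move=> /existsNP[y /not_implyP[Xy Z2y]].
have [Y [[_ irrY] sYX Yx Yy]] := dirX x y Xx Xy.
have [sY|sY] := irrY Z1 Z2 Z1c Z2c (subset_trans sYX sXZ).
  exact/Z1x/sY.
exact/Z2y/sY.
Qed.

End Regular.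
Arguments regular F p q : clear implicits.

(** * Polynomial and rational curves *)

Section OneVariable.
Variable F : numFieldType.

Definition polynomial1 : set (F -> F) :=
  [set f | exists p : {poly F}, forall t, f t = p.[t]].

Lemma polynomial1_algebra : function_algebra polynomial1.
Proof.
split=> [c|f g [p fp] [q gq]|f g [p fp] [q gq]].
- by exists c%:P => t; rewrite hornerC.
- by exists (p + q) => t; rewrite hornerD fp gq.
- by exists (p * q) => t; rewrite hornerM fp gq.
Qed.

Lemma polynomial1_id : polynomial1 id.
Proof. by exists 'X => t; rewrite hornerX. Qed.

Lemma poly_eq0_of_values (p : {poly F}) : (forall t, p.[t] = 0) -> p = 0.
Proof.
move=> p0; apply: (@roots_geq_poly_eq0 _ p [seq i%:R | i <- iota 0 (size p)]).
- by apply/allP => t _; apply/rootP.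
- by rewrite map_inj_uniq ?iota_uniq // => i j /eqP; rewrite eqr_nat => /eqP.
- by rewrite size_map size_iota.
Qed.

Lemma poly_inj (p q : {poly F}) : (forall t, p.[t] = q.[t]) -> p = q.
Proof.
move=> pq; apply/eqP; rewrite -subr_eq0; apply/eqP/poly_eq0_of_values => t.
by rewrite hornerD hornerN pq subrr.
Qed.

Lemma polynomial1_eq0 f :
  polynomial1 f -> (forall t, t != 0 -> f t = 0) -> f 0 = 0.
Proof.
move=> [p fp] f0; rewrite fp.
suff : 'X * p = 0 by move/eqP; rewrite mulf_eq0 polyX_eq0 => /= /eqP->; rewrite horner0.
apply: poly_eq0_of_values => t; rewrite hornerM hornerX.
by have [->|t0] := eqVneq t 0; rewrite ?mul0r // -fp f0 // mulr0.
Qed.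

(** The algebraic stand-in for letting t tend to 0: a polynomial in t that vanishes off 0 vanishes
    at 0, the field being infinite. *)
Lemma zclosed_limit p q (phi : F -> 'M[F]_(p, q)) Z :
  zclosed Z -> entries_in polynomial1 phi ->
  (forall t, t != 0 -> Z (phi t)) -> Z (phi 0).
Proof.
move=> [S ->] phiP Zphi P SP.
apply: (@polynomial1_eq0 (fun t => meval_mx P (phi t))).
  by apply: algebra_meval phiP; apply: polynomial1_algebra.
by move=> t t0; apply: Zphi.
Qed.

Variable N : {poly F}.

(** One denominator with a varying exponent keeps the class closed under sums and products. Nothing
    is demanded at the zeros of [N]. *)
Definition rational1 : set (F -> F) :=
  [set f | exists p k, forall t, N.[t] != 0 -> f t = p.[t] / N.[t] ^+ k].

Lemma rational1_algebra : function_algebra rational1.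
Proof.
split=> [c|f g [p [k fp]] [q [l gq]]|f g [p [k fp]] [q [l gq]]].
- by exists c%:P, 0%N => t; rewrite hornerC expr0 divr1.
- exists (p * N ^+ l + q * N ^+ k), (k + l)%N => t Nt.
  rewrite fp // gq // hornerD !hornerM !horner_exp exprD.
  by field; rewrite !expf_neq0.
- exists (p * q), (k + l)%N => t Nt; rewrite fp // gq // hornerM exprD.
  by field; rewrite !expf_neq0.
Qed.

Lemma rational1_poly p : rational1 (fun t => p.[t]).
Proof. by exists p, 0%N => t; rewrite expr0 divr1. Qed.

Lemma rational1_inv : rational1 (fun t => N.[t]^-1).
Proof. by exists 1, 1%N => t; rewrite hornerC expr1 mul1r. Qed.

Lemma zirreducible_rational_curve p q (phi : F -> 'M[F]_(p, q)) :
  N != 0 -> entries_in rational1 phi ->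
  zirreducible [set phi t | t in [set t | N.[t] != 0]].
Proof.
move=> N0 phiR; split.
  apply: contrapT => /nonemptyPn/eqP e0.
  move/eqP: N0; apply; apply: poly_eq0_of_values => t; apply/eqP.
  apply: contraT => Nt; suff: set0 (phi t) by [].
  by rewrite -(eqP e0); exists t.
move=> _ _ [S1 ->] [S2 ->] sZ.
apply: contrapT => /not_orP[] /existsNP[_ /not_implyP[[a Na <-]]].
move=> /existsNP[P1 /not_implyP[SP1 P1a]].
move=> /existsNP[_ /not_implyP[[b Nb <-]]] /existsNP[P2 /not_implyP[SP2 P2b]].
have [p1 [k1 e1]] := algebra_meval rational1_algebra P1 phiR.
have [p2 [k2 e2]] := algebra_meval rational1_algebra P2 phiR.
(* The factor [N] disposes of the parameters that are excluded from the curve. *)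
have : p1 * p2 * N = 0.
  apply: poly_eq0_of_values => t; rewrite !hornerM.
  have [->|Nt] := eqVneq N.[t] 0; first by rewrite mulr0.
  have [/(_ P1 SP1)|/(_ P2 SP2)] : _ \/ _ := sZ (phi t) (ex_intro2 _ _ t Nt erefl).
    rewrite e1 // => /eqP; rewrite mulf_eq0 invr_eq0 expf_eq0 (negPf Nt) andbF orbF.
    by move=> /eqP->; rewrite !mul0r.
  rewrite e2 // => /eqP; rewrite mulf_eq0 invr_eq0 expf_eq0 (negPf Nt) andbF orbF.
  by move=> /eqP->; rewrite mulr0 mul0r.
move/eqP; rewrite !mulf_eq0 (negPf N0) orbF => /orP[] /eqP p0.
  by apply: P1a; rewrite e1 // p0 horner0 mul0r.
by apply: P2b; rewrite e2 // p0 horner0 mul0r.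
Qed.

End OneVariable.

(** * Lie products and the adjoint action *)

Section LieProduct.
Variables (F : fieldType) (n : nat).
Implicit Types (x y z : 'M[F]_n) (U V W : {vspace 'M[F]_n}).

Lemma lie_prod_ind (P : 'M[F]_n -> Prop) U V :
  P 0 -> (forall c x y, P x -> P y -> P (c *: x + y)) ->
  (forall x y, x \in U -> y \in V -> P (lieb x y)) ->
  forall z, z \in lie_prod U V -> P z.
Proof.
move=> P0 PL PB z; rewrite /lie_prod; set X := (X in <<X>>%VS) => zX.
have PX i : P (in_tuple X)`_i.
  have [iX|iX] := ltnP i (size X); last by rewrite nth_default.
  have /allpairsP[[a b] /= [aU bV ->]] : (in_tuple X)`_i \in X by apply: mem_nth.
  by apply: PB; apply: vbasis_mem.
rewrite (coord_span (X := in_tuple X) zX).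
by elim/big_ind: _ => // [x y Px Py|i _]; [rewrite -(scale1r x) | rewrite -[_ *: _]addr0]; apply: PL.
Qed.

Lemma lieb_sumr I (r : seq I) (f : I -> 'M[F]_n) x :
  lieb x (\sum_(i <- r) f i) = \sum_(i <- r) lieb x (f i).
Proof. by rewrite /lieb mulmx_sumr mulmx_suml -sumrB. Qed.

Lemma liebC x y : lieb x y = - lieb y x.
Proof. by rewrite /lieb opprB. Qed.

Lemma liebZr c x y : lieb x (c *: y) = c *: lieb x y.
Proof. by rewrite /lieb -scalemxAr -scalemxAl scalerBr. Qed.

Lemma lieb_suml I (r : seq I) (f : I -> 'M[F]_n) x :
  lieb (\sum_(i <- r) f i) x = \sum_(i <- r) lieb (f i) x.
Proof. by rewrite liebC lieb_sumr -sumrN; under eq_bigr do rewrite -liebC. Qed.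

Lemma liebZl c x y : lieb (c *: x) y = c *: lieb x y.
Proof. by rewrite liebC liebZr -scalerN -liebC. Qed.

Lemma lieb_mem U V x y : x \in U -> y \in V -> lieb x y \in lie_prod U V.
Proof.
move=> /coord_vbasis-> /coord_vbasis->; rewrite lieb_suml; apply: memv_suml => i _.
rewrite liebZl memvZ // lieb_sumr; apply: memv_suml => j _.
rewrite liebZr memvZ //; apply: memv_span; apply/allpairsP.
by exists ((vbasis U)`_i, (vbasis V)`_j); split=> //=; apply: mem_nth; rewrite size_tuple.
Qed.

Lemma lie_prod_sub U V W :
  (forall x y, x \in U -> y \in V -> lieb x y \in W) -> (lie_prod U V <= W)%VS.
Proof.
move=> sW; apply/subvP; apply: lie_prod_ind => //; first exact: mem0v.
by move=> c x y xW yW; rewrite memvD // memvZ.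
Qed.

Lemma lie_prodS U U' V V' :
  (U <= U')%VS -> (V <= V')%VS -> (lie_prod U V <= lie_prod U' V')%VS.
Proof.
move=> /subvP sU /subvP sV; apply: lie_prod_sub => x y /sU xU /sV yV.
exact: lieb_mem.
Qed.

Lemma lie_subalgebraP V :
  lie_subalgebra V <-> forall x y, x \in V -> y \in V -> lieb x y \in V.
Proof.
split=> [/subvP sV x y xV yV|]; last exact: lie_prod_sub.
by apply: sV; apply: lieb_mem.
Qed.

End LieProduct.

Section Adjoint.
Variables (F : fieldType) (n : nat).
Implicit Types (x y z g h : 'M[F]_n) (U V b : {vspace 'M[F]_n}).

Lemma AdE g x : Ad g x = g *m x *m invmx g.
Proof. by rewrite lfunE. Qed.

Lemma Ad_unitK g x : g \in unitmx -> Ad (invmx g) (Ad g x) = x.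
Proof. by move=> ug; rewrite !AdE invmxK !mulmxA mulVmx // mul1mx mulmxKV. Qed.

Lemma Ad_unitVK g x : g \in unitmx -> Ad g (Ad (invmx g) x) = x.
Proof. by move=> ug; rewrite -{1}(invmxK g) Ad_unitK // unitmx_inv. Qed.

Lemma invmxM g h : g \in unitmx -> h \in unitmx ->
  invmx (g *m h) = invmx h *m invmx g.
Proof.
move=> ug uh; have ugh : g *m h \in unitmx by rewrite unitmx_mul ug.
rewrite -[RHS]mulmx1 -(mulmxV ugh) !mulmxA mulmxKV //.
by rewrite mulVmx // mul1mx.
Qed.

Lemma AdM g h x : g \in unitmx -> h \in unitmx -> Ad (g *m h) x = Ad g (Ad h x).
Proof. by move=> ug uh; rewrite !AdE invmxM // !mulmxA. Qed.

Lemma Ad1 x : Ad 1%:M x = x.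
Proof. by rewrite AdE mul1mx invmx1 mulmx1. Qed.

Lemma Ad_mul g x y : g \in unitmx -> Ad g (x *m y) = Ad g x *m Ad g y.
Proof. by move=> ug; rewrite !AdE !mulmxA mulmxKV. Qed.

Lemma Ad_lieb g x y : g \in unitmx -> Ad g (lieb x y) = lieb (Ad g x) (Ad g y).
Proof. by move=> ug; rewrite /lieb linearB /= !Ad_mul. Qed.

Lemma mem_Ad_img g b x : g \in unitmx -> (x \in (Ad g @: b)%VS) = (Ad (invmx g) x \in b).
Proof.
move=> ug; apply/idP/idP => [/memv_imgP[y yb ->]|xb]; first by rewrite Ad_unitK.
by apply/memv_imgP; exists (Ad (invmx g) x); rewrite ?Ad_unitVK.
Qed.

Lemma Ad_img_mem g b x : g \in unitmx -> x \in b -> Ad g x \in (Ad g @: b)%VS.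
Proof. by move=> ug xb; rewrite mem_Ad_img // Ad_unitK. Qed.

Lemma Ad_imgM g h b : g \in unitmx -> h \in unitmx ->
  (Ad (g *m h) @: b)%VS = (Ad g @: (Ad h @: b))%VS.
Proof.
move=> ug uh; apply/vspaceP => x.
by rewrite !mem_Ad_img ?unitmx_mul ?ug // invmxM // AdM // unitmx_inv.
Qed.

Lemma Ad_img1 b : (Ad 1%:M @: b)%VS = b.
Proof. by apply/vspaceP => x; rewrite mem_Ad_img ?unitmx1 // invmx1 Ad1. Qed.

Lemma Ad_imgV g b c : g \in unitmx -> (Ad g @: b)%VS = c -> (Ad (invmx g) @: c)%VS = b.
Proof. by move=> ug <-; rewrite -Ad_imgM ?unitmx_inv // mulVmx // Ad_img1. Qed.

Lemma Ad_imgS g b c : (b <= c)%VS -> (Ad g @: b <= Ad g @: c)%VS.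
Proof. exact: limgS. Qed.

Lemma lie_prod_Ad g U V : g \in unitmx ->
  lie_prod (Ad g @: U)%VS (Ad g @: V)%VS = (Ad g @: lie_prod U V)%VS.
Proof.
move=> ug; apply/eqP; rewrite eqEsubv; apply/andP; split.
  apply: lie_prod_sub => x y; rewrite !mem_Ad_img // Ad_lieb ?unitmx_inv // => xU yV.
  exact: lieb_mem.
apply/subvP => z; rewrite mem_Ad_img // => zUV; rewrite -(Ad_unitVK z ug).
move: (Ad _ z) zUV; apply: lie_prod_ind.
- by rewrite linear0 mem0v.
- by move=> c x y xU yU; rewrite linearD linearZ memvD // memvZ.
- by move=> x y xU yV; rewrite Ad_lieb //; apply: lieb_mem; apply: Ad_img_mem.
Qed.

Lemma dimv_Ad g b : g \in unitmx -> \dim (Ad g @: b) = \dim b.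
Proof.
move=> ug; apply: limg_dim_eq; apply/eqP; rewrite -subv0; apply/subvP => x.
rewrite memv_cap memv0 memv_ker => /andP[_ /eqP Ax].
by rewrite -(Ad_unitK x ug) Ax linear0.
Qed.

End Adjoint.


(** * The bilinear form, reflections *)

(** Factor the block matrix with rows (1, -B) and (A, 1) into triangular ones in two ways. *)
Lemma det_sylvester (F : fieldType) m n (A : 'M[F]_(m, n)) (B : 'M[F]_(n, m)) :
  \det (1%:M + A *m B) = \det (1%:M + B *m A).
Proof.
have e1 : block_mx 1%:M (- B) A 1%:M =
    block_mx 1%:M 0 A 1%:M *m block_mx 1%:M (- B) 0 (1%:M + A *m B).
  rewrite mulmx_block !mul1mx !mul0mx !mulmx1 !addr0 mulmxN addrCA.
  by rewrite addNr addr0.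
have e2 : block_mx 1%:M (- B) A 1%:M =
    block_mx (1%:M + B *m A) (- B) 0 1%:M *m block_mx 1%:M 0 A 1%:M.
  rewrite mulmx_block !mul1mx !mul0mx !mulmx1 !mulmx0 !add0r mulNmx addrK.
  by [].
have := congr1 determinant e2; rewrite e1 !det_mulmx det_lblock !det_ublock.
by rewrite !det1 !mul1r !mulr1.
Qed.

Section Form.
Variables (F : numClosedFieldType) (n : nat).
Implicit Types (a b w x y z : 'cV[F]_n) (g h : 'M[F]_n).
Local Notation S := (@skew_mx F n).

Definition bform x y : F := (x^T *m S *m y) 0 0.
Local Notation B := bform.

Lemma skew_mulE x i : (S *m x) i 0 = x (rev_ord i) 0.
Proof.
rewrite mxE (bigD1 (rev_ord i)) //= mxE eqxx mul1r big1 ?addr0 // => j.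
by rewrite mxE => /negPf->; rewrite mul0r.
Qed.

Lemma bformE x y : B x y = \sum_i x i 0 * y (rev_ord i) 0.
Proof.
rewrite /bform -mulmxA mxE; apply: eq_bigr => i _.
by rewrite skew_mulE mxE.
Qed.

Lemma skew_tr : S^T = S.
Proof.
apply/matrixP => i j; rewrite !mxE; congr (_%:R).
by rewrite -(inj_eq rev_ord_inj) rev_ordK eq_sym.
Qed.

Lemma skew_sqr : S *m S = 1%:M.
Proof.
apply/matrixP => i j; rewrite mxE (bigD1 (rev_ord i)) //= big1 => [|k].
  by rewrite addr0 !mxE eqxx rev_ordK mul1r eq_sym.
by rewrite !mxE => /negPf->; rewrite mul0r.
Qed.

Lemma bformC x y : B x y = B y x.
Proof.
rewrite /bform -[in LHS](trmxK (_ *m y)) mxE !trmx_mul !trmxK skew_tr.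
by rewrite mulmxA.
Qed.

Lemma bformDl x y z : B (x + y) z = B x z + B y z.
Proof. by rewrite /bform linearD !mulmxDl mxE. Qed.
Lemma bformDr x y z : B x (y + z) = B x y + B x z.
Proof. by rewrite /bform mulmxDr mxE. Qed.
Lemma bformZl c x y : B (c *: x) y = c * B x y.
Proof. by rewrite /bform linearZ /= -!scalemxAl mxE. Qed.
Lemma bformZr c x y : B x (c *: y) = c * B x y.
Proof. by rewrite /bform -scalemxAr mxE. Qed.
Lemma bformNl x y : B (- x) y = - B x y.
Proof. by rewrite -scaleN1r bformZl mulN1r. Qed.
Lemma bformNr x y : B x (- y) = - B x y.
Proof. by rewrite -scaleN1r bformZr mulN1r. Qed.
Lemma bformBl x y z : B (x - y) z = B x z - B y z.
Proof. by rewrite bformDl bformNl. Qed.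
Lemma bformBr x y z : B x (y - z) = B x y - B x z.
Proof. by rewrite bformDr bformNr. Qed.
Lemma bform0l x : B 0 x = 0. Proof. by rewrite -(scale0r 0) bformZl mul0r. Qed.
Lemma bform0r x : B x 0 = 0. Proof. by rewrite bformC bform0l. Qed.
Definition bformP := (bformDl, bformDr, bformNl, bformNr, bformZl, bformZr,
                      bform0l, bform0r).

Lemma bform_suml I (r : seq I) (P : pred I) (f : I -> 'cV[F]_n) y :
  B (\sum_(i <- r | P i) f i) y = \sum_(i <- r | P i) B (f i) y.
Proof.
by elim/big_ind2: _ => [|x1 x2 y1 y2 <- <-|//]; rewrite ?bform0l ?bformDl.
Qed.

Lemma bform_sumr I (r : seq I) (P : pred I) (f : I -> 'cV[F]_n) y :
  B y (\sum_(i <- r | P i) f i) = \sum_(i <- r | P i) B y (f i).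
Proof. by rewrite bformC bform_suml; under eq_bigr do rewrite bformC. Qed.

Definition e (i : 'I_n) : 'cV[F]_n := delta_mx i 0.

Lemma eE i k : e i k 0 = (k == i)%:R.
Proof. by rewrite mxE eqxx andbT. Qed.

Lemma bform_el i x : B (e i) x = x (rev_ord i) 0.
Proof.
rewrite bformE (bigD1 i) //= eE eqxx mul1r big1 ?addr0 // => j /negPf ji.
by rewrite eE ji mul0r.
Qed.

Lemma bform_er i x : B x (e i) = x (rev_ord i) 0.
Proof. by rewrite bformC bform_el. Qed.

Lemma bform_ee i j : B (e i) (e j) = (j == rev_ord i)%:R.
Proof. by rewrite bform_el eE eq_sym. Qed.

Lemma coord_bform x k : x k 0 = B (e (rev_ord k)) x.
Proof. by rewrite bform_el rev_ordK. Qed.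

Lemma col_sum_e x : x = \sum_i x i 0 *: e i.
Proof.
apply/colP => k; rewrite summxE (bigD1 k) //= mxE eE eqxx mulr1 big1 ?addr0 //.
by move=> j /negPf jk; rewrite mxE eE eq_sym jk mulr0.
Qed.

Lemma bform_nondeg x : (forall y, B x y = 0) -> x = 0.
Proof. by move=> x0; apply/colP => k; rewrite coord_bform bformC x0 mxE. Qed.

Lemma mulmx_eE g i k : (g *m e i) k 0 = g k i.
Proof. by rewrite -colE mxE. Qed.

Lemma mx_eq_on_e g h : (forall i, g *m e i = h *m e i) -> g = h.
Proof. by move=> gh; apply/matrixP => k i; rewrite -!mulmx_eE gh. Qed.

Definition orth : set 'M[F]_n := [set g | g^T *m S *m g = S].

Lemma bform_mulmx g x y : B (g *m x) y = B x (S *m g^T *m S *m y).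
Proof. by rewrite /bform trmx_mul !mulmxA -(mulmxA _ S S) skew_sqr mulmx1. Qed.

Lemma orth_bform g x y : orth g -> B (g *m x) (g *m y) = B x y.
Proof. by move=> og; rewrite /bform trmx_mul -!mulmxA (mulmxA S) (mulmxA g^T) (mulmxA g^T) og. Qed.

Lemma orthP g : (forall x y, B (g *m x) (g *m y) = B x y) -> orth g.
Proof.
move=> og; apply/matrixP => i j.
have := og (e i) (e j); rewrite /bform trmx_mul /e.
rewrite -!mulmxA !(mulmxA g^T) !(mulmxA (g^T *m S)) -!colE !trmx_delta -!rowE.
by rewrite !mxE.
Qed.

Lemma orth1 : orth 1%:M.
Proof. by rewrite /orth /= trmx1 mul1mx mulmx1. Qed.

Lemma orthM g h : orth g -> orth h -> orth (g *m h).
Proof. by move=> og oh; apply: orthP => x y; rewrite -!mulmxA !orth_bform. Qed.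

Lemma orth_mulV g : orth g -> (S *m g^T *m S) *m g = 1%:M.
Proof. by move=> og; rewrite -!mulmxA (mulmxA g^T) og skew_sqr. Qed.

Lemma orth_unit g : orth g -> g \in unitmx.
Proof. by move/orth_mulV/mulmx1_unit => []. Qed.

Lemma orth_inv g : orth g -> invmx g = S *m g^T *m S.
Proof.
move=> og; rewrite -[RHS]mulmx1 -(mulmxV (orth_unit og)) mulmxA orth_mulV //.
by rewrite mul1mx.
Qed.

Lemma orthV g : orth g -> orth (invmx g).
Proof.
move=> og; apply: orthP => x y.
by rewrite -(orth_bform _ _ og) !mulKVmx ?orth_unit.
Qed.

Lemma orth_fixV g x : orth g -> g *m x = x -> invmx g *m x = x.
Proof. by move=> og gx; rewrite -{1}gx mulKmx ?orth_unit. Qed.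

Lemma bform_invl g x y : orth g -> B (invmx g *m x) y = B x (g *m y).
Proof. by move=> og; rewrite -(orth_bform _ _ og) mulKVmx ?orth_unit. Qed.

Lemma bform_orthl g x y : orth g -> B (g *m x) y = B x (invmx g *m y).
Proof. by move=> og; rewrite -(orth_bform x _ og) mulKVmx ?orth_unit. Qed.

Definition refl a : 'M[F]_n := 1%:M - (2 / B a a) *: (a *m (a^T *m S)).

Lemma refl_mul a x : refl a *m x = x - (2 * B a x / B a a) *: a.
Proof.
rewrite mulmxBl mul1mx -scalemxAl -mulmxA [a^T *m S *m x]mx11_scalar mul_mx_scalar.
by rewrite scalerA mulrAC.
Qed.

Lemma orth_refl a : B a a != 0 -> orth (refl a).
Proof.
move=> a0; apply: orthP => x y; rewrite !refl_mul !bformP (bformC x a).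
by field.
Qed.

(** A rank one perturbation of the identity: [det_sylvester] reduces it to the 1 x 1 determinant 1 -
    2. *)
Lemma det_refl a : B a a != 0 -> \det (refl a) = -1.
Proof.
move=> a0; rewrite /refl scalemxAl -mulNmx det_sylvester det_mx11 !mxE eqxx.
have -> : \sum_j (a^T *m S) 0 j * (- (2 / B a a *: a)) j 0 = - 2.
  transitivity (- (2 / B a a) * B a a); last by field.
  rewrite /bform [in RHS]mxE mulr_sumr; apply: eq_bigr => j _.
  by rewrite !mxE; ring.
by rewrite mulr1n; ring.
Qed.

Lemma refl_fix a x : B a x = 0 -> refl a *m x = x.
Proof. by move=> ax; rewrite refl_mul ax mulr0 mul0r scale0r subr0. Qed.

Lemma refl_swap a b : B a a = B b b -> B (a - b) (a - b) != 0 ->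
  refl (a - b) *m a = b.
Proof.
move=> ab d0; rewrite refl_mul.
have -> : 2 * B (a - b) a / B (a - b) (a - b) = 1.
  suff -> : 2 * B (a - b) a = B (a - b) (a - b) by rewrite divff.
  rewrite !bformP -ab (bformC b a). ring.
by rewrite scale1r opprB addrC subrK.
Qed.

End Form.
Arguments e {F n}.
Arguments orth F n : clear implicits.

(** * The vector fixed by K, Witt's theorem and the Cartan-Dieudonne theorem *)

Section Flag.
Variables (F : numClosedFieldType) (p : nat).
Local Notation n := p.+2.
Local Notation B := (@bform F n).
Implicit Types (a b w x y z : 'cV[F]_n) (g h : 'M[F]_n).

Definition mid : 'I_n := inord n./2.
Definition m : nat := n.-1./2.

Lemma val_mid : mid = n./2 :> nat.
Proof. by rewrite /mid inordK //; lia. Qed.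

Lemma mid_m : mid = (n - m.+1)%N :> nat.
Proof. by rewrite val_mid /m; lia. Qed.

(* The involution theta is conjugation by the reflection in this vector. *)
Definition v : 'cV[F]_n := e mid - (~~ odd n)%:R *: e (rev_ord mid).

Lemma rev_mid_odd : odd n -> rev_ord mid = mid.
Proof. by move=> on; apply: val_inj; rewrite /= val_mid; lia. Qed.

Lemma rev_mid_even : ~~ odd n -> rev_ord mid != mid.
Proof. by move=> on; rewrite -val_eqE /= val_mid; lia. Qed.

Lemma vE k : v k 0 = (k == mid)%:R - (~~ odd n && (k == rev_ord mid))%:R.
Proof.
by rewrite mxE eE [X in _ + X]mxE [X in _ - X]mxE eE; case: (odd n); rewrite ?mul0r ?mul1r.
Qed.

Definition q : F := B v v.

Lemma qE : q = if odd n then 1 else - 2.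
Proof.
rewrite /q /v; case: ifP => on.
  by rewrite scale0r subr0 bform_ee rev_mid_odd // eqxx.
have h := negPf (rev_mid_even (negbT on)); rewrite scale1r !bformP !bform_ee.
by rewrite !rev_ordK !eqxx (eq_sym mid) h mulr0n mulr1n; ring.
Qed.

Lemma q_neq0 : q != 0.
Proof. by rewrite qE; case: ifP => _; rewrite ?oner_eq0 // oppr_eq0 pnatr_eq0. Qed.

Lemma v_supp (k : 'I_n) : (k < m)%N || (n - m <= k)%N -> v k 0 = 0.
Proof.
move=> km; rewrite vE.
have /negPf-> : k != mid by rewrite -val_eqE /= mid_m; move: km; rewrite /m; lia.
have /negPf-> : k != rev_ord mid.
  by rewrite -val_eqE /= val_mid; move: km; rewrite /m; lia.
by rewrite andbF subrr.
Qed.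

Lemma bform_ve (i : 'I_n) : (i < m)%N -> B v (e i) = 0.
Proof. by move=> im; rewrite bform_er v_supp //=; move: im; rewrite /m; lia. Qed.

(* The orthogonal complement of this span is the one for n - i, so the whole
   standard flag, isotropic or not, is described by one predicate. *)
Definition below (i : nat) w : Prop := forall k : 'I_n, (i <= k)%N -> w k 0 = 0.

Lemma belowD i x y : below i x -> below i y -> below i (x + y).
Proof. by move=> bx bz k ik; rewrite mxE bx // bz // addr0. Qed.

Lemma belowZ i c x : below i x -> below i (c *: x).
Proof. by move=> bx k ik; rewrite mxE bx // mulr0. Qed.

Lemma belowN i x : below i x -> below i (- x).
Proof. by move=> bx; rewrite -scaleN1r; apply: belowZ. Qed.

Lemma belowB i x y : below i x -> below i y -> below i (x - y).
Proof. by move=> bx /belowN; apply: belowD. Qed.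

Lemma below0 i : below i 0.
Proof. by move=> k _; rewrite mxE. Qed.

Lemma below_le i j x : (i <= j)%N -> below i x -> below j x.
Proof. by move=> ij bx k jk; apply: bx; apply: leq_trans jk. Qed.

Lemma below_e i (k : 'I_n) : (k < i)%N -> below i (e k).
Proof. by move=> ki j ij; rewrite eE -val_eqE /=; case: eqP => //; lia. Qed.

Lemma below_orthP i w :
  (forall j : 'I_n, (j < i)%N -> B (e j) w = 0) <-> below (n - i) w.
Proof.
split=> [ow k ik|bw j ji]; last by rewrite bform_el bw //=; lia.
by rewrite coord_bform ow //=; move: (ltn_ord k); lia.
Qed.

Lemma below_bform i w z : below i w -> below (n - i) z -> B w z = 0.
Proof.
move=> bw /below_orthP oz; rewrite (col_sum_e w) bform_suml big1 // => j _.
rewrite bformZl; case: (ltnP j i) => ji; first by rewrite oz ?mulr0.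
by rewrite bw // mul0r.
Qed.

Lemma below_v : below (n - m) v.
Proof. by move=> k km; apply: v_supp; rewrite km orbT. Qed.

Lemma below_bform_v i w : (i <= m)%N -> below i w -> B v w = 0.
Proof.
move=> im bw; rewrite bformC; apply: (below_bform bw).
by apply: below_le below_v; lia.
Qed.

Lemma below_ind (P : 'cV[F]_n -> Prop) i :
  P 0 -> (forall x y, P x -> P y -> P (x + y)) ->
  (forall (c : F) (j : 'I_n), (j < i)%N -> P (c *: e j)) -> forall w, below i w -> P w.
Proof.
move=> P0 PD Pe w bw; rewrite (col_sum_e w); elim/big_ind: _ => // j _.
by case: (ltnP j i) => ji; [apply: Pe | rewrite bw // scale0r].
Qed.

(** For isotropic a and b one has B(a - b, a - b) = - 2 B(a, b), so the reflection in a - b exists.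
    It fixes everything orthogonal to both. *)
Lemma refl_swap_isotropic (v0 a b : 'cV[F]_n) i :
  B a a = 0 -> B b b = 0 -> B a b != 0 -> B a v0 = 0 -> B b v0 = 0 ->
  below (n - i) a -> below (n - i) b ->
  exists g, [/\ orth F n g, g *m v0 = v0,
    forall j : 'I_n, (j < i)%N -> g *m e j = e j & g *m a = b].
Proof.
move=> aa bb ab av bv ba bz; exists (refl (a - b)).
have d0 : B (a - b) (a - b) != 0.
  have -> : B (a - b) (a - b) = - 2 * B a b by rewrite !bformP aa bb (bformC b a); ring.
  by rewrite mulf_neq0 // oppr_eq0 pnatr_eq0.
split; first exact: orth_refl.
- by rewrite refl_fix // !bformP av bv subrr.
- move=> j ji; rewrite refl_fix // bformC.
  by move/below_orthP: (belowB ba bz); apply.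
- by rewrite refl_swap // aa bb.
Qed.

(** If B(e_i, w) is nonzero one reflection suffices. Otherwise pass through an isotropic z that
    pairs nontrivially with both. The case v0 = v serves the group fixing v, the case v0 = 0 the
    full orthogonal group. *)
Lemma witt_step (v0 w : 'cV[F]_n) (i : 'I_n) :
  v0 = 0 \/ v0 = v -> (i < m)%N ->
  below (n - i) w -> B w v0 = 0 -> B w w = 0 -> ~ below i w ->
  exists g, [/\ orth F n g, g *m v0 = v0,
    forall j : 'I_n, (j < i)%N -> g *m e j = e j & g *m e i = w].
Proof.
move=> v0v im bw wv ww nbw.
have m2 : (m.*2 < n)%N by rewrite /m; lia.
have ei0 : B (e i) (e i) = 0.
  by rewrite bform_ee; case: eqP => // /(congr1 val) /=; lia.
have bei : below (n - i) (e i) by apply: below_e; lia.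
have v0e (j : 'I_n) : (j < m)%N -> B v0 (e j) = 0.
  by move=> jm; case: v0v => ->; rewrite ?bform0l // bform_ve.
have v0r (j : 'I_n) : (j < m)%N -> B v0 (e (rev_ord j)) = 0.
  move=> jm; rewrite bform_er rev_ordK; case: v0v => ->; first by rewrite mxE.
  by rewrite v_supp ?jm.
have [ew|ew] := eqVneq (B (e i) w) 0; last first.
  by apply: refl_swap_isotropic => //; rewrite bformC v0e.
suff [z [zz bz zv ze zw]] : exists z, [/\ B z z = 0, below (n - i) z, B z v0 = 0,
    B (e i) z != 0 & B z w != 0].
  have eiv : B (e i) v0 = 0 by rewrite bformC v0e.
  have [g [og gv ge gei]] := refl_swap_isotropic ei0 zz ze eiv zv bei bz.
  have [h [oh hv he hz]] := refl_swap_isotropic zz ww zw zv wv bz bw.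
  exists (h *m g); split; first exact: orthM.
  - by rewrite -mulmxA gv.
  - by move=> j ji; rewrite -mulmxA ge // he.
  - by rewrite -mulmxA gei.
have eri : B (e i) (e (rev_ord i)) = 1 by rewrite bform_ee eqxx.
have rr0 : B (e (rev_ord i)) (e (rev_ord i)) = 0.
  by rewrite bform_ee; case: eqP => // /(congr1 val) /=; lia.
have ber : below (n - i) (e (rev_ord i)) by apply: below_e => /=; lia.
(* The vector dual to e_i pairs to 1 with e_i, and its pairing with w is the i-th coordinate of
   w. *)
have [wi|wi] := eqVneq (w i 0) 0; last first.
  exists (e (rev_ord i)); split=> //; first by rewrite bformC v0r.
  - by rewrite eri oner_eq0.
  - by rewrite bform_el rev_ordK.
(* Coordinate i of w is 0 and so is the dual one, so a nonzero coordinate that witnesses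
   [~ below i w] sits strictly between them. *)
have [k ik wk] : exists2 k : 'I_n, (i < k < n - i.+1)%N & w k 0 != 0.
  apply: contrapT => nk; apply: nbw => k ik; apply/eqP; apply: contraT => wk.
  case: nk; exists k => //; rewrite ltn_neqAle ik andbT.
  have -> /= : i != k :> nat by apply: contraNneq wk => /val_inj <-; apply/eqP.
  rewrite ltn_neqAle; apply/andP; split; last first.
    rewrite leqNgt; apply: contra wk => lk; rewrite bw //; lia.
  apply: contraNneq wk => kr; have -> : k = rev_ord i by apply: val_inj.
  by rewrite -bform_el ew.
(* Make the dual of e_k orthogonal to v0; for v0 = 0 the correction is 0 whatever c is. *)
pose c := B (e (rev_ord k)) v0 / B v0 v0.
pose y := e (rev_ord k) - c *: v0.
have yv : B y v0 = 0.
  rewrite /y /c !bformP; case: v0v => ->; first by rewrite !bformP mulr0 subr0.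
  by rewrite divfK ?subrr // q_neq0.
have yw : B y w = w k 0.
  by rewrite /y !bformP bform_el rev_ordK (bformC v0) wv mulr0 subr0.
have ye : B y (e i) = 0.
  rewrite /y !bformP v0e // mulr0 subr0 bform_ee rev_ordK.
  by case: eqP => // eik; move: ik; rewrite eik; lia.
have yr : B y (e (rev_ord i)) = 0.
  rewrite /y !bformP v0r // mulr0 subr0 bform_ee rev_ordK.
  by case: eqP => // /(congr1 val) /= eik; move: ik; lia.
have by_ : below (n - i) y.
  rewrite /y; apply: belowB; first by apply: below_e => /=; lia.
  apply: belowZ; case: v0v => ->; first exact: below0.
  by apply: below_le below_v; lia.
(* The dual of e_i ensures the pairing with e_i, y the pairing with w, and the multiple of e_i
   cancels B(y, y). *)
clearbody y; exists (e (rev_ord i) + y - (B y y / 2) *: e i); split.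
- rewrite !bformP ye (bformC (e i) y) ye yr (bformC (e _) y) yr rr0 ei0 eri.
  by rewrite (bformC _ (e i)) eri; field.
- by apply: belowB; [apply: belowD | apply: belowZ].
- by rewrite !bformP yv !(bformC _ v0) v0r // v0e // mulr0 subr0 addr0.
- by rewrite !bformP eri ei0 (bformC (e i) y) ye mulr0 subr0 addr0 oner_eq0.
- by rewrite !bformP yw ew mulr0 subr0 bform_el rev_ordK wi add0r.
Qed.

Definition eps_sign (k : 'I_n) : F :=
  if (k < rev_ord k)%N then 1 else if (rev_ord k < k)%N then -1 else 0.

(** An orthogonal basis of anisotropic vectors e_k + e_-k and e_k - e_-k, with signs such that v is
    its member at [mid]. Fixing v then amounts to leaving out one index. *)
Definition eps (k : 'I_n) : 'cV[F]_n := e k + eps_sign k *: e (rev_ord k).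

Lemma eps_mid : eps mid = v.
Proof.
rewrite /eps /eps_sign /v -scaleNr; congr (_ + _ *: _).
have [on|on] := boolP (odd n); first by rewrite rev_mid_odd // ltnn oppr0.
have e2 : rev_ord mid = (n - mid.+1)%N :> nat by [].
move: e2; rewrite val_mid => ->.
case: ifP => h1; first by exfalso; move: h1 on; lia.
by case: ifP => h2; [rewrite mulr1n | exfalso; move: h2 on; lia].
Qed.

Lemma eps_orth j k : j != k -> B (eps j) (eps k) = 0.
Proof.
move=> jk; rewrite /eps !bformP !bform_ee !rev_ordK (inj_eq rev_ord_inj).
have [kj|kj] := eqVneq k (rev_ord j); last first.
  have /negPf-> : rev_ord k != j by rewrite -(inj_eq rev_ord_inj) rev_ordK.
  by rewrite (eq_sym k j) (negPf jk) !mulr0 !addr0.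
rewrite kj rev_ordK eqxx (eq_sym (rev_ord j)) -kj (negPf jk) /eps_sign.
have jr : (j == rev_ord j :> nat) = false.
  by rewrite (eqtype.val_eqE j) -kj; apply: negbTE.
rewrite kj rev_ordK; case: (ltngtP j (rev_ord j)) => [_|_|/eqP]; last by rewrite jr.
  by ring.
by ring.
Qed.

Lemma eps_norm k : B (eps k) (eps k) != 0.
Proof.
rewrite /eps !bformP !bform_ee !rev_ordK !eqxx /eps_sign.
case: (ltngtP k (rev_ord k)) => kr.
- have /negPf-> : k != rev_ord k by apply/negP => /eqP E; move: kr; rewrite -E ltnn.
  have /negPf-> : rev_ord k != k by apply/negP => /eqP E; move: kr; rewrite E ltnn.
  by rewrite !mulr0 !addr0 add0r !mulr1 -mulr2n pnatr_eq0.
- have /negPf-> : k != rev_ord k by apply/negP => /eqP E; move: kr; rewrite -E ltnn.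
  have /negPf-> : rev_ord k != k by apply/negP => /eqP E; move: kr; rewrite E ltnn.
  by rewrite !mulr0 addr0 add0r !mulr1 -opprD oppr_eq0 -mulr2n pnatr_eq0.
- have <- : k = rev_ord k by apply: val_inj.
  by rewrite eqxx !mul0r !addr0 oner_eq0.
Qed.

Lemma eps_fix_eq1 g : (forall k, g *m eps k = eps k) -> g = 1%:M.
Proof.
move=> ge; apply: mx_eq_on_e => k; rewrite mul1mx.
wlog kr : k / (k <= rev_ord k)%N.
  move=> fix_lt; have [/fix_lt//|rk] := leqP k (rev_ord k).
  have := ge k; rewrite /eps mulmxDr -scalemxAr (fix_lt (rev_ord k)).
    by move/addIr.
  by rewrite rev_ordK ltnW.
have [kr'|kr'] := ltnP k (rev_ord k); last first.
  have := ge k; rewrite /eps /eps_sign ltnNge kr' ltnNge kr /=.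
  by rewrite scale0r addr0.
have := ge (rev_ord k); have := ge k.
rewrite /eps /eps_sign rev_ordK kr' ltnNge kr /= scale1r scaleN1r.
rewrite mulmxDr mulmxDr mulmxN => e1 e2.
have : (g *m e k + g *m e (rev_ord k)) - (g *m e (rev_ord k) - g *m e k) =
    (e k + e (rev_ord k)) - (e (rev_ord k) - e k) by rewrite e1 e2.
rewrite !opprB [in LHS]addrACA [in RHS]addrACA !subrr !addr0 -!mulr2n.
by rewrite -!scaler_nat => /(scalerI _); apply; rewrite pnatr_eq0.
Qed.

Definition refl_prod (s : seq 'cV[F]_n) : 'M[F]_n :=
  foldr (fun a h => refl a *m h) 1%:M s.

Lemma refl_involutive a g : B a a != 0 -> refl a *m (refl a *m g) = g.
Proof.
move=> a0; apply: mx_eq_on_e => k; rewrite -!mulmxA.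
set y := g *m e k; rewrite [LHS]refl_mul refl_mul.
have -> : 2 * B a (y - (2 * B a y / B a a) *: a) / B a a = - (2 * B a y / B a a).
  by rewrite !bformP; field.
by rewrite scaleNr opprK subrK.
Qed.

Lemma det_refl_prod s :
  {in s, forall a, B a a != 0} -> \det (refl_prod s) = (-1) ^+ size s.
Proof.
elim: s => [|a s IHs] s0; first by rewrite det1.
rewrite /= det_mulmx det_refl; last by apply: s0; rewrite mem_head.
by rewrite IHs ?exprS // => b bs; apply: s0; rewrite inE bs orbT.
Qed.

(** Induction on the list of basis vectors that g may move. With b = eps_k and a = g b, the
    reflection in a - b restores b if a - b is anisotropic. If not, a + b is, because B(a + b, a +
    b) + B(a - b, a - b) = 4 B(b, b), and two reflections send a to -b and then to b. All vectors
    used are orthogonal to the basis vectors already fixed. *)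
Lemma cartan_dieudonne (r : seq 'I_n) g :
  orth F n g -> (forall k, k \notin r -> g *m eps k = eps k) ->
  exists2 s, {in s, forall a, B a a != 0 /\ forall k, k \notin r -> B a (eps k) = 0} &
    g = refl_prod s.
Proof.
elim: r g => [|k r IHr] g og ge.
  by exists [::] => //; apply: eps_fix_eq1 => k; apply: ge.
have [kr|kr] := boolP (k \in r).
  have sub j : j \notin r -> j \notin k :: r.
    by rewrite inE negb_or => jr; rewrite jr andbT; apply: contraNneq jr => ->.
  have sub' j : j \notin k :: r -> j \notin r by rewrite inE negb_or => /andP[].
  have [s s0 gs] := IHr g og (fun j jr => ge j (sub j jr)).
  exists s => // a /s0[a0 ae]; split=> // j /sub'; exact: ae.
pose a := g *m eps k; pose b := eps k.
have sub s : {in s, forall a, B a a != 0 /\ forall k, k \notin r -> B a (eps k) = 0} ->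
    {in s, forall a, B a a != 0 /\ forall j, j \notin k :: r -> B a (eps j) = 0}.
  move=> s0 c /s0[c0 ce]; split=> // j; rewrite inE negb_or => /andP[_]; exact: ce.
have ab : B a a = B b b by apply: orth_bform.
have be j : j \notin k :: r -> B b (eps j) = 0.
  by rewrite inE negb_or => /andP[jk _]; apply: eps_orth; rewrite eq_sym.
have ae j : j \notin k :: r -> B a (eps j) = 0.
  by move=> jr; rewrite -(ge j jr) orth_bform //; apply: be.
have [d0|d0] := eqVneq (B (a - b) (a - b)) 0; last first.
  have [||s s0 hs] := IHr (refl (a - b) *m g).
  - by apply: orthM => //; apply: orth_refl.
  - move=> j jr; rewrite -mulmxA; have [->|jk] := eqVneq j k.
      by rewrite -/a refl_swap.
    have jkr : j \notin k :: r by rewrite inE negb_or jk.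
    by rewrite ge // refl_fix // bformBl ae // be // subrr.
  exists ((a - b) :: s) => [c|]; last by rewrite /= -hs refl_involutive.
  rewrite inE => /orP[/eqP->|/(sub _ _ s0)//]; split=> // j jr.
  by rewrite bformBl ae // be // subrr.
have b0 : B b b != 0 := eps_norm k.
have s0 : B (a + b) (a + b) != 0.
  have : B (a + b) (a + b) + B (a - b) (a - b) = 4 * B b b.
    have para x y : B (x + y) (x + y) + B (x - y) (x - y) = 2 * B x x + 2 * B y y.
      by rewrite !bformP; ring.
    by rewrite para ab; ring.
  by rewrite d0 addr0 => ->; rewrite mulf_neq0 // pnatr_eq0.
have [||s s1 hs] := IHr (refl b *m (refl (a + b) *m g)).
- by apply: orthM; [apply: orth_refl | apply: orthM => //; apply: orth_refl].
- move=> j jr; rewrite -!mulmxA; have [->|jk] := eqVneq j k.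
    rewrite -/a; have := @refl_swap _ _ a (- b); rewrite opprK => -> //.
      rewrite refl_mul bformNr (_ : 2 * - B b b / B b b = - 2); last by field.
      by rewrite scaleNr opprK scaler_nat mulr2n addKr.
    by rewrite bformNl bformNr opprK.
  have jkr : j \notin k :: r by rewrite inE negb_or jk.
  by rewrite ge // !refl_fix // ?be // bformDl ae // be // addr0.
exists ((a + b) :: b :: s) => [c|]; last by rewrite /= -hs !refl_involutive.
rewrite !inE => /or3P[/eqP->|/eqP->|/(sub _ _ s1)//]; last by split=> // j; apply: be.
by split=> // j jr; rewrite bformDl ae // be // addr0.
Qed.

End Flag.
Arguments mid {p}.
Arguments m p : simpl never.
Arguments v F p : clear implicits.
Arguments q F p : clear implicits.

(** * The group K *)

Section GroupK.
Variables (F : numClosedFieldType) (p : nat).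
Local Notation n := p.+2.
Local Notation B := (@bform F n).
Local Notation S := (@skew_mx F n).
Local Notation v := (v F p).
Local Notation q := (q F p).
Implicit Types (a b w x y z : 'cV[F]_n) (g h : 'M[F]_n).

Definition OW : set 'M[F]_n := [set g | orth F n g /\ g *m v = v].
Definition SOW : set 'M[F]_n := [set g | OW g /\ \det g = 1].

Lemma s_mx_refl : s_mx F n = refl v.
Proof.
apply/matrixP => i j.
rewrite -[RHS]mulmx_eE refl_mul bform_er mxE eE [X in _ + X]mxE [X in _ - X]mxE !vE -/q.
have rm := val_mid p; have im : (i == mid) = (i == n./2 :> nat) by rewrite -val_eqE /= rm.
rewrite /s_mx qE (inj_eq rev_ord_inj) im; case: ifP => on.
  rewrite mxE !andFb subr0 (eq_sym i j) (_ : (rev_ord j == mid) = (j == n./2 :> nat)); last first.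
    by rewrite -(inj_eq rev_ord_inj) rev_ordK rev_mid_odd // -val_eqE /= rm.
  rewrite mulr0n subr0 divr1; have [->|ji] := eqVneq j i.
    by case: (_ == _) => /=; rewrite ?expr1 ?expr0 ?mulr1n ?mulr0n; ring.
  case: (eqVneq (j : nat) n./2) => jl; case: (eqVneq (i : nat) n./2) => il;
    rewrite /= ?mulr1n ?mulr0n ?mulr0 ?mul0r ?subr0 //.
  by case/eqP: ji; apply: val_inj; rewrite /= jl il.
rewrite mxE /swap_mid andTb.
have jm : (rev_ord j == mid) = (j == n./2.-1 :> nat).
  rewrite -(inj_eq rev_ord_inj) rev_ordK -val_eqE /= rm; congr (_ == _).
  by move: on; lia.
have irm : (i == rev_ord mid) = (i == n./2.-1 :> nat).
  by rewrite -val_eqE /= rm; congr (_ == _); move: on; lia.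
have jm' : (j == mid) = (j == n./2 :> nat) by rewrite -val_eqE /= rm.
rewrite jm irm jm' andTb -[i == j]val_eqE /=.
have l0 : (n./2 == n./2.-1)%N = false by lia.
have l1 : (n./2.-1 == n./2)%N = false by lia.
have -> : forall x y : F, 2 * x / (- 2) * y = - (x * y) by move=> x y; field.
rewrite opprK; case: (eqVneq (j : nat) n./2.-1) => [->|jl].
  case: (eqVneq (i : nat) n./2) => [->|il]; rewrite ?l0 ?l1.
    by rewrite /= ?mulr1n ?mulr0n; ring.
  by case: (_ == _); rewrite /= ?mulr1n ?mulr0n; ring.
case: (eqVneq (j : nat) n./2) => [->|jl'].
  case: (eqVneq (i : nat) n./2) => [->|il]; rewrite ?l0 ?l1.
    by rewrite /= ?mulr1n ?mulr0n; ring.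
  by case: (_ == _); rewrite /= ?mulr1n ?mulr0n; ring.
by rewrite /= ?mulr0n; ring.
Qed.

Lemma v_neq0 : v != 0.
Proof.
by apply: contraNneq (q_neq0 F p) => v0; rewrite (_ : q = B v v) // {1}v0 bform0l.
Qed.

Lemma OW_orth g : OW g -> orth F n g. Proof. by case. Qed.
Lemma SOW_OW g : SOW g -> OW g. Proof. by case. Qed.

Lemma OW1 : OW 1%:M. Proof. by split; [exact: orth1 | rewrite mul1mx]. Qed.
Lemma OWM g h : OW g -> OW h -> OW (g *m h).
Proof. by move=> [og gv] [oh hv]; split; [exact: orthM | rewrite -mulmxA hv]. Qed.
Lemma OWV g : OW g -> OW (invmx g).
Proof. by move=> [og gv]; split; [exact: orthV | exact: orth_fixV]. Qed.

Lemma SOW1 : SOW 1%:M. Proof. by split; [exact: OW1 | rewrite det1]. Qed.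
Lemma SOWM g h : SOW g -> SOW h -> SOW (g *m h).
Proof. by move=> [og dg] [oh dh]; split; [exact: OWM | rewrite det_mulmx dg dh mulr1]. Qed.
Lemma SOWV g : SOW g -> SOW (invmx g).
Proof. by move=> [og dg]; split; [exact: OWV | rewrite det_inv dg invr1]. Qed.

Lemma SOW_conj h g : OW h -> SOW g -> SOW (h *m g *m invmx h).
Proof.
move=> oh [og dg]; split; first by apply: OWM; [apply: OWM | apply: OWV].
rewrite !det_mulmx dg mulr1 det_inv divff //.
by rewrite -unitfE -unitmxE orth_unit; case: oh.
Qed.

Lemma OW_refl a : B a a != 0 -> B a v = 0 -> OW (refl a).
Proof. by move=> a0 av; split; [exact: orth_refl | exact: refl_fix]. Qed.

Lemma OW_refl_prod g : OW g ->
  exists2 s, {in s, forall a, B a a != 0 /\ B a v = 0} & g = refl_prod s.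
Proof.
move=> [og gv]; have mem k : (k \notin [seq k <- enum 'I_n | k != mid]) = (k == mid).
  by rewrite mem_filter mem_enum andbT negbK.
have [|s s0 ->] := @cartan_dieudonne F p [seq k <- enum 'I_n | k != mid] g og.
  by move=> k; rewrite mem => /eqP->; rewrite eps_mid.
exists s => // a /s0[a0 av]; split=> //.
by have := av mid; rewrite eps_mid; apply; rewrite mem.
Qed.

Lemma OW_det g : OW g -> \det g = 1 \/ \det g = -1.
Proof.
move=> /OW_refl_prod[s s0 ->]; rewrite det_refl_prod => [|a /s0[]//].
by rewrite -signr_odd; case: odd; [right|left].
Qed.

(* Join a to b by a line: r_a r_{a + t (b - a)} is the identity at t = 0. *)
Lemma refl_pair_irreducible a b :
  B a a != 0 -> B a v = 0 -> B b b != 0 -> B b v = 0 ->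
  exists X, [/\ zirreducible X, X `<=` SOW, X 1%:M & X (refl a *m refl b)].
Proof.
move=> a0 av b0 bv; pose c t := a + t *: (b - a).
pose N : {poly F} := (B a a)%:P + (2 * B a (b - a)) *: 'X + B (b - a) (b - a) *: 'X^2.
have NE t : N.[t] = B (c t) (c t).
  by rewrite /N !hornerD !hornerZ hornerC hornerX hornerXn /c !bformP (bformC b a); ring.
exists [set refl a *m refl (c t) | t in [set t | N.[t] != 0]]; split.
- apply: zirreducible_rational_curve.
    by apply: contraNneq a0 => N0; have := NE 0; rewrite N0 horner0 /c scale0r addr0 => <-.
  have algN := rational1_algebra N.
  have cin : entries_in (rational1 N) c.
    apply: entries_add => //; first exact: entries_cst.
    apply: entries_scale => //; last exact: entries_cst.
    have -> : (fun t : F => t) = (fun t => ('X : {poly F}).[t]) by apply: funext => t; rewrite hornerX.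
    exact: rational1_poly.
  apply: entries_mul => //; first exact: entries_cst.
  apply: entries_sub => //; first exact: entries_cst.
  apply: entries_scale => //.
    under eq_fun do rewrite -NE.
    by apply: algebra_mul => //; [apply: algebra_cst | apply: rational1_inv].
  apply: entries_mul => //; apply: entries_mul => //; last exact: entries_cst.
  exact: entries_tr.
- move=> _ [t /= Nt <-]; rewrite NE in Nt.
  have ctv : B (c t) v = 0 by rewrite /c bformDl bformZl bformBl bv av subrr mulr0 addr0.
  split; first by apply: OWM; apply: OW_refl.
  by rewrite det_mulmx !det_refl // mulrNN mulr1.
- exists 0; first by rewrite /= NE /c scale0r addr0.
  by rewrite /c scale0r addr0 -[refl a in X in _ *m X]mulmx1 refl_involutive.
- by exists 1; rewrite /= ?NE /c scale1r addrC subrK.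
Qed.

Lemma zirreducible_mul (X Y : set 'M[F]_n) : zirreducible X -> zirreducible Y ->
  zirreducible [set z | exists2 x, X x & exists2 y, Y y & z = x *m y].
Proof.
move=> iX iY; apply: zirreducible_image2 iX iY => [x _|y _].
  apply: entries_mul; [exact: regular_algebra | | exact: entries_id].
  by apply: entries_cst; apply: regular_algebra.
apply: entries_mul; [exact: regular_algebra | exact: entries_id | ].
by apply: entries_cst; apply: regular_algebra.
Qed.

Lemma SOW_path g : SOW g ->
  exists X, [/\ zirreducible X, X `<=` SOW, X 1%:M & X g].
Proof.
move=> [/OW_refl_prod[s s0 ->]]; rewrite det_refl_prod => [|a /s0[]//].
(* Reflections are removed in pairs; a single one left over would contradict the determinant. *)
have [k] := ubnP (size s); elim: k s s0 => // k IHk [|a [|b s]] s0 /=.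
- move=> _ _; exists [set 1%:M]; split=> //; first exact: zirreducible_set1.
  by move=> _ ->; apply: SOW1.
- by move=> _ /eqP; rewrite expr1 eq_sym -subr_eq0 opprK -mulr2n pnatr_eq0.
rewrite ltnS => sk; rewrite !exprS !mulN1r opprK => ds.
have [a0 av] : B a a != 0 /\ B a v = 0 by apply: s0; rewrite mem_head.
have [b0 bv] : B b b != 0 /\ B b v = 0 by apply: s0; rewrite !inE eqxx orbT.
have s1 : {in s, forall a, B a a != 0 /\ B a v = 0}.
  by move=> c cs; apply: s0; rewrite !inE cs !orbT.
have [Y [iY sY Y1 Ys]] := IHk s s1 (ltnW sk) ds.
have [X [iX sX X1 Xab]] := refl_pair_irreducible a0 av b0 bv.
exists [set z | exists2 x, X x & exists2 y, Y y & z = x *m y]; split.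
- exact: zirreducible_mul.
- by move=> _ [x /sX Xx [y /sY Yy ->]]; apply: SOWM.
- by exists 1%:M => //; exists 1%:M => //; rewrite mul1mx.
- by exists (refl a *m refl b) => //; exists (refl_prod s) => //; rewrite mulmxA.
Qed.

Lemma SOW_irreducible : zirreducible SOW.
Proof.
apply: zirreducible_directed; first by exists 1%:M; apply: SOW1.
move=> x y /SOW_path[X [iX sX X1 Xx]] /SOW_path[Y [iY sY Y1 Yy]].
exists [set z | exists2 x, X x & exists2 y, Y y & z = x *m y]; split.
- exact: zirreducible_mul.
- by move=> _ [x' /sX Xx' [y' /sY Yy' ->]]; apply: SOWM.
- by exists x => //; exists 1%:M => //; rewrite mulmx1.
- by exists 1%:M => //; exists y => //; rewrite mul1mx.
Qed.

Lemma refl_v_unit : refl v \in unitmx.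
Proof. by apply/orth_unit/orth_refl/q_neq0. Qed.

Lemma invmx_refl_v : invmx (refl v) = refl v.
Proof.
rewrite -[LHS]mulmx1 -(refl_involutive 1%:M (q_neq0 F p)) mulmx1.
by rewrite mulKmx // refl_v_unit.
Qed.

Lemma thetaE (x : 'M[F]_n) : theta F n x = refl v *m x *m refl v.
Proof. by rewrite /theta AdE s_mx_refl invmx_refl_v. Qed.

Lemma refl_vK (x : 'M[F]_n) : refl v *m (refl v *m x) = x.
Proof. by rewrite refl_involutive // q_neq0. Qed.

Lemma refl_v_sqr : refl v *m refl v = 1%:M.
Proof. by rewrite -[X in _ *m X]mulmx1 refl_vK. Qed.

Lemma refl_v_v : refl v *m v = - v.
Proof.
by rewrite refl_mul mulfK ?q_neq0 // scaler_nat mulr2n opprD addrA subrr add0r.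
Qed.

Lemma theta_fix_comm (x : 'M[F]_n) : theta F n x = x <-> refl v *m x = x *m refl v.
Proof.
rewrite thetaE; split=> [xs|->]; last by rewrite -mulmxA refl_v_sqr mulmx1.
by rewrite -[in RHS]xs -[RHS]mulmxA refl_v_sqr mulmx1.
Qed.

Lemma refl_v_comm g : OW g -> refl v *m g = g *m refl v.
Proof.
move=> [og gv]; apply: mx_eq_on_e => k; rewrite -!mulmxA refl_mul refl_mul.
rewrite mulmxBr -scalemxAr gv; congr (_ - (_ * _ / _) *: _).
by rewrite -{1}gv orth_bform.
Qed.

(** Commuting with the reflection in v means preserving the line of v, hence sending v to v or to
    -v. These are two disjoint closed conditions, so a connected set through 1 satisfies the first.
    Conversely [SOW_path] joins each element to 1. *)
Lemma KgrpE : Kgrp F n = SOW.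
Proof.
apply/seteqP; split=> g.
  move=> [X [cX sX X1 Xg]].
  have Xv k : X k -> k *m v = v \/ k *m v = - v.
    move=> /sX[[ox _]] /theta_fix_comm sx.
    have : refl v *m (k *m v) = - (k *m v) by rewrite mulmxA sx -mulmxA refl_v_v mulmxN.
    rewrite refl_mul => /eqP; rewrite subr_eq addrC -subr_eq opprK -mulr2n -scaler_nat.
    move=> /eqP/(congr1 ( *:%R 2^-1)); rewrite !scalerA mulVf ?pnatr_eq0 // scale1r.
    set c := _ * _ => xv.
    (* Comparing norms leaves only the scalars 1 and -1. *)
    have : c ^+ 2 * q = 1 * q.
      rewrite mul1r expr2 -mulrA; transitivity (B (k *m v) (k *m v)).
        by rewrite xv bformZl bformZr.
      exact: orth_bform.
    move=> /(mulIf (q_neq0 F p))/eqP; rewrite sqrf_eq1 => /orP[]/eqP c1.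
      by left; rewrite xv c1 scale1r.
    by right; rewrite xv c1 scaleN1r.
  have reg := @regular_algebra F n n.
  have cl w : zclosed [set x : 'M[F]_n | x *m v = w].
    apply: zclosed_mx_eq; last exact: entries_cst.
    by apply: entries_mul => //; [apply: entries_id | apply: entries_cst].
  have vNv : v = - v -> False.
    move=> /eqP; rewrite -addr_eq0 -mulr2n -scaler_nat scaler_eq0 pnatr_eq0 /=.
    by move/eqP => v0; have := v_neq0; rewrite v0 eqxx.
  have [|gv|/(_ _ X1)] := cX _ _ (cl v) (cl (- v)) Xv.
  - by apply/seteqP; split=> // k [[_ /= kv]]; rewrite kv => /vNv.
  - by have gv' := gv g Xg; case: (sX g Xg) => -[og dg] _.
  - by rewrite /= mul1mx => /vNv.
move=> /[dup] sg /SOW_path[X [iX sX X1 Xg]].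
exists X; split=> // [|x /sX[ox dx]]; first exact: zirreducible_connected.
by split; [split=> //; case: ox | apply/theta_fix_comm/refl_v_comm].
Qed.

End GroupK.

(** * The Lie algebra and its standard Borel subalgebra *)

Section Algebra.
Variables (F : numClosedFieldType) (p : nat).
Local Notation n := p.+2.
Local Notation B := (@bform F n).
Local Notation S := (@skew_mx F n).
Local Notation v := (v F p).
Local Notation q := (q F p).
Local Notation m := (m p).
Implicit Types (x y z g h : 'M[F]_n).

Lemma mem_so x : (x \in so F n) <-> forall a b, B (x *m a) b = - B a (x *m b).
Proof.
rewrite /so memv_ker lfunE /= -/(S).
have eB a b : (a^T *m (x^T *m S + S *m x) *m b) 0 0 = B (x *m a) b + B a (x *m b).
  by rewrite mulmxDr mulmxDl mxE /bform trmx_mul !mulmxA.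
split=> [/eqP x0 a b|xso].
  by apply/eqP; rewrite -addr_eq0 -eB x0 mulmx0 mul0mx mxE.
apply/eqP/matrixP => i j.
have := eB (e i) (e j); rewrite xso addNr /e trmx_delta -rowE -colE.
by rewrite !mxE.
Qed.

Lemma so_entryP x :
  (x \in so F n) <-> forall i j, x i j = - x (rev_ord j) (rev_ord i).
Proof.
split=> [/mem_so xso i j|xE].
  have := xso (e j) (e (rev_ord i)).
  by rewrite bform_er bform_el rev_ordK !mulmx_eE.
apply/mem_so => a b; rewrite (col_sum_e a) (col_sum_e b) !mulmx_sumr.
rewrite !bform_suml -sumrN; apply: eq_bigr => i _.
rewrite !bform_sumr -sumrN; apply: eq_bigr => j _.
rewrite -!scalemxAr !bformZl !bformZr -!mulrN; congr (_ * (_ * _)).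
by rewrite bform_er bform_el !mulmx_eE xE rev_ordK.
Qed.

Lemma so_entry x i j : x \in so F n -> x i j = - x (rev_ord j) (rev_ord i).
Proof. by move/so_entryP. Qed.

Lemma so_antidiag x i : x \in so F n -> x i (rev_ord i) = 0.
Proof.
move=> xso; have := so_entry i (rev_ord i) xso; rewrite rev_ordK => /eqP.
by rewrite -addr_eq0 -mulr2n mulrn_eq0 => /eqP.
Qed.

Lemma so_bform0 x a : x \in so F n -> B (x *m a) a = 0.
Proof.
move=> /mem_so/(_ a a)/eqP; rewrite (bformC a) -addr_eq0 -mulr2n mulrn_eq0.
by move=> /eqP.
Qed.

Lemma Ad_so g x : orth F n g -> (Ad g x \in so F n) = (x \in so F n).
Proof.
have sub h y : orth F n h -> y \in so F n -> Ad h y \in so F n.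
  move=> oh /mem_so yso; apply/mem_so => a b; rewrite AdE -!mulmxA.
  by rewrite bform_orthl // yso bform_invl.
move=> og; apply/idP/idP; last exact: sub.
move=> /(sub (invmx g)); rewrite Ad_unitK ?orth_unit //; apply; exact: orthV.
Qed.

Lemma theta_so x : (theta F n x \in so F n) = (x \in so F n).
Proof.
rewrite thetaE -{2}(invmx_refl_v F p) -AdE Ad_so //.
exact/orth_refl/q_neq0.
Qed.

Lemma mem_kalg x : (x \in kalg F n) = (x \in so F n) && (theta F n x == x).
Proof.
by rewrite memv_cap [X in _ && X]memv_ker add_lfunE opp_lfunE scale_lfunE id_lfunE scale1r subr_eq0.
Qed.

Lemma mem_palg x : (x \in palg F n) = (x \in so F n) && (theta F n x == - x).
Proof.
rewrite memv_cap [X in _ && X]memv_ker add_lfunE opp_lfunE scale_lfunE id_lfunE scaleN1r opprK.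
by rewrite addr_eq0.
Qed.

Lemma theta_involutive x : theta F n (theta F n x) = x.
Proof. by rewrite !thetaE -!mulmxA refl_v_sqr mulmx1 refl_vK. Qed.

Lemma kp_cap0 : (kalg F n :&: palg F n = 0)%VS.
Proof.
apply/eqP; rewrite -subv0; apply/subvP => x.
case/memv_capP => xk xp; move: xk xp; rewrite mem_kalg => /andP[_ /eqP xk].
rewrite mem_palg => /andP[_]; rewrite xk memv0.
by rewrite -addr_eq0 -mulr2n -scaler_nat scaler_eq0 pnatr_eq0.
Qed.

Lemma proj_kD x y : x \in kalg F n -> y \in palg F n -> proj_k (x + y) = x.
Proof.
rewrite /proj_k; move: (kalg F n) (palg F n) kp_cap0 => U V UV xU yV.
have VU : (V :&: U = 0)%VS by rewrite capvC.
have yUV : y \in (U + V)%VS by rewrite -[y]add0r memv_add // mem0v.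
have := daddv_pi_add UV yUV; rewrite (daddv_pi_id VU yV).
move=> /(canRL (addrK y)); rewrite subrr => y0.
by rewrite linearD /= (daddv_pi_id UV xU) y0 addr0.
Qed.

Lemma proj_kE x : x \in so F n -> proj_k x = 2^-1 *: (x + theta F n x).
Proof.
move=> xso; pose k := 2^-1 *: (x + theta F n x); pose r := 2^-1 *: (x - theta F n x).
have kk : k \in kalg F n.
  rewrite mem_kalg memvZ ?memvD ?theta_so //= linearZ linearD /= theta_involutive.
  by rewrite addrC.
have rp : r \in palg F n.
  rewrite mem_palg memvZ ?memvB ?theta_so //= linearZ linearB /= theta_involutive.
  by rewrite -scalerN opprB.
have xkr : x = k + r.
  rewrite -scalerDr addrACA subrr addr0 -mulr2n -scaler_nat scalerA.
  by rewrite mulVf ?scale1r // pnatr_eq0.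
exact: etrans (congr1 (@proj_k F n) xkr) (proj_kD kk rp).
Qed.

Lemma proj_k_so x : x \in so F n -> proj_k x \in so F n.
Proof. by move=> xso; rewrite proj_kE // memvZ // memvD // theta_so. Qed.

Lemma proj_k_kalg x : x \in so F n -> proj_k x \in kalg F n.
Proof. by move=> xso; rewrite /proj_k memv_pi. Qed.

Lemma bform_v_so x : x \in so F n -> B v (x *m v) = 0.
Proof. by move=> xso; rewrite bformC so_bform0. Qed.

(** Average x with its conjugate by the reflection in v; the correction has rank at most two and
    involves only v and x v. *)
Lemma proj_k_mul x a : x \in so F n ->
  proj_k x *m a = x *m a - (B v a / q) *: (x *m v) + (B (x *m v) a / q) *: v.
Proof.
move=> xso; rewrite proj_kE // -scalemxAl mulmxDl thetaE -!mulmxA.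
rewrite (refl_mul v a) mulmxBr -scalemxAr mulmxBr -scalemxAr.
rewrite (refl_fix (bform_v_so xso)) refl_mul.
have -> : B v (x *m a) = - B (x *m v) a by move/mem_so: xso => ->; rewrite opprK.
rewrite -/q; move: (B (x *m v) a) (B v a) (x *m a) (x *m v) (q) (q_neq0 F p).
move: (v) => v0 c d y u q0 q0_neq0.
by apply/colP => k; rewrite !mxE; field.
Qed.

Lemma proj_k_v x : x \in so F n -> proj_k x *m v = 0.
Proof.
move=> xso; rewrite proj_k_mul // (_ : B v v / q = 1); last by rewrite divff ?q_neq0.
by rewrite scale1r subrr (bformC _ v) bform_v_so // mul0r scale0r addr0.
Qed.

Lemma Ad_proj_k g x : OW g -> x \in so F n -> Ad g (proj_k x) = proj_k (Ad g x).
Proof.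
move=> og xso; have ug := orth_unit (OW_orth og).
rewrite !proj_kE ?Ad_so //; last exact: OW_orth.
transitivity (2^-1 *: (Ad g x + Ad g (theta F n x))); first by rewrite linearZ /= linearD.
congr (_ *: (_ + _)); rewrite !thetaE !AdE -!mulmxA.
by rewrite (refl_v_comm (OWV og)) [in LHS](mulmxA g) -(refl_v_comm og) -!mulmxA.
Qed.

Definition upper x : Prop := forall i j : 'I_n, (j < i)%N -> x i j = 0.
Definition strict_upper x : Prop := forall i j : 'I_n, (j <= i)%N -> x i j = 0.

Lemma strict_upperW x : strict_upper x -> upper x.
Proof. by move=> sx i j /ltnW; apply: sx. Qed.

Lemma upper_below x i a : upper x -> below i a -> below i (x *m a).
Proof.
move=> ux ba k ik; rewrite mxE big1 // => j _.
case: (ltnP j k) => jk; first by rewrite ux ?mul0r.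
by rewrite ba ?mulr0 //; apply: leq_trans jk.
Qed.

Lemma strict_upper_below x i a : strict_upper x -> below i a -> below i.-1 (x *m a).
Proof.
move=> ux ba k ik; rewrite mxE big1 // => j _.
case: (leqP j k) => jk; first by rewrite ux ?mul0r.
by rewrite ba ?mulr0 //; lia.
Qed.

Lemma mem_b_plus x : (x \in b_plus F n) <-> (x \in so F n /\ upper x).
Proof.
rewrite /b_plus memv_cap; split=> [/andP[xso /memv_sumP[y yp xE]]|[xso ux]].
  split=> // i j ji; rewrite xE summxE big1 // => -[k l] /= kl.
  have /vlineP[c ->] := yp (k, l) kl; rewrite !mxE /=.
  case: eqP => [ik|]; last by rewrite mulr0.
  by case: eqP => [jl|]; [move: ji; rewrite ik jl; lia | rewrite mulr0].
rewrite xso /= [x]matrix_sum_delta.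
have -> : \sum_(i < n) \sum_(j < n) x i j *: delta_mx i j =
    \sum_(i < n) \sum_(j < n | (i <= j)%N) x i j *: delta_mx i j.
  apply: eq_bigr => i _; rewrite [RHS]big_mkcond /=; apply: eq_bigr => j _.
  by case: leqP => // ji; rewrite ux // scale0r.
rewrite pair_big_dep /=; apply: memv_sumr => -[i j] /= ij.
by apply: memvZ; apply: memv_line.
Qed.

Lemma lieb_so x y : x \in so F n -> y \in so F n -> lieb x y \in so F n.
Proof.
move=> /mem_so xso /mem_so yso; apply/mem_so => a b.
rewrite /lieb !mulmxBl bformBl bformBr -!mulmxA.
by rewrite !xso !yso !xso !opprK opprB.
Qed.

(** The filtration by superdiagonals: degree 0 is upper triangular, degree 1 strictly upper
    triangular. *)
Definition shifted k x : Prop := forall i j : 'I_n, (j < i + k)%N -> x i j = 0.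

Lemma shifted_mul k l x y : shifted k x -> shifted l y -> shifted (k + l) (x *m y).
Proof.
move=> sx sy i j ij; rewrite mxE big1 // => r _.
case: (ltnP r (i + k)) => ri; first by rewrite sx ?mul0r.
by rewrite sy ?mulr0 //; lia.
Qed.

Lemma shifted_lieb k l x y : shifted k x -> shifted l y -> shifted (k + l) (lieb x y).
Proof.
move=> sx sy i j ij; rewrite /lieb mxE (shifted_mul sx sy) // mxE.
by rewrite (shifted_mul sy sx) ?subr0 // (addnC l).
Qed.

Lemma strict_upper_lieb x y : upper x -> upper y -> strict_upper (lieb x y).
Proof.
move=> ux uy i j; rewrite leq_eqVlt => /orP[/eqP/val_inj->|ji]; last first.
  have u0 z : upper z -> shifted 0 z by move=> uz k l; rewrite addn0; apply: uz.
  by apply: (shifted_lieb (u0 _ ux) (u0 _ uy)); rewrite !addn0.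
have diag z t : upper z -> upper t -> (z *m t) i i = z i i * t i i.
  move=> uz ut; rewrite mxE (bigD1 i) //= big1 ?addr0 // => k ki.
  case: (ltngtP k i) => [ki'|ki'|/val_inj kI]; first by rewrite uz ?mul0r.
    by rewrite ut ?mulr0.
  by move: ki; rewrite kI eqxx.
by rewrite /lieb mxE [X in _ + X]mxE !diag // mulrC subrr.
Qed.

(** A diagonal element of so with distinct eigenvalues n - 1 - 2i, so that its bracket multiplies
    the (i, j) entry by 2(j - i). It produces the nilradical as brackets and later detects diagonal
    matrices. *)
Definition grading_mx : 'M[F]_n := diag_mx (\row_(i < n) ((n.-1)%:R - (i.*2)%:R)).

Lemma grading_so : grading_mx \in so F n.
Proof.
have hE a k : (grading_mx *m a) k 0 = ((n.-1)%:R - (k.*2)%:R) * a k 0.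
  by rewrite mul_diag_mx mxE mxE.
apply/mem_so => a b; rewrite !bformE -sumrN; apply: eq_bigr => k _.
rewrite !hE; have kn := ltn_ord k.
have -> : (rev_ord k).*2 = (n.-1.*2 - k.*2)%N by rewrite /=; lia.
by rewrite natrB; [rewrite -!addnn !natrD; ring | lia].
Qed.

Lemma grading_lieb x i j : lieb grading_mx x i j = ((j.*2)%:R - (i.*2)%:R) * x i j.
Proof. by rewrite /lieb mxE [X in _ + X]mxE mul_diag_mx mul_mx_diag !mxE; ring. Qed.

Lemma nilrad_b_plusE : nilrad (b_plus F n) = [set x | x \in so F n /\ strict_upper x].
Proof.
apply/seteqP; split=> [x|x [xso sx]]; rewrite /nilrad /=.
  move: x; apply: (@lie_prod_ind _ _ (fun x => x \in so F n /\ strict_upper x)).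
  - by split; [exact: mem0v | move=> i j _; rewrite mxE].
  - move=> c y z [yso sy] [zso sz]; split; first by rewrite memvD // memvZ.
    by move=> i j ij; rewrite !mxE sy // sz // mulr0 addr0.
  - move=> y z /mem_b_plus[yso uy] /mem_b_plus[zso uz]; split; first exact: lieb_so.
    exact: strict_upper_lieb.
(* Invert the bracket with [grading_mx] entrywise. On the diagonal the quotient by 0 is 0,
   consistent with x vanishing there. *)
pose y : 'M[F]_n := \matrix_(i, j) (x i j / ((j.*2)%:R - (i.*2)%:R)).
have xE : x = lieb grading_mx y.
  apply/matrixP => i j; rewrite grading_lieb mxE.
  case: (leqP j i) => ij; first by rewrite sx // mul0r mulr0.
  rewrite mulrC divfK // -natrB ?pnatr_eq0; lia.
rewrite xE; apply: lieb_mem; apply/mem_b_plus.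
  split; first exact: grading_so.
  by move=> i j ij; rewrite mxE -val_eqE /= gtn_eqF.
split; last by move=> i j ij; rewrite mxE sx ?mul0r // ltnW.
apply/so_entryP => i j; rewrite !mxE (so_entry _ _ xso) mulNr; congr (- (_ / _)).
have dr (k : 'I_n) : ((rev_ord k).*2)%:R = (n.-1.*2)%:R - (k.*2)%:R :> F.
  by rewrite -natrB /=; [congr (_%:R) | ]; move: (ltn_ord k); lia.
by rewrite !dr; ring.
Qed.

End Algebra.

(** * The nilpotent cone and contractions *)

Section Invariants.
Variables (F : numClosedFieldType) (n' : nat).
Local Notation n := n'.+1.
Implicit Types (x g : 'M[F]_n) (V : {vspace 'M[F]_n}) (H : set 'M[F]_n).

Lemma dhomog_meval k (P : {mpoly F[k]}) d (c : F) (a : 'I_k -> F) :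
  P \is d.-homog -> P.@[fun i => c * a i] = c ^+ d * P.@[a].
Proof.
move=> /dhomogP Pd; rewrite !mevalE mulr_sumr; apply: eq_big_seq => mm mP.
rewrite mulrCA; congr (_ * _).
under eq_bigr => i _ do rewrite exprMn.
rewrite big_split /=; congr (_ * _); rewrite prodrXr; congr (_ ^+ _).
by rewrite -(Pd mm mP) /= mdegE.
Qed.

(** In positive degree homogeneity gives the value 0. Degree 0 would make the generator constant,
    against algebraic independence. *)
Lemma basic_invariants_0 V H r (f : 'I_r -> 'M[F]_n -> F) :
  basic_invariants V H f -> forall i, f i 0 = 0.
Proof.
move=> [_ hom indep _] i; have [d [P Pd fP]] := hom i.
have P0 x : meval_mx P 0 = 0 ^+ d * meval_mx P x.
  rewrite /meval_mx -(dhomog_meval _ _ Pd); apply: meval_eq => j.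
  by rewrite linear0 mxE mul0r.
rewrite fP ?mem0v // (P0 0); case: d Pd P0 => [|d] Pd P0; last by rewrite expr0n mul0r.
have := indep ('X_i - (meval_mx P 0)%:MP) => /(_ _)/wrap[x xV|X0].
  by rewrite mevalB mevalXU mevalC fP // (P0 x) expr0 mul1r subrr.
have := congr1 (fun Q : {mpoly F[r]} => Q.@[fun=> meval_mx P 0 + 1]) X0.
by rewrite meval0 mevalB mevalXU mevalC addrAC subrr add0r => /eqP; rewrite oner_eq0.
Qed.

Definition nilp x : Prop := forall w : 'cV[F]_n, iter n (mulmx x) w = 0.

Lemma mulmx_exp x k (w : 'cV[F]_n) : x ^+ k *m w = iter k (mulmx x) w.
Proof.
elim: k => [|k IHk]; first by rewrite expr0 mul1mx.
by rewrite exprS -mulmxA IHk.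
Qed.

Lemma nilp_of_det x : (forall t, \det (t%:M - x) = t ^+ n) -> nilp x.
Proof.
move=> xt; have cx : char_poly x = 'X^n.
  apply: poly_inj => t; rewrite hornerXn -xt -[LHS]/(horner_eval t (\det _)) -det_map_mx.
  congr (\det _); apply/matrixP => i j; rewrite !mxE /horner_eval.
  by rewrite rmorphB rmorphMn /= /horner_eval hornerX hornerC.
move=> w; rewrite -mulmx_exp; have := Cayley_Hamilton x.
by rewrite cx rmorphXn /= horner_mx_X => ->; rewrite mul0mx.
Qed.

(** For each t the function det(t - y) is invariant, hence a polynomial in the generators. These
    vanish at x as they do at 0, so x has the characteristic polynomial of 0. *)
Lemma basic_invariants_nilp V H r (f : 'I_r -> 'M[F]_n -> F) x :
  H `<=` [set g | g \in unitmx] ->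
  basic_invariants V H f -> x \in V -> (forall i, f i x = 0) -> nilp x.
Proof.
move=> uH bf xV fx; apply: nilp_of_det => t.
have f0 := basic_invariants_0 bf; have [_ _ _ gen] := bf.
have [|P PE] := gen (fun y => \det (t%:M - y)).
  split.
    have [P PE] : regular F n n (fun y => \det (t%:M - y)).
      apply: algebra_det; first exact: regular_algebra.
      apply: entries_sub; [exact: regular_algebra | | exact: entries_id].
      by apply: entries_cst; apply: regular_algebra.
    by exists P.
  move=> g y /uH ug yV; rewrite AdE.
  have -> : t%:M - g *m y *m invmx g = g *m (t%:M - y) *m invmx g.
    by rewrite mulmxBr mulmxBl mul_mx_scalar -scalemxAl mulmxV // scalemx1.
  by rewrite !det_mulmx mulrAC -det_mulmx mulmxV // det1 mul1r.
rewrite (PE x xV); transitivity (\det (t%:M - 0 : 'M[F]_n)).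
  by rewrite (PE 0 (mem0v _)); apply: meval_eq => i; rewrite fx f0.
by rewrite subr0 det_scalar.
Qed.

End Invariants.

(** * A torus in K contracting the nilradical *)

Section Contraction.
Variables (F : numClosedFieldType) (p : nat).
Local Notation n := p.+2.
Local Notation B := (@bform F n).
Local Notation v := (v F p).
Local Notation m := (m p).
Local Notation OW := (@OW F p).
Local Notation SOW := (@SOW F p).
Implicit Types (x y z g h : 'M[F]_n).

(** The torus element diag(t^m, ..., t, 1, ..., 1, t^-1, ..., t^-m). Subtraction is truncated, so
    for each i at least one of the two exponents is 0, and both are 0 on the support of v. *)
Definition contraction (t : F) : 'M[F]_n :=
  diag_mx (\row_i (t ^+ (m - i) / t ^+ (m - rev_ord i))).

Lemma contraction_mul t (a : 'cV[F]_n) k :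
  (contraction t *m a) k 0 = t ^+ (m - k) / t ^+ (m - rev_ord k) * a k 0.
Proof. by rewrite mul_diag_mx mxE mxE. Qed.

Lemma contraction_SOW t : t != 0 -> SOW (contraction t).
Proof.
move=> t0; split; first split.
- apply: orthP => a b; rewrite !bformE; apply: eq_bigr => k _.
  rewrite !contraction_mul rev_ordK mulrACA.
  by rewrite -[RHS]mul1r; congr (_ * _); field; rewrite !expf_neq0.
- apply/colP => k; rewrite contraction_mul.
  have [km|mk] := ltnP k m; first by rewrite v_supp ?km // mulr0.
  have [km|km] := leqP (n - m) k; first by rewrite v_supp ?km ?orbT // mulr0.
  have e1 : (m - k = 0)%N by lia.
  have e2 : (m - rev_ord k = 0)%N by rewrite /=; lia.
  by rewrite e1 e2 divr1 mul1r.
rewrite det_diag; under eq_bigr => i _ do rewrite mxE.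
rewrite prodf_div [X in _ / X](reindex_inj rev_ord_inj).
under [X in _ / X]eq_bigr => i _ do rewrite rev_ordK.
by rewrite divff //; apply/prodf_neq0 => i _; rewrite expf_neq0.
Qed.

(* An entry above the diagonal has positive weight, except for the central
   antidiagonal entry, which vanishes on so. *)
Lemma contraction_limit x : x \in so F n -> strict_upper x ->
  exists phi : F -> 'M[F]_n, [/\ entries_in (@polynomial1 F) phi, phi 0 = 0 &
    forall t, t != 0 -> phi t = Ad (contraction t) x].
Proof.
move=> xso sx.
(* The (i, j) entry has weight N1 - N2. [x0] shows that it vanishes unless the weight is positive,
   so the truncated difference is the right exponent. *)
pose N1 (i j : 'I_n) := ((m - i) + (m - rev_ord j))%N.
pose N2 (i j : 'I_n) := ((m - rev_ord i) + (m - j))%N.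
pose phi (t : F) : 'M[F]_n := \matrix_(i, j) (t ^+ (N1 i j - N2 i j) * x i j).
have x0 i j : (N1 i j <= N2 i j)%N -> x i j = 0.
  move=> N12; case: (leqP j i) => ij; first exact: sx.
  suff -> : j = rev_ord i by exact: so_antidiag.
  have := ltn_ord i; have := ltn_ord j.
  by move: N12; rewrite /N1 /N2 /= => N12 jn im; apply: val_inj => /=; move: N12; rewrite /m; lia.
exists phi; split.
- move=> i j; exists (x i j *: 'X^(N1 i j - N2 i j)) => t.
  by rewrite mxE hornerZ hornerXn mulrC.
- apply/matrixP => i j; rewrite !mxE.
  have [/x0->|N12] := leqP (N1 i j) (N2 i j); first by rewrite mulr0.
  by rewrite expr0n subn_eq0 leqNgt N12 mul0r.
- move=> t t0; have oc := OW_orth (SOW_OW (contraction_SOW t0)).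
  rewrite AdE; apply: (canRL (mulmxK (orth_unit oc))).
  apply/matrixP => i j; rewrite mul_diag_mx mul_mx_diag !mxE.
  have [/x0->|N12] := leqP (N1 i j) (N2 i j); first by rewrite !mulr0 mul0r.
  rewrite expfB // /N1 /N2 !exprD.
  by field; rewrite !expf_neq0.
Qed.

(** Along the contraction f is constant for t nonzero and polynomial in t, so its value is the one
    at the limit 0. On Ad h x the torus acts through its conjugate by h, which stays in [SOW] even
    if det h = -1, because [SOW] is normal in [OW]. *)
Lemma polyfun_contract (V : {vspace 'M[F]_n}) (f : 'M[F]_n -> F) x (phi : F -> 'M[F]_n) h :
  (forall g y, SOW g -> y \in V -> f (Ad g y) = f y) -> polyfun V f ->
  (forall g y, OW g -> y \in V -> Ad g y \in V) -> OW h -> x \in V ->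
  entries_in (@polynomial1 F) phi -> phi 0 = 0 ->
  (forall t, t != 0 -> phi t = Ad (contraction t) x) ->
  f (Ad h x) = f 0.
Proof.
move=> inv [P fP] VO oh xV phiP phi0 phiE.
have uh := orth_unit (OW_orth oh); rewrite (fP 0) ?mem0v //.
pose G t := meval_mx P (h *m phi t *m invmx h) - f (Ad h x).
have : G 0 = 0.
  apply: polynomial1_eq0.
    have alg := @polynomial1_algebra F.
    apply: algebra_add => //; last exact: algebra_cst.
    apply: algebra_meval => //; apply: entries_mul => //; last exact: entries_cst.
    by apply: entries_mul => //; apply: entries_cst.
  move=> t t0; rewrite /G -AdE phiE //; have sc := contraction_SOW t0.
  have uc := orth_unit (OW_orth (SOW_OW sc)).
  rewrite -fP; last by apply: (VO) => //; apply: (VO) => //; case: sc.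
  rewrite -AdM // -(mulmxKV uh (h *m _)) AdM ?unitmx_mul ?uh ?uc ?unitmx_inv //.
  by rewrite inv ?subrr //; [apply: SOW_conj | apply: VO].
by rewrite /G phi0 mulmx0 mul0mx => /eqP; rewrite subr_eq0 => /eqP.
Qed.

End Contraction.

(** * Nilpotency on the zero fiber, and its converse *)

Section Fiber.
Variables (F : numClosedFieldType) (p : nat).
Local Notation n := p.+2.
Local Notation OW := (@OW F p).
Local Notation SOW := (@SOW F p).
Variables (fk : 'I_(rk n.-1) -> 'M[F]_n -> F) (f : 'I_(rk n) -> 'M[F]_n -> F).
Hypothesis hfk : basic_invariants (kalg F n) (Kgrp F n) fk.
Hypothesis hf : basic_invariants (so F n) (SO F n) f.
Implicit Types (x y z g h : 'M[F]_n).

Lemma SOW_SO g : SOW g -> SO F n g.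
Proof. by move=> [[og _] dg]. Qed.

Lemma Phi_fiber0E x : Phi_fiber0 fk f x <->
  [/\ x \in so F n, forall i, fk i (proj_k x) = 0 & forall i, f i x = 0].
Proof.
split=> [[xso]|[xso fk0 f0]].
  case=> /rowP fk0 /rowP f0; split=> // i; first by have := fk0 i; rewrite !mxE.
  by have := f0 i; rewrite !mxE.
split=> //; rewrite /Phi; congr (_, _); apply/rowP => i; rewrite !mxE //.
Qed.

Lemma fiber_nilp x : Phi_fiber0 fk f x ->
  [/\ x \in so F n, nilp x & nilp (proj_k x)].
Proof.
move=> /Phi_fiber0E[xso fk0 f0]; split=> //.
  by apply: (basic_invariants_nilp _ hf) => // g [og _]; apply: orth_unit.
apply: (basic_invariants_nilp _ hfk) => //; last exact: proj_k_kalg.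
by rewrite KgrpE => g /SOW_OW/OW_orth/orth_unit.
Qed.

Lemma fiber_of_nilrad h x : OW h -> nilrad (b_plus F n) x -> Phi_fiber0 fk f (Ad h x).
Proof.
rewrite nilrad_b_plusE => oh [xso sx].
have [phi [phiP phi0 phiE]] := contraction_limit xso sx.
have oSO y g : OW g -> y \in so F n -> Ad g y \in so F n.
  by move=> /OW_orth og yso; rewrite Ad_so.
apply/Phi_fiber0E; split; first exact: oSO.
  move=> i; have [inv _ _ _] := hfk; have [fkP fkI] := inv i.
  rewrite -Ad_proj_k // -(basic_invariants_0 hfk i).
  have phiso (t : F) : t != 0 -> Ad (contraction p t) x \in so F n.
    by move=> t0; apply: oSO => //; case: (contraction_SOW p t0).
  (* The curve for the projection of x is the theta-average of [phi], a polynomial formula valid for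
     all t. *)
  apply: (@polyfun_contract _ _ (kalg F n) _ _
    (fun t => 2^-1 *: (phi t + refl (v F p) *m phi t *m refl (v F p)))) => //.
  - by move=> g y sg; apply: fkI; rewrite KgrpE.
  - move=> g y og yk; have yso : y \in so F n by move: yk; rewrite mem_kalg => /andP[].
    rewrite -(proj_kD yk (mem0v _)) addr0 Ad_proj_k //.
    by apply: proj_k_kalg; apply: oSO.
  - exact: proj_k_kalg.
  - have alg := @polynomial1_algebra F.
    apply: entries_scale => //; first exact: algebra_cst.
    apply: entries_add => //; apply: entries_mul => //; last exact: entries_cst.
    by apply: entries_mul => //; apply: entries_cst.
  - by rewrite phi0 mulmx0 mul0mx addr0 scaler0.
  - move=> t t0; have [oc _] := contraction_SOW p t0.
    by rewrite Ad_proj_k // proj_kE ?phiso // thetaE phiE.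
move=> i; have [inv _ _ _] := hf; have [fP fI] := inv i.
rewrite -(basic_invariants_0 hf i); apply: (polyfun_contract _ fP _ oh xso phiP phi0 phiE).
  by move=> g y /SOW_SO; apply: fI.
by move=> g y; apply: oSO.
Qed.

End Fiber.

(** * Elements of the zero fiber stabilize an isotropic flag orthogonal to v *)

Section NilpotentSeries.
Variables (F : numFieldType) (n : nat) (A : 'M[F]_n).
Hypothesis nA : forall w : 'cV[F]_n, iter n (mulmx A) w = 0.

(** The Neumann series of (1 - t A)^-1 w, finite because A is nilpotent. *)
Definition geom (t : F) (w : 'cV[F]_n) := \sum_(k < n) t ^+ k *: iter k (mulmx A) w.

Lemma geomE t w : geom t w - t *: (A *m geom t w) = w.
Proof.
rewrite /geom mulmx_sumr scaler_sumr.
under [X in _ - X]eq_bigr => k _ do rewrite -scalemxAr scalerA -exprS -[A *m _]iterS.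
transitivity (w - t ^+ n *: iter n (mulmx A) w); last by rewrite nA scaler0 subr0.
rewrite -sumrB -(big_mkord xpredT (fun k => t ^+ k *: iter k (mulmx A) w -
  t ^+ k.+1 *: iter k.+1 (mulmx A) w)).
rewrite -[LHS]opprK -sumrN.
under eq_bigr => k _ do rewrite opprB.
by rewrite telescope_sumr // opprB expr0 scale1r.
Qed.

Lemma geom_unique t w z : z - t *: (A *m z) = w -> z = geom t w.
Proof.
move=> zw; apply/eqP; rewrite -subr_eq0; set d := z - geom t w.
have dE : d = t *: (A *m d).
  apply/eqP; rewrite -subr_eq0 /d mulmxBr scalerBr opprD opprK addrACA zw.
  by rewrite -[- _ + _]opprK opprD opprK geomE subrr.
have dk k : d = t ^+ k *: iter k (mulmx A) d.
  elim: k => [|k IHk]; first by rewrite expr0 scale1r.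
  by rewrite {1}dE {1}IHk exprS iterS -scalemxAr scalerA.
by rewrite (dk n) nA scaler0.
Qed.

Lemma geomZ t c w : geom t (c *: w) = c *: geom t w.
Proof.
rewrite /geom scaler_sumr; apply: eq_bigr => k _; rewrite !scalerA mulrC -scalerA.
congr (_ *: _); elim: (k : nat) => //= j ->; by rewrite scalemxAr.
Qed.

Lemma iter_mulmx0 k : iter k (mulmx A) 0 = 0 :> 'cV[F]_n.
Proof. by elim: k => //= k ->; rewrite mulmx0. Qed.

End NilpotentSeries.

Section FlagOfFiber.
Variables (F : numClosedFieldType) (p : nat).
Local Notation n := p.+2.
Local Notation B := (@bform F n).
Local Notation v := (v F p).
Local Notation q := (q F p).
Local Notation m := (m p).
Local Notation OW := (@OW F p).
Implicit Types (x y z g h : 'M[F]_n) (w : 'cV[F]_n).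

Lemma mE : m = n.-1./2.
Proof. by []. Qed.

(** Skew symmetry carries the first m columns to the last m rows. What remains below the diagonal is
    at most one central antidiagonal entry, which is 0 on so. *)
Lemma upper_of_cols x : x \in so F n ->
  (forall i j : 'I_n, (j < m)%N -> (j < i)%N -> x i j = 0) -> upper x.
Proof.
move=> xso cx i j ji; have [jm|mj] := ltnP j m; first exact: cx.
have [im|mi] := ltnP (rev_ord i) m.
  by rewrite (so_entry _ _ xso) cx ?oppr0 //=; have := ltn_ord i; lia.
suff -> : i = rev_ord j by rewrite -{2}(rev_ordK j) so_antidiag.
apply: val_inj; move: (mE) (ltn_ord i) (ltn_ord j) mi mj ji; rewrite /=; lia.
Qed.

Lemma upper_iter_diag x k (j : 'I_n) : upper x ->
  below j.+1 (iter k (mulmx x) (e j)) /\ iter k (mulmx x) (e j) j 0 = x j j ^+ k.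
Proof.
move=> ux; elim: k => [|k [IHb IHj]].
  by split; [apply: below_e | rewrite /= eE eqxx].
split; first exact: upper_below.
rewrite iterS mxE (bigD1 j) //= IHj big1 ?addr0 ?exprS // => i ij.
case: (ltngtP i j) => [ij'|ji|/val_inj E]; first by rewrite ux ?mul0r.
  by rewrite IHb ?mulr0.
by rewrite E eqxx in ij.
Qed.

(** After [upper_of_cols] only the diagonal is in question, and its entries are eigenvalues of a
    nilpotent matrix. *)
Lemma strict_upper_of_cols x : x \in so F n -> nilp x ->
  (forall i j : 'I_n, (j < m)%N -> (j <= i)%N -> x i j = 0) -> strict_upper x.
Proof.
move=> xso nx cx; have ux : upper x.
  by apply: upper_of_cols => // i j jm ji; apply: cx => //; apply: ltnW.
move=> i j; rewrite leq_eqVlt => /orP[/eqP/val_inj->|]; last exact: ux.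
have [_ /eqP] := @upper_iter_diag x n i ux.
by rewrite nx mxE eq_sym expf_eq0 => /andP[_ /eqP].
Qed.

Section Isotropy.
Variable x : 'M[F]_n.
Hypotheses (xso : x \in so F n) (nx : nilp x) (nA : nilp (proj_k x)).
Local Notation A := (proj_k x).
Local Notation u := (x *m v).

Let Aso : A \in so F n. Proof. exact: proj_k_so. Qed.

(* With alpha(t) = B(v, (1 - t x)^-1 v) / q and b(t) = B(u, (1 - t A)^-1 u), the
   decomposition x = A + (B(v, -) u - B(u, -) v) / q gives alpha (1 + t^2 b / q) = 1; both
   factors are polynomials in t, hence constant. *)
Lemma resolvent_identity t :
  B v (geom x t v) / q * (1 + t ^+ 2 * B u (geom A t u) / q) = 1.
Proof.
set y := geom x t v; set a := B v y / q.
have yE : y - t *: (x *m y) = v := geomE nx t v.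
have q0 := q_neq0 F p.
have av : a * q = B v y by rewrite /a divfK.
have aE : a = 1 - t * B u y / q.
  have : B v (y - t *: (x *m y)) = q by rewrite yE.
  have -> : B v (y - t *: (x *m y)) = a * q + t * B u y.
    by rewrite bformBr bformZr av (proj1 (mem_so x) xso) mulrN.
  move=> aq; apply: (mulIf q0); transitivity (q - t * B u y).
    by rewrite -[X in X - _]aq addrK.
  by rewrite mulrBl mul1r divfK.
(* Removing from y its component along v leaves a solution z of z - t A z = t a u; pairing it with u
   brings in b(t). *)
have : y - a *: v = geom A t (t * a *: u).
  apply: geom_unique => //; rewrite mulmxBr -scalemxAr proj_k_v // scaler0 subr0.
  rewrite proj_k_mul // -/a.
  have lin (v0 u0 w y0 : 'cV[F]_n) c : y0 = v0 + t *: w ->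
      y0 - a *: v0 - t *: (w - a *: u0 + c *: v0) = (t * a) *: u0 + (1 - a - t * c) *: v0.
    by move=> ->; apply/colP => k; rewrite !mxE; ring.
  rewrite (lin v u (x *m y) y); last by apply/eqP; rewrite -subr_eq yE.
  have -> : 1 - a - t * (B u y / q) = 0 by rewrite [X in 1 - X]aE; ring.
  by rewrite scale0r addr0.
move=> /(congr1 (B u)); rewrite geomZ bformBr !bformZr (bformC _ v) bform_v_so //.
rewrite mulr0 subr0 => uy; rewrite mulrDr mulr1 {1}aE uy; ring.
Qed.

(** [resolvent_identity] becomes Pa (1 + X^2 Pb) = 1 in the polynomial ring. Degrees force X^2 Pb =
    0, and the coefficients of Pb are these pairings divided by q. *)
Lemma isotropic_cyclic k : B u (iter k (mulmx A) u) = 0.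
Proof.
pose Pa : {poly F} := \poly_(k < n) (B v (iter k (mulmx x) v) / q).
pose Pb : {poly F} := \poly_(k < n) (B u (iter k (mulmx A) u) / q).
have geomB N w w' t : B w (geom N t w') = \sum_(k < n) B w (iter k (mulmx N) w') * t ^+ k.
  by rewrite /geom bform_sumr; apply: eq_bigr => i _; rewrite bformZr mulrC.
have Pab : Pa * (1 + 'X^2 * Pb) = 1.
  apply: poly_inj => t; rewrite hornerM hornerD hornerM hornerXn hornerC.
  rewrite -[RHS](resolvent_identity t) !horner_poly !geomB; congr (_ * (_ + _)).
    by rewrite mulr_suml; apply: eq_bigr => i _; rewrite mulrAC.
  by rewrite -mulrA mulr_suml; congr (_ * _); apply: eq_bigr => i _; rewrite mulrAC.
have Pb0 : Pb = 0.
  apply/eqP; apply: contraT => b0.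
  have := congr1 (fun P : {poly F} => size P) Pab; rewrite size_poly1.
  have Pa0 : Pa != 0 by apply: contra_eq_neq Pab => ->; rewrite mul0r eq_sym oner_eq0.
  have sz : (size (1 + 'X^2 * Pb)%R = (size Pb).+2)%N.
    have s2 : size ('X^2 * Pb) = (size Pb).+2 by rewrite -commr_polyXn size_mulXn.
    rewrite addrC size_polyDl ?s2 // size_poly1.
    by rewrite ltnS ltnW // ltnS size_poly_gt0.
  have P10 : 1 + 'X^2 * Pb != 0 by rewrite -size_poly_eq0 sz.
  rewrite size_mul // sz; move: Pa0 b0; rewrite -!size_poly_gt0; lia.
have [kn|nk] := ltnP k n.
  have := congr1 (fun P : {poly F} => P`_k) Pb0; rewrite coef_poly kn coef0.
  by move=> /eqP; rewrite mulf_eq0 invr_eq0 (negPf (q_neq0 F p)) orbF => /eqP.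
have -> : k = (k - n + n)%N by rewrite subnK.
by rewrite iterD nA iter_mulmx0 bform0r.
Qed.

End Isotropy.
End FlagOfFiber.

(** * Extending the isotropic flag vector by vector *)

Section FlagConstruction.
Variables (F : numClosedFieldType) (p : nat).
Local Notation n := p.+2.
Local Notation B := (@bform F n).
Local Notation v := (v F p).
Local Notation q := (q F p).
Local Notation m := (m p).
Local Notation OW := (@OW F p).
Implicit Types (x y g h : 'M[F]_n) (w z : 'cV[F]_n).

Definition krylov x : 'M[F]_n :=
  \matrix_(i, k) iter k (mulmx (proj_k x)) (x *m v) i 0.

Lemma krylov_col x (k : 'I_n) : krylov x *m e k = iter k (mulmx (proj_k x)) (x *m v).
Proof. by apply/colP => i; rewrite mulmx_eE mxE. Qed.

Lemma iter_Ad h y k w : h \in unitmx ->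
  iter k (mulmx (Ad h y)) (h *m w) = h *m iter k (mulmx y) w.
Proof.
by move=> uh; elim: k => //= k ->; rewrite AdE -!mulmxA (mulKmx uh).
Qed.

Lemma Ad_mul_v h x : OW h -> Ad h x *m v = h *m (x *m v).
Proof. by move=> [oh hv]; rewrite AdE -!mulmxA orth_fixV. Qed.

Lemma krylov_Ad h x : OW h -> x \in so F n -> krylov (Ad h x) = h *m krylov x.
Proof.
move=> oh xso; have uh := orth_unit (OW_orth oh).
apply: mx_eq_on_e => k; rewrite -mulmxA !krylov_col Ad_mul_v //.
by rewrite -Ad_proj_k // iter_Ad.
Qed.

Lemma nilp_Ad h x : h \in unitmx -> nilp x -> nilp (Ad h x).
Proof. by move=> uh nx w; rewrite -(mulKVmx uh w) iter_Ad // nx mulmx0. Qed.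

Definition doubly_nilpotent x : Prop := [/\ x \in so F n, nilp x & nilp (proj_k x)].

Lemma doubly_nilpotent_Ad h x : OW h -> doubly_nilpotent x -> doubly_nilpotent (Ad h x).
Proof.
move=> oh [xso nx nA]; have uh := orth_unit (OW_orth oh).
split; [by rewrite Ad_so //; case: oh | exact: nilp_Ad | rewrite -Ad_proj_k //; exact: nilp_Ad].
Qed.

(** The induction invariant. Its second clause keeps the dichotomy needed for n odd: u has already
    dropped into the flag one step early, or the flag so far consists of combinations of the vectors
    A^k u. For i = 0 the latter is vacuous. *)
Definition flagged i x : Prop :=
  (forall j : 'I_n, (j < i)%N -> below j (x *m e j)) /\
  (below i.-1 (x *m v) \/
   forall j : 'I_n, (j < i)%N -> exists c, e j = krylov x *m c).

Lemma last_before (P : nat -> Prop) k :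
  ~ P 0%N -> P k -> exists j, [/\ (j < k)%N, ~ P j & P j.+1].
Proof.
move=> P0; elim: k => [//|k IHk] Pk; have [/IHk[j [jk nPj Pj]]|nPk] := EM (P k).
  by exists j; rewrite ltnW.
by exists k.
Qed.

Lemma fix_below h i w : (forall j : 'I_n, (j < i)%N -> h *m e j = e j) ->
  below i w -> h *m w = w.
Proof.
move=> he; apply: (@below_ind F p (fun w => h *m w = w)) => [|a b ha hb|c j ji]; first by rewrite mulmx0.
  by rewrite mulmxDr ha hb.
by rewrite -scalemxAr he.
Qed.

Section Cyclic.
Variable x : 'M[F]_n.
Hypothesis gx : doubly_nilpotent x.
Local Notation A := (proj_k x).
Local Notation u := (x *m v).
Local Notation Au k := (iter k (mulmx A) u).

Let xso : x \in so F n. Proof. by case: gx. Qed.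
Let Aso : A \in so F n. Proof. exact: proj_k_so. Qed.

Lemma bform_cyclic i j : B (Au i) (Au j) = 0.
Proof.
elim: i j => [|i IHi] j; first by case: gx => ? ? ?; apply: isotropic_cyclic.
by rewrite iterS (proj1 (mem_so A) Aso) -iterS IHi oppr0.
Qed.

Lemma bform_v_proj_k w : B v (A *m w) = 0.
Proof.
by rewrite -[LHS]opprK -(proj1 (mem_so A) Aso) proj_k_v // bform0l oppr0.
Qed.

Lemma bform_v_cyclic k : B v (Au k) = 0.
Proof. by case: k => [|k]; [apply: bform_v_so | apply: bform_v_proj_k]. Qed.

Lemma mul_perp w : B v w = 0 -> B u w = 0 -> x *m w = A *m w.
Proof.
by move=> vw uw; rewrite proj_k_mul // vw uw !mul0r !scale0r subr0 addr0.
Qed.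

Lemma mul_cyclic k : x *m Au k = Au k.+1.
Proof. by rewrite mul_perp ?bform_v_cyclic //; apply: (bform_cyclic 0). Qed.

(** Let E be the span of the first i vectors. If u is not in E, take the last A^k u outside E. If u
    is in E, then x and A agree on the vectors orthogonal to E and v. Either A sends all of them
    into E and e_i will do, or some A z is outside E and the last iterate w = A^(k+1) z outside E is
    isotropic: B(w, w) = - B(A^k z, A w) with A w in E. *)
Lemma flag_vector (i : 'I_n) : flagged i x -> (i < m)%N ->
  exists w, [/\ below (n - i) w, B w v = 0, B w w = 0, ~ below i w & below i (x *m w)] /\
    (below i u \/ exists k : 'I_n, w = Au k /\
      forall j : 'I_n, (j < i)%N -> exists c, e j = krylov x *m c).
Proof.
move=> [fl Ui] im; have m2 := mE p.
have [bu|nbu] := EM (below i u); last first.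
  have Ku : forall j : 'I_n, (j < i)%N -> exists c, e j = krylov x *m c.
    by case: Ui => // bu; case: nbu; apply: below_le bu; lia.
  have An0 : below i (Au n) by case: gx => _ _ nA; rewrite nA; apply: below0.
  have [k [kn nk bk]] := @last_before (fun k => below i (Au k)) n nbu An0.
  exists (Au k); split; last by right; exists (Ordinal kn).
  split=> //; last by rewrite mul_cyclic.
  - apply/below_orthP => j ji; have [c ->] := Ku j ji.
    rewrite (col_sum_e c) mulmx_sumr bform_suml big1 // => l _.
    by rewrite -scalemxAr bformZl krylov_col bform_cyclic mulr0.
  - by rewrite bformC bform_v_cyclic.
  - exact: bform_cyclic.
suff [w ww] : exists w,
    [/\ below (n - i) w, B w v = 0, B w w = 0, ~ below i w & below i (x *m w)].
  by exists w; split=> //; left.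
pose W z := below (n - i) z /\ B v z = 0.
have uW z : W z -> B u z = 0 by move=> [bz _]; apply: (below_bform bu).
have xW z : W z -> x *m z = A *m z by move=> Wz; apply: mul_perp; [case: Wz | apply: uW].
have We (j : 'I_n) : (j <= i)%N -> W (e j).
  move=> ji; split; last by apply: bform_ve; lia.
  by apply: below_e; lia.
have AW z : W z -> W (A *m z).
  move=> [bz vz]; split; last exact: bform_v_proj_k.
  apply/below_orthP => j ji; rewrite -[LHS]opprK -(proj1 (mem_so A) Aso).
  rewrite -xW; last by apply: We; apply: ltnW.
  by rewrite (below_bform (below_le (ltnW ji) (fl j ji)) bz) oppr0.
have [[z [Wz nz]]|nA0] := EM (exists z, W z /\ ~ below i (A *m z)); last first.
  exists (e i); have [bi vi] := We i (leqnn i); split=> //.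
  - by rewrite bformC.
  - by rewrite bform_ee; case: eqP => // /(congr1 val) /=; lia.
  - by move=> /(_ i (leqnn i)); rewrite eE eqxx => /eqP; rewrite oner_eq0.
  - by rewrite xW //; apply: contrapT => nb; apply: nA0; exists (e i).
have Wk k : W (iter k (mulmx A) z) by elim: k => //= k; apply: AW.
have An0 : below i (iter n.+1 (mulmx A) z).
  by rewrite iterSr; case: gx => _ _ nA; rewrite nA; apply: below0.
have [k [_ nk bk]] := @last_before (fun k => below i (iter k.+1 (mulmx A) z)) n nz An0.
exists (iter k.+1 (mulmx A) z); have [bw vw] := Wk k.+1.
split=> //; [by rewrite bformC | | by rewrite xW].
rewrite {1}iterS (proj1 (mem_so A) Aso) -iterS bformC (below_bform bk) ?oppr0 //.
by case: (Wk k).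
Qed.

End Cyclic.

Lemma flag_step x (i : 'I_n) : doubly_nilpotent x -> flagged i x -> (i < m)%N ->
  exists2 h, OW h & flagged i.+1 (Ad h x).
Proof.
move=> gx fx im; have [w [[bw wv ww nbw xw] wu]] := flag_vector gx fx im.
have [fl Ui] := fx; have xso : x \in so F n by case: gx.
have [h [oh hv he hw]] := witt_step (or_intror erefl) im bw wv ww nbw.
have uh := orth_unit oh; pose k := invmx h.
have ok : OW k by apply: OWV.
have ke (j : 'I_n) : (j < i)%N -> k *m e j = e j.
  by move=> ji; rewrite -{1}(he j ji) mulKmx.
have kw : k *m w = e i by rewrite -hw mulKmx.
exists k => //; split=> [j|].
  rewrite ltnS AdE invmxK -!mulmxA leq_eqVlt => /orP[/eqP/val_inj ->|ji].
    by rewrite hw (fix_below ke).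
  by rewrite he // (fix_below ke); [apply: fl | apply: below_le (fl j ji); apply: ltnW].
case: wu => [bu|[l [wE Ku]]].
  by left; rewrite Ad_mul_v // (fix_below ke).
right=> j; rewrite krylov_Ad // ltnS leq_eqVlt => /orP[/eqP/val_inj ->|ji].
  by exists (e l); rewrite -mulmxA krylov_col -wE kw.
by have [c ec] := Ku j ji; exists c; rewrite -mulmxA -ec ke.
Qed.

Lemma flag_of_doubly_nilpotent x : doubly_nilpotent x ->
  exists h, [/\ OW h, Ad h x \in so F n, strict_upper (Ad h x) &
    below m.-1 (Ad h x *m v) \/
    forall j : 'I_n, (j < m)%N -> exists c, e j = krylov (Ad h x) *m c].
Proof.
move=> gx; suff [h oh [fl Um]] : exists2 h, OW h & flagged m (Ad h x).
  have [xso nx _] := doubly_nilpotent_Ad oh gx.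
  exists h; split=> //; apply: strict_upper_of_cols => // i j jm ji.
  by rewrite -mulmx_eE; apply: fl.
have : (m <= m)%N by []; move: {1 3}(m) => i; elim: i => [|i IHi] im.
  exists 1%:M; first exact: OW1.
  by split=> //; right.
have [h oh fh] := IHi (ltnW im).
have i_n : (i < n)%N by have := mE p; lia.
have [k ok fk] := @flag_step (Ad h x) (Ordinal i_n) (doubly_nilpotent_Ad oh gx) fh im.
exists (k *m h); first exact: OWM.
by rewrite AdM ?orth_unit //; [case: ok | case: oh].
Qed.

End FlagConstruction.

(** * The two components when n is odd *)

Section Irreducible.
Variables (F : numClosedFieldType) (p : nat).
Local Notation n := p.+2.
Local Notation OW := (@OW F p).
Local Notation SOW := (@SOW F p).
Local Notation m := (m p).
Implicit Types (x y g h : 'M[F]_n) (w : 'cV[F]_n) (b : {vspace 'M[F]_n}).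

Lemma zirreducible_vspace b : zirreducible [set x | x \in b].
Proof.
apply: zirreducible_directed; first by exists 0; apply: mem0v.
move=> x y xb yb.
exists [set x + t *: (y - x) | t in [set t : F | (1 : {poly F}).[t] != 0]]; split.
- apply: zirreducible_rational_curve; first exact: oner_neq0.
  have alg := rational1_algebra (1 : {poly F}).
  apply: entries_add => //; first exact: entries_cst.
  apply: entries_scale => //; last exact: entries_cst.
  have -> : (fun t : F => t) = (fun t => ('X : {poly F}).[t]).
    by apply: funext => t; rewrite hornerX.
  exact: rational1_poly.
- by move=> _ [t _ <-] /=; rewrite memvD // memvZ // memvB.
- by exists 0; rewrite /= ?hornerC ?oner_eq0 // scale0r addr0.
- by exists 1; rewrite /= ?hornerC ?oner_eq0 // scale1r addrC subrK.
Qed.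

(** On orthogonal matrices the inverse is S g^T S, so the action is polynomial in g as well as in
    x. *)
Lemma zirreducible_Ad_sat b : zirreducible (Ad_sat SOW (nilrad b)).
Proof.
have -> : Ad_sat SOW (nilrad b) = [set z | exists2 g, SOW g & exists2 x,
    [set x | x \in lie_prod b b] x & z = g *m x *m (skew_mx n *m g^T *m skew_mx n)].
  apply/seteqP; split=> z [g sg [x xb ->]]; exists g => //; exists x => //;
    by rewrite AdE orth_inv //; case: sg => -[].
have reg := @regular_algebra F n n.
apply: (@zirreducible_image2 F n n n n n n
  (fun g x => g *m x *m (skew_mx n *m g^T *m skew_mx n))).
- move=> g _; apply: entries_mul => //; last exact: entries_cst.
  by apply: entries_mul => //; [apply: entries_cst | apply: entries_id].
- move=> x _; apply: entries_mul => //.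
    by apply: entries_mul => //; [apply: entries_id | apply: entries_cst].
  apply: entries_mul => //; last exact: entries_cst.
  apply: entries_mul => //; first exact: entries_cst.
  by apply: entries_tr; apply: entries_id.
- exact: SOW_irreducible.
- exact: zirreducible_vspace.
Qed.

Lemma strict_upper_nilp x : strict_upper x -> nilp x.
Proof.
move=> sx w; suff H k : below (n - k) (iter k (mulmx x) w).
  by have Hn := H n; apply/colP => i; rewrite [RHS]mxE; apply: Hn; rewrite subnn.
elim: k => [|k IHk] /=; first by move=> i; have := ltn_ord i; lia.
by rewrite subnS; apply: strict_upper_below.
Qed.

(** Such isometries preserve b_+ and its nilradical, because upper triangularity in so is decided by
    the first m columns. *)
Definition fixes_flag h : Prop := orth F n h /\ forall j : 'I_n, (j < m)%N -> h *m e j = e j.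

Lemma fixes_flagV h : fixes_flag h -> fixes_flag (invmx h).
Proof. by move=> [oh he]; split=> [|j jm]; [exact: orthV | rewrite orth_fixV ?he]. Qed.

Lemma Ad_fixes_flag_col h x (j : 'I_n) : fixes_flag h -> (j < m)%N -> below j.+1 (x *m e j) ->
  Ad h x *m e j = x *m e j.
Proof.
move=> hf jm bx; rewrite AdE -!mulmxA; have [_ ->] := fixes_flagV hf => //.
by apply: (fix_below (i := m)); [case: hf | apply: below_le bx].
Qed.

Lemma Ad_strict_upper h x : fixes_flag h -> x \in so F n -> strict_upper x ->
  strict_upper (Ad h x).
Proof.
move=> hf xso sx; have [oh _] := hf.
apply: strict_upper_of_cols; first by rewrite Ad_so.
  by apply: nilp_Ad (strict_upper_nilp sx); apply: orth_unit.
have bx (j : 'I_n) : below j (x *m e j) by move=> k jk; rewrite mulmx_eE sx.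
move=> i j jm ji; rewrite -mulmx_eE Ad_fixes_flag_col //; first exact: bx.
by apply: below_le (bx j).
Qed.

Lemma Ad_b_plus_sub h : orth F n h ->
  (forall x, x \in b_plus F n -> upper (Ad h x)) -> (Ad h @: b_plus F n)%VS = b_plus F n.
Proof.
move=> oh ux; have uh := orth_unit oh.
apply/eqP; rewrite eqEdim dimv_Ad // leqnn andbT; apply/subvP => y.
rewrite mem_Ad_img // => yb; apply/mem_b_plus; rewrite -(Ad_unitVK y uh).
split; last exact: ux.
by rewrite Ad_so //; case/mem_b_plus: yb.
Qed.

Lemma Ad_fixes_flag_b_plus h : fixes_flag h -> (Ad h @: b_plus F n)%VS = b_plus F n.
Proof.
move=> hf; have [oh _] := hf; apply: Ad_b_plus_sub => // x /mem_b_plus[xso ux].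
apply: upper_of_cols; first by rewrite Ad_so.
have bx (j : 'I_n) : below j.+1 (x *m e j) by move=> k jk; rewrite mulmx_eE ux.
by move=> i j jm ji; rewrite -mulmx_eE Ad_fixes_flag_col //; apply: bx.
Qed.

Lemma Ad_upper_b_plus h : orth F n h -> upper h -> (Ad h @: b_plus F n)%VS = b_plus F n.
Proof.
move=> oh uh; apply: Ad_b_plus_sub => // x /mem_b_plus[xso ux].
have u0 y : upper y -> shifted 0 y by move=> uy i j; rewrite addn0; apply: uy.
rewrite AdE => i j ji; have uV : upper (invmx h).
  move=> k l lk; rewrite orth_inv // -mulmx_eE -!mulmxA skew_mulE.
  have -> : skew_mx n *m e l = e (rev_ord l) :> 'cV[F]_n.
    by apply/colP => s; rewrite skew_mulE !eE -(inj_eq rev_ord_inj) rev_ordK.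
  by rewrite mulmx_eE mxE uh //=; have := ltn_ord k; lia.
by apply: (shifted_mul (shifted_mul (u0 _ uh) (u0 _ ux)) (u0 _ uV)); rewrite !addn0.
Qed.

(** For n even v = e_mid - e_-mid, and a = e_mid + e_-mid is anisotropic, orthogonal to v and to the
    half flag. Its reflection merges the two cosets of [SOW] in [OW]. *)
Lemma even_reflection : ~~ odd n -> exists t, [/\ OW t, \det t = -1 & fixes_flag t].
Proof.
move=> en; pose a : 'cV[F]_n := e mid + e (rev_ord mid).
have re := negPf (rev_mid_even en).
have a0 : bform a a != 0.
  rewrite /a !bformP !bform_ee !rev_ordK !eqxx (eq_sym mid) re.
  by rewrite /= mulr0n add0r addr0 -mulr2n pnatr_eq0.
have av : bform a (v F p) = 0.
  rewrite bformC /v en /= mulr1n scale1r /a !bformP !bform_ee !rev_ordK !eqxx (eq_sym mid) re.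
  by rewrite /= mulr0n mulr1n; ring.
exists (refl a); split; [exact: OW_refl | exact: det_refl | split].
  exact: orth_refl.
move=> j jm.
have jn (k : 'I_n) : (m <= k)%N && (k < n - m)%N -> bform (e k) (e j) = 0 :> F.
  by move=> mk; rewrite bform_ee; case: eqP => // jk; move: jm mk; rewrite jk /=; lia.
have mm := mid_m p; have me := mE p.
by rewrite refl_fix // /a bformDl !jn ?addr0 //=; move: en; lia.
Qed.

Section FiberDescription.
Variables (fk : 'I_(rk n.-1) -> 'M[F]_n -> F) (f : 'I_(rk n) -> 'M[F]_n -> F).
Hypothesis hfk : basic_invariants (kalg F n) (Kgrp F n) fk.
Hypothesis hf : basic_invariants (so F n) (SO F n) f.

Lemma fiber_doubly_nilpotent x : Phi_fiber0 fk f x -> doubly_nilpotent x.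
Proof. exact: fiber_nilp. Qed.

Lemma fiberE : Phi_fiber0 fk f = Ad_sat OW (nilrad (b_plus F n)).
Proof.
apply/seteqP; split=> [x /fiber_doubly_nilpotent/flag_of_doubly_nilpotent|].
  move=> [h [oh xso sx _]]; exists (invmx h); first exact: OWV.
  exists (Ad h x); last by rewrite Ad_unitK // orth_unit //; case: oh.
  by rewrite nilrad_b_plusE.
by move=> _ [h oh [x xn ->]]; apply: fiber_of_nilrad.
Qed.

Lemma fiber_even : ~~ odd n -> Phi_fiber0 fk f = Ad_sat SOW (nilrad (b_plus F n)).
Proof.
move=> en; rewrite fiberE; apply/seteqP; split=> y [h oh [x xn ->]]; last first.
  by exists h; [case: oh | exists x].
have [dh|dh] := OW_det oh; first by exists h => //; exists x.
have [t [ot dt ft]] := even_reflection en.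
have uh := orth_unit (OW_orth oh); have ut := orth_unit (OW_orth ot).
exists (h *m t).
  by split; [exact: OWM | rewrite det_mulmx dh dt mulrNN mulr1].
exists (Ad (invmx t) x); last by rewrite AdM // Ad_unitVK.
move: xn; rewrite nilrad_b_plusE => -[xso sx]; split; last first.
  by apply: Ad_strict_upper => //; apply: fixes_flagV.
by rewrite Ad_so //; apply: orthV; case: ot.
Qed.

End FiberDescription.
End Irreducible.

Section OddCase.
Variables (F : numClosedFieldType) (p : nat).
Local Notation n := p.+2.
Local Notation B := (@bform F n).
Local Notation S := (@skew_mx F n).
Local Notation v := (v F p).
Local Notation OW := (@OW F p).
Local Notation SOW := (@SOW F p).
Local Notation m := (m p).
Hypothesis on : odd n.
Implicit Types (x y g h : 'M[F]_n) (w : 'cV[F]_n) (b : {vspace 'M[F]_n}).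

Lemma odd_m : n = (m.*2).+1.
Proof. by have := mE p; move: on; lia. Qed.

Lemma m_gt0 : (0 < m)%N.
Proof. by have := odd_m; lia. Qed.

Lemma mid_odd : @mid p = m :> nat.
Proof. by rewrite mid_m; have := odd_m; lia. Qed.

Lemma v_odd : v = e mid.
Proof. by rewrite /v on scale0r subr0. Qed.

Definition last_pos : 'I_n := inord m.-1.

Lemma val_last_pos : last_pos = m.-1 :> nat.
Proof. by rewrite inordK //; have := odd_m; lia. Qed.

Lemma val_rev_last_pos : rev_ord last_pos = m.+1 :> nat.
Proof. by rewrite /= val_last_pos; have := odd_m; have := m_gt0; lia. Qed.

(* Exchanges e_l and e_{-l}; minus this reflection represents s_{alpha_l}. *)
Definition swap_refl : 'M[F]_n := refl (e last_pos - e (rev_ord last_pos)).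
Local Notation r := swap_refl.

Lemma last_neq_rev : (last_pos == rev_ord last_pos) = false.
Proof.
apply/negP => /eqP/(congr1 (@nat_of_ord n)).
by rewrite val_rev_last_pos val_last_pos; lia.
Qed.

Lemma mid_neq_last : (@mid p == last_pos) = false.
Proof.
apply/negP => /eqP/(congr1 (@nat_of_ord n)).
by rewrite mid_odd val_last_pos; have := m_gt0; lia.
Qed.

Lemma mid_neq_rev_last : (@mid p == rev_ord last_pos) = false.
Proof.
apply/negP => /eqP/(congr1 (@nat_of_ord n)).
by rewrite mid_odd val_rev_last_pos; lia.
Qed.

Lemma swap_norm : B (e last_pos - e (rev_ord last_pos))
  (e last_pos - e (rev_ord last_pos)) = - 2.
Proof.
rewrite !bformP !bform_ee !rev_ordK !eqxx (eq_sym _ last_pos) last_neq_rev.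
by rewrite mulr0n mulr1n; ring.
Qed.

Lemma swap_norm0 : B (e last_pos - e (rev_ord last_pos))
  (e last_pos - e (rev_ord last_pos)) != 0.
Proof. by rewrite swap_norm oppr_eq0 pnatr_eq0. Qed.

Lemma swap_fix k : k != last_pos -> k != rev_ord last_pos -> r *m e k = e k.
Proof.
move=> k1 k2; rewrite refl_fix // bformBl !bform_ee rev_ordK.
by rewrite (negPf k1) (negPf k2) subrr.
Qed.

Lemma swap_last : r *m e last_pos = e (rev_ord last_pos).
Proof.
rewrite refl_swap ?swap_norm0 // !bform_ee rev_ordK (eq_sym _ last_pos).
by rewrite last_neq_rev.
Qed.

Lemma swapK x : r *m (r *m x) = x.
Proof. exact: refl_involutive swap_norm0. Qed.

Lemma OW_swap : OW r.
Proof.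
apply: OW_refl; first exact: swap_norm0.
rewrite v_odd bformBl !bform_ee rev_ordK.
by rewrite mid_neq_last mid_neq_rev_last subrr.
Qed.

Lemma swap_rev_last : r *m e (rev_ord last_pos) = e last_pos.
Proof.
by rewrite -swap_last mulmxA -[X in r *m X]mulmx1 swapK mul1mx.
Qed.

Lemma det_swap : \det r = -1.
Proof. exact: det_refl swap_norm0. Qed.

Lemma invmx_swap : invmx r = r.
Proof.
have ur := orth_unit (OW_orth OW_swap).
by rewrite -[RHS]mulmx1 -(mulmxV ur) swapK.
Qed.

Lemma Ad_swapK x : Ad r (Ad r x) = x.
Proof.
by rewrite -{1}invmx_swap Ad_unitK //; apply: orth_unit (OW_orth OW_swap).
Qed.

Definition nplus : set 'M[F]_n := nilrad (b_plus F n).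
Definition bminus : {vspace 'M[F]_n} := (Ad r @: b_plus F n)%VS.

Lemma nplusE : nplus = [set x | x \in so F n /\ strict_upper x].
Proof. exact: nilrad_b_plusE. Qed.

Lemma nilrad_bminusE x : nilrad bminus x <-> nplus (Ad r x).
Proof.
have ur := orth_unit (OW_orth OW_swap).
by rewrite /nilrad /= lie_prod_Ad // mem_Ad_img // invmx_swap.
Qed.

(** [bminus] is obtained with a reflection of determinant -1, so Ad(K) n_- is the part of Ad([OW])
    n_+ coming from the other coset. *)
Lemma Ad_sat_minusP x : Ad_sat SOW (nilrad bminus) x <->
  exists g y, [/\ OW g, \det g = -1, nplus y & x = Ad g y].
Proof.
have or := OW_swap; have ur := orth_unit (OW_orth or).
split=> [[g [og dg] [y /nilrad_bminusE yn ->]]|[g [y [og dg yn ->]]]].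
  exists (g *m r), (Ad r y); split=> //; first exact: OWM.
    by rewrite det_mulmx dg det_swap mul1r.
  by rewrite AdM ?Ad_swapK // orth_unit //; case: og.
exists (g *m r).
  by split; [exact: OWM | rewrite det_mulmx dg det_swap mulrNN mulr1].
exists (Ad r y); first by apply/nilrad_bminusE; rewrite Ad_swapK.
by rewrite AdM ?Ad_swapK // orth_unit //; case: og.
Qed.

Lemma grading_e (k : 'I_n) :
  grading_mx F p *m e k = ((n.-1)%:R - (k.*2)%:R : F) *: e k.
Proof.
apply/colP => i; rewrite mul_diag_mx [in RHS]mxE mxE mxE eE.
by case: eqP => [->//|]; rewrite !mulr0.
Qed.

Lemma Ad_swap_grading : Ad r (grading_mx F p) =
  grading_mx F p - epsilon n./2 (grading_mx F p) *: coroot_short F n.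
Proof.
have mn2 : n./2 = m by have := odd_m; lia.
have m0 := m_gt0; have om := odd_m.
have -> : epsilon n./2 (grading_mx F p) = 2.
  rewrite /epsilon mn2 (big_pred1 last_pos) => [|i].
    by rewrite mxE eqxx mulr1n mxE val_last_pos -natrB; [congr (_%:R); lia | lia].
  by rewrite -[RHS]/(i == last_pos :> nat) val_last_pos; lia.
have last2 : (n.-1)%:R - (last_pos.*2)%:R = 2 :> F.
  by rewrite val_last_pos -natrB; [congr (_%:R); lia | lia].
have rev2 : (n.-1)%:R - ((rev_ord last_pos).*2)%:R = - 2 :> F.
  have e2 : (m.+1.*2 = n.-1 + 2)%N by lia.
  by rewrite val_rev_last_pos e2 natrD opprD addrA subrr add0r.
apply: mx_eq_on_e => k; rewrite AdE invmx_swap -!mulmxA [RHS]mulmxBl -[in RHS]scalemxAl.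
have corE : coroot_short F n *m e k =
    ((k == last_pos)%:R *+ 2 - (k == rev_ord last_pos)%:R *+ 2) *: e k.
  apply/colP => i; rewrite /coroot_short mn2 mul_diag_mx [in RHS]mxE mxE mxE eE.
  have [->|ik] := eqVneq i k; last by rewrite mulr0n !mulr0.
  congr ((_%:R *+ 2 - _%:R *+ 2) * _).
    congr (nat_of_bool _).
    by rewrite -[RHS]/(k == last_pos :> nat) val_last_pos; lia.
  congr (nat_of_bool _).
  by rewrite -[RHS]/(k == rev_ord last_pos :> nat) val_rev_last_pos; lia.
rewrite corE grading_e scalerA -scalerBl.
have [->|kl] := eqVneq k last_pos.
  rewrite swap_last grading_e rev2 -scalemxAr swap_rev_last last2 last_neq_rev.
  by congr (_ *: _); rewrite mulr1n mulr0n; ring.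
have [->|kr] := eqVneq k (rev_ord last_pos).
  rewrite swap_rev_last grading_e last2 -scalemxAr swap_last rev2.
  by congr (_ *: _); rewrite mulr1n mulr0n; ring.
rewrite swap_fix // grading_e -scalemxAr swap_fix //.
by congr (_ *: _); rewrite mulr0n; ring.
Qed.

(** w and the swap act alike on [grading_mx], so k = r^-1 w commutes with it. Its eigenvalues are
    distinct, hence k is diagonal and preserves b_+. *)
Lemma represents_b_minus (w : 'M[F]_n) : represents_s_short w -> b_minus w = bminus.
Proof.
move=> [[ow dw] aw]; have or := OW_swap; have ur := orth_unit (OW_orth or).
have uw : w \in unitmx by apply: (orth_unit (F := F)).
have wr : Ad w (grading_mx F p) = Ad r (grading_mx F p).
  by rewrite aw ?grading_so ?diag_mx_is_diag // Ad_swap_grading.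
pose k := invmx r *m w.
have kcomm : lieb (grading_mx F p) k = 0.
  have : Ad w (grading_mx F p) *m w = w *m grading_mx F p by rewrite AdE mulmxKV.
  rewrite wr AdE => wE; apply/eqP; rewrite subr_eq0; apply/eqP.
  by rewrite /k -[RHS]mulmxA -wE !mulmxA mulVmx // mul1mx.
rewrite /b_minus -(mulKVmx ur w) Ad_imgM ?unitmx_mul ?unitmx_inv ?ur // -/k.
rewrite (@Ad_upper_b_plus _ _ k) //; first by apply: orthM => //; apply: orthV; case: or.
move=> i j ji; have : lieb (grading_mx F p) k i j = 0 by rewrite kcomm mxE.
rewrite grading_lieb => /eqP; rewrite mulf_eq0 subr_eq0 eqr_nat => /orP[|/eqP//].
by rewrite -!muln2 eqn_pmul2r // => /eqP E; rewrite E ltnn in ji.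
Qed.

Definition corner : 'M[F]_n := diag_mx (\row_i (i < m)%N%:R).
Local Notation P := corner.

Lemma corner_mul w k : (P *m w) k 0 = (k < m)%N%:R * w k 0.
Proof. by rewrite mul_diag_mx mxE mxE. Qed.

(** The adjoint of P for B is the projection onto the last m coordinates, so the two add up to 1
    away from e_0, where c has no component. *)
Lemma corner_bform a c : B v c = 0 -> B (P *m a) c + B a (P *m c) = B a c.
Proof.
rewrite v_odd bform_el rev_mid_odd // => c0.
rewrite !bformE -big_split /=; apply: eq_bigr => i _.
rewrite !corner_mul; have om := odd_m; have := ltn_ord i.
have [->|im] := eqVneq i mid; first by rewrite rev_mid_odd // c0 !mulr0 addr0.
have im' : (i : nat) <> m by rewrite -mid_odd => /val_inj E; rewrite E eqxx in im.
move=> i_n; have -> : (rev_ord i < m)%N = ~~ (i < m)%N by rewrite /=; lia.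
by case: (i < m)%N; rewrite /= ?mulr1n ?mulr0n; ring.
Qed.

Lemma OW_fix g : OW g -> g *m v = v.
Proof. by case. Qed.

(* Jacobi's complementary minors: the block and its complement in g^-1 have
   proportional determinants, and orthogonality identifies the latter with the
   former. *)
Lemma det_corner g : OW g -> \det g = -1 -> \det (1%:M + (g - 1%:M) *m P) = 0.
Proof.
move=> og dg; have ug := orth_unit (OW_orth og).
have detS (X : 'M[F]_n) : \det (S *m X^T *m S) = \det X.
  by rewrite !det_mulmx det_tr mulrAC -det_mulmx skew_sqr det1 mul1r.
have e1 : invmx g *m (1%:M + (g - 1%:M) *m P) = P + invmx g *m (1%:M - P).
  rewrite mulmxDr mulmxA mulmxBr mulVmx // !mulmx1 mulmxBl mul1mx mulmxBr mulmx1.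
  by rewrite addrCA.
(* Let P' be the adjoint of P. The adjoint of P + g^-1 (1 - P) sends b to g b - P' c with c = g b -
   b, and P' c = c - P c because c is orthogonal to v. The result is b + P c. *)
have e2 : S *m (P + invmx g *m (1%:M - P))^T *m S = 1%:M + P *m (g - 1%:M).
  apply: mx_eq_on_e => k; apply/eqP; rewrite -subr_eq0; apply/eqP.
  apply: bform_nondeg => a; rewrite bformC bformBr -bform_mulmx.
  set b := e k; pose c := g *m b - b.
  have vc : B v c = 0 by rewrite /c bformBr -{1}(OW_fix og) orth_bform ?subrr //; case: og.
  rewrite !mulmxDl -!mulmxA !mulmxBl !mul1mx -/c bformDl bform_invl; last by case: og.
  rewrite bformBl bformDr.
  have := corner_bform a vc; rewrite {1 3}/c !bformBr => h.
  have -> : B a (g *m b) = B a (P *m c) + B (P *m a) (g *m b) - B (P *m a) b + B a b.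
    by rewrite -[LHS](subrK (B a b)) -h; ring.
  by ring.
have := congr1 determinant e1; rewrite det_mulmx det_inv dg -(detS (P + _)) e2.
(* With det g = -1 the minor equals its own opposite. *)
rewrite -det_sylvester invrN1 mulN1r => /eqP.
by rewrite eq_sym -addr_eq0 -mulr2n mulrn_eq0 => /eqP.
Qed.

End OddCase.

(** * The determinant separating the two components *)

Section OddComponents.
Variables (F : numClosedFieldType) (p : nat).
Local Notation n := p.+2.
Local Notation B := (@bform F n).
Local Notation v := (v F p).
Local Notation OW := (@OW F p).
Local Notation SOW := (@SOW F p).
Local Notation m := (m p).
Local Notation r := (swap_refl F p).
Local Notation nplus := (@nplus F p).
Local Notation bminus := (bminus F p).
Hypothesis on : odd n.
Implicit Types (x y g h : 'M[F]_n) (w : 'cV[F]_n).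

(** Agrees with [proj_k] on so, but is a polynomial formula on all matrices, as closed conditions
    require. *)
Definition theta_average x : 'M[F]_n := 2^-1 *: (x + refl v *m x *m refl v).

Lemma theta_averageE x : x \in so F n -> theta_average x = proj_k x.
Proof. by move=> xso; rewrite proj_kE // thetaE. Qed.

(* Singular iff the vectors A^k u with k < m are dependent modulo the last
   n - m basis vectors, where u = x v and A = x_k. *)
Definition krylov_test x : 'M[F]_n := \matrix_(i, k)
  (if (k < m)%N then iter k (mulmx (theta_average x)) (x *m v) i 0 else (i == k)%:R).

Lemma krylov_test_lt x (k : 'I_n) : x \in so F n -> (k < m)%N ->
  krylov_test x *m e k = iter k (mulmx (proj_k x)) (x *m v).
Proof. by move=> xso km; apply/colP => i; rewrite mulmx_eE mxE km theta_averageE. Qed.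

Lemma krylov_test_ge x (k : 'I_n) : (m <= k)%N -> krylov_test x *m e k = e k.
Proof. by move=> mk; apply/colP => i; rewrite mulmx_eE mxE ltnNge mk eE. Qed.

Lemma krylov_test_regular T (A : set (T -> F)) (phi : T -> 'M[F]_n) :
  function_algebra A -> entries_in A phi -> entries_in A (fun t => krylov_test (phi t)).
Proof.
move=> alg phiA i k; under eq_fun do rewrite mxE.
case: (k < m)%N; last exact: algebra_cst.
suff H : entries_in A (fun t => iter k (mulmx (theta_average (phi t))) (phi t *m v)).
  exact: H.
apply: entries_iter => //; last by apply: entries_mul => //; apply: entries_cst.
apply: entries_scale => //; first exact: algebra_cst.
apply: entries_add => //; apply: entries_mul => //; last exact: entries_cst.
by apply: entries_mul => //; apply: entries_cst.
Qed.

(** y v = y e_0 lies in the span of the first m vectors, which is totally isotropic and orthogonal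
    to v. There y and its projection agree, and each application lowers the level by one. *)
Lemma nplus_cyclic y k : nplus y ->
  below (m - k) (iter k (mulmx (proj_k y)) (y *m v)) /\
  iter k (mulmx (proj_k y)) (y *m v) = iter k (mulmx y) (y *m v).
Proof.
rewrite nplusE => -[yso sy].
have bu : below m (y *m v).
  rewrite v_odd // -(mid_odd on) -[nat_of_ord mid]/(mid.+1.-1).
  by apply: strict_upper_below => //; apply: below_e.
elim: k => [|k [IHb IHe]]; first by rewrite subn0.
have Aw w : below m w -> proj_k y *m w = y *m w.
  move=> bw; rewrite proj_k_mul // (below_bform_v _ bw) //.
  rewrite (below_bform bu); last by apply: below_le bw; have := odd_m on; lia.
  by rewrite !mul0r !scale0r subr0 addr0.
have bk : below m (iter k (mulmx (proj_k y)) (y *m v)) by apply: below_le IHb; lia.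
by rewrite !iterS Aw // subnS -IHe; split=> //; apply: strict_upper_below.
Qed.

(** 1 + (g - 1) P agrees with g on the first m basis vectors and with the identity on the others.
    The vectors A^k u of y lie in the former span and are moved by g; the remaining columns are
    untouched. *)
Lemma krylov_test_Ad g y : OW g -> nplus y ->
  krylov_test (Ad g y) = (1%:M + (g - 1%:M) *m corner F p) *m krylov_test y.
Proof.
move=> og yn; have yso : y \in so F n by move: yn; rewrite nplusE => -[].
have gyso : Ad g y \in so F n by rewrite Ad_so //; case: og.
apply: mx_eq_on_e => k; rewrite -mulmxA.
have Pw w : (1%:M + (g - 1%:M) *m corner F p) *m w =
    w + (g *m (corner F p *m w) - corner F p *m w).
  by rewrite mulmxDl mul1mx -mulmxA mulmxBl mul1mx.
have [km|mk] := ltnP k m; last first.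
  rewrite !krylov_test_ge // Pw.
  have -> : corner F p *m e k = 0; last by rewrite mulmx0 subrr addr0.
  apply/colP => i; rewrite corner_mul eE mxE; case: eqP => [->|_]; last by rewrite mulr0n mulr0.
  by rewrite ltnNge mk mul0r.
rewrite !krylov_test_lt // Pw -Ad_proj_k // Ad_mul_v // iter_Ad; last by apply: orth_unit; case: og.
have [bk _] := nplus_cyclic k yn; set w := iter _ _ _ in bk *.
have -> : corner F p *m w = w.
  apply/colP => i; rewrite corner_mul; case: ltnP => im; first by rewrite mul1r.
  by rewrite mul0r bk //; lia.
by rewrite addrC subrK.
Qed.

(** The determinant is not invariant under K, hence the quantifier over the whole group; the
    intersection is still closed. *)
Definition minus_closed : set 'M[F]_n :=
  [set x | forall k, SOW k -> \det (krylov_test (Ad k x)) = 0].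

Lemma zclosed_minus : zclosed minus_closed.
Proof.
apply: zclosed_bigcap_cond => k _; apply: zclosed_eq0.
have reg := @regular_algebra F n n.
apply: algebra_det => //; apply: (krylov_test_regular (phi := fun x => Ad k x)) => //.
have -> : (fun x => Ad k x) = (fun x => k *m x *m invmx k) by apply: funext => x; rewrite AdE.
apply: entries_mul => //; last exact: entries_cst.
by apply: entries_mul => //; [apply: entries_cst | apply: entries_id].
Qed.

Lemma minus_sub_closed x : Ad_sat SOW (nilrad bminus) x -> minus_closed x.
Proof.
move=> /(Ad_sat_minusP on)[g [y [og dg yn ->]]] k [ok dk].
rewrite -AdM ?orth_unit //; [|by case: ok|by case: og].
rewrite krylov_test_Ad //; last exact: OWM.
by rewrite det_mulmx det_corner ?mul0r //; [exact: OWM | rewrite det_mulmx dk dg mul1r].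
Qed.

Lemma krylov_test_unit x : (forall j : 'I_n, (j < m)%N -> exists c, e j = krylov_test x *m c) ->
  \det (krylov_test x) != 0.
Proof.
move=> h; have hh (j : 'I_n) : exists c, e j = krylov_test x *m c.
  have [/h//|mj] := ltnP j m; by exists (e j); rewrite krylov_test_ge.
have [c cE] := choice hh; pose C : 'M[F]_n := \matrix_(i, j) c j i 0.
have : krylov_test x *m C = 1%:M.
  apply: mx_eq_on_e => j; rewrite mul1mx [RHS]cE -mulmxA; congr (_ *m _).
  by apply/colP => i; rewrite mulmx_eE mxE.
by move/mulmx1_unit => [+ _]; rewrite unitmxE unitfE.
Qed.

(** On n_+ the iterates A^k u vanish from k = m on, so the m columns kept in the test already span
    the whole cyclic space. *)
Lemma nplus_krylov_test x : nplus x ->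
  (forall j : 'I_n, (j < m)%N -> exists c, e j = krylov x *m c) ->
  \det (krylov_test x) != 0.
Proof.
move=> xn h; have xso : x \in so F n by move: xn; rewrite nplusE => -[].
apply: krylov_test_unit => j /h[c ->].
exists (\sum_(k < n | (k < m)%N) c k 0 *: e k).
rewrite [in LHS](col_sum_e c) !mulmx_sumr [RHS]big_mkcond /=; apply: eq_bigr => k _.
rewrite -scalemxAr krylov_col; case: ltnP => km.
  by rewrite -scalemxAr krylov_test_lt.
have [bk _] := nplus_cyclic k xn.
suff -> : iter k (mulmx (proj_k x)) (x *m v) = 0 by rewrite scaler0.
by apply/colP => i; rewrite [RHS]mxE; apply: bk; lia.
Qed.

(** The hypothesis says that x has no component in the root space of alpha_l, and the reflection
    s_{alpha_l} permutes the other positive roots. *)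
Lemma nplus_swap x : nplus x -> below m.-1 (x *m v) -> nplus (Ad r x).
Proof.
rewrite !nplusE => -[xso sx] bu; have or := OW_swap F on.
have ur := orth_unit (OW_orth or); have om := odd_m on; have m0 := m_gt0 on.
split; first by rewrite Ad_so //; case: or.
apply: strict_upper_of_cols; first by rewrite Ad_so //; case: or.
  by apply: nilp_Ad => //; apply: strict_upper_nilp.
have vl := val_last_pos on; have vr := val_rev_last_pos on.
have rfix w : below m.-1 w -> r *m w = w.
  apply: fix_below => j jm; apply: swap_fix => //; apply/negP => /eqP E; move: jm; rewrite E.
    by rewrite vl ltnn.
  by rewrite vr; lia.
have bx (j : 'I_n) : below j (x *m e j) by move=> k jk; rewrite mulmx_eE sx.
move=> i j jm ji; rewrite -mulmx_eE AdE invmx_swap // -!mulmxA.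
have [jl|jl] := eqVneq j (last_pos p); last first.
  have jm1 : (j < m.-1)%N.
    have : (j : nat) <> m.-1 by rewrite -vl => /val_inj E; rewrite E eqxx in jl.
    lia.
  rewrite swap_fix //; last by apply/negP => /eqP E; move: jm; rewrite E vr; lia.
  by rewrite rfix; [apply: bx | apply: below_le (bx j); lia].
rewrite jl swap_last // in ji *.
have bw : below m.-1 (x *m e (rev_ord (last_pos p))).
  move=> k mk; rewrite mulmx_eE; have [rk|kr] := leqP (rev_ord (last_pos p)) k; first exact: sx.
  have [->|kl] := eqVneq k (last_pos p); first exact: so_antidiag.
  have -> : k = mid.
    apply: val_inj; rewrite /= (mid_odd on).
    have : (k : nat) <> m.-1 by rewrite -vl => /val_inj E; rewrite E eqxx in kl.
    by move: kr; rewrite vr; lia.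
  rewrite (so_entry _ _ xso) rev_ordK rev_mid_odd // -mulmx_eE -v_odd // bu ?oppr0 //.
  by rewrite vl.
by rewrite rfix //; apply: bw; rewrite -vl.
Qed.

(** Ones above the diagonal, with the sign changed from row m on to land in so. Its vectors A^k u
    are e_l, ..., e_1, which makes it the witness separating the two components. *)
Definition regular_nilpotent : 'M[F]_n :=
  \matrix_(i, j) ((j == i.+1 :> nat)%:R * (if (i < m)%N then 1 else -1)).

Lemma regular_nplus : nplus regular_nilpotent.
Proof.
rewrite nplusE; split; last by move=> i j ji; rewrite mxE (_ : (_ == _) = false) ?mul0r //; lia.
have om := odd_m on; apply/so_entryP => i j; rewrite !mxE.
have i_n := ltn_ord i; have jn := ltn_ord j.
have -> : (rev_ord i == (rev_ord j).+1 :> nat) = (j == i.+1 :> nat) by rewrite /=; lia.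
case: eqP => [ji|]; last by rewrite !mul0r oppr0.
have -> : (rev_ord j < m)%N = ~~ (i < m)%N by rewrite /=; lia.
by rewrite -mulrN; case: (i < m)%N; rewrite ?opprK.
Qed.

Lemma regular_krylov_test : \det (krylov_test regular_nilpotent) != 0.
Proof.
have rn := regular_nplus; have om := odd_m on.
have rso : regular_nilpotent \in so F n by move: rn; rewrite nplusE => -[].
have ye (k l : 'I_n) : (k < m)%N -> l = k.+1 :> nat -> regular_nilpotent *m e l = e k.
  move=> km lk; apply/colP => i; rewrite mulmx_eE eE mxE lk eqSS eq_sym.
  by rewrite -[i == k]/(i == k :> nat); case: eqP => [->|]; rewrite ?km ?mulr1 ?mul0r.
have it (k : nat) (j : 'I_n) : (k < m)%N -> j = (m - k.+1)%N :> nat ->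
    iter k (mulmx regular_nilpotent) (regular_nilpotent *m v) = e j.
  elim: k j => [|k IHk] j km jk /=.
    by rewrite v_odd //; apply: ye; rewrite ?(mid_odd on); lia.
  have l_n : (m - k.+1 < n)%N by lia.
  by rewrite (IHk (Ordinal l_n)) //; [apply: ye => /= | ]; lia.
apply: krylov_test_unit => j jm.
have k_n : (m - j.+1 < n)%N by lia.
exists (e (Ordinal k_n)); rewrite krylov_test_lt //=; last by lia.
by have [_ ->] := nplus_cyclic (m - j.+1) rn; rewrite (it _ j) //; lia.
Qed.

Section Components.
Variables (fk : 'I_(rk n.-1) -> 'M[F]_n -> F) (f : 'I_(rk n) -> 'M[F]_n -> F).
Hypothesis hfk : basic_invariants (kalg F n) (Kgrp F n) fk.
Hypothesis hf : basic_invariants (so F n) (SO F n) f.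
Local Notation X := (Phi_fiber0 fk f).
Local Notation Yp := (Ad_sat SOW nplus).
Local Notation Ym := (Ad_sat SOW (nilrad bminus)).

Lemma fiber_odd : X = Yp `|` Ym.
Proof.
rewrite fiberE //; apply/seteqP; split=> x.
  move=> [g og [y yn ->]]; have [dg|dg] := OW_det og.
    by left; exists g => //; exists y.
  by right; apply/Ad_sat_minusP => //; exists g, y.
move=> [[g [og _] [y yn ->]]|/(Ad_sat_minusP on)[g [y [og _ yn ->]]]];
  by exists g => //; exists y.
Qed.

(** Bring x into n_+ by h. If det h = -1 nothing is left to do. If det h = 1, either the swap can be
    inserted by [nplus_swap], or the determinant at Ad h x is nonzero, against the hypothesis. *)
Lemma fiber_minus x : X x -> minus_closed x -> Ym x.
Proof.
move=> Xx mx; have gx := fiber_doubly_nilpotent hfk hf Xx.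
have [h [oh xso sx xh]] := flag_of_doubly_nilpotent gx.
have uh := orth_unit (OW_orth oh); have xn : nplus (Ad h x) by rewrite nplusE.
apply/Ad_sat_minusP => //; have [dh|dh] := OW_det oh; last first.
  exists (invmx h), (Ad h x); split=> //; first exact: OWV.
    by rewrite det_inv dh invrN1.
  by rewrite Ad_unitK.
have or := OW_swap F on; have ur := orth_unit (OW_orth or).
case: xh => [bu|kx].
  exists (invmx h *m r), (Ad r (Ad h x)); split.
  - by apply: OWM => //; apply: OWV.
  - by rewrite det_mulmx det_inv dh det_swap // invr1 mul1r.
  - exact: nplus_swap.
  - by rewrite AdM ?unitmx_inv // Ad_swapK // Ad_unitK.
have /eqP[] := nplus_krylov_test xn kx; apply: mx; by split.
Qed.

Lemma Ad_swap_sat x : Ym (Ad r x) <-> Yp x.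
Proof.
have or := OW_swap F on; have ur := orth_unit (OW_orth or).
split=> [/(Ad_sat_minusP on)[g [y [og dg yn e1]]]|[g [og dg] [y yn ->]]].
  exists (r *m g).
    by split; [exact: OWM | rewrite det_mulmx dg det_swap // mulrNN mulr1].
  exists y => //; rewrite AdM -?e1 ?Ad_swapK //; by apply: orth_unit; case: og.
apply/Ad_sat_minusP => //; exists (r *m g), y; split=> //; first exact: OWM.
  by rewrite det_mulmx dg det_swap // mulr1.
by rewrite AdM // orth_unit //; case: og.
Qed.

Lemma fiber_swap x : X x -> X (Ad r x).
Proof.
have or := OW_swap F on; have ur := orth_unit (OW_orth or).
rewrite fiberE // => -[g og [y yn ->]]; exists (r *m g); first exact: OWM.
by exists y => //; rewrite AdM // orth_unit //; case: og.
Qed.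

Lemma plus_not_minus : ~ Yp `<=` Ym.
Proof.
move=> /(_ regular_nilpotent) []; last first.
  move=> k sk [y yn yE].
  have : minus_closed regular_nilpotent by apply: minus_sub_closed; exists k => //; exists y.
  move=> /(_ 1%:M (SOW1 F p)); rewrite Ad1 => /eqP.
  by rewrite (negPf regular_krylov_test).
exists 1%:M; first exact: SOW1.
by exists regular_nilpotent; [exact: regular_nplus | rewrite Ad1].
Qed.

Lemma minus_not_plus : ~ Ym `<=` Yp.
Proof.
move=> mp; apply: plus_not_minus => x Yx.
have /mp : Ym (Ad r x) by apply/Ad_swap_sat.
by move=> /Ad_swap_sat; rewrite Ad_swapK.
Qed.

Lemma fiber_components Y : zirr_component X Y <-> Y = Yp \/ Y = Ym.
Proof.
have irrp : zirreducible Yp by apply: zirreducible_Ad_sat.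
have irrm : zirreducible Ym by apply: zirreducible_Ad_sat.
have sYp : Yp `<=` X by rewrite fiber_odd => x; left.
have sYm : Ym `<=` X by rewrite fiber_odd => x; right.
have closedp : zclosed [set x | minus_closed (Ad r x)].
  apply: (zclosed_preimage (phi := fun x => Ad r x)) zclosed_minus.
  have reg := @regular_algebra F n n.
  have -> : (fun x => Ad r x) = (fun x => r *m x *m invmx r) by apply: funext => x; rewrite AdE.
  apply: entries_mul => //; last exact: entries_cst.
  by apply: entries_mul => //; [apply: entries_cst | apply: entries_id].
(* Inside the fiber the two pieces are the traces of [minus_closed] and of its conjugate by the
   swap. *)
have dich Y' : Y' `<=` X -> zirreducible Y' -> Y' `<=` Yp \/ Y' `<=` Ym.
  move=> sY [_ irr].
  have [|sp|sm] := irr _ _ closedp zclosed_minus.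
  - move=> x /sY; rewrite fiber_odd => -[Yx|Yx]; last by right; apply: minus_sub_closed.
    by left; apply: minus_sub_closed; apply/Ad_swap_sat.
  - left=> x Yx; apply/Ad_swap_sat; apply: fiber_minus; last exact: sp.
    by apply: fiber_swap; apply: sY.
  - by right=> x Yx; apply: fiber_minus; [apply: sY | apply: sm].
split=> [[sYX irrY maxY]|[->|->]].
- have [sY|sY] := dich Y sYX irrY; [left|right]; exact/esym/maxY.
- split=> // Y' sY' irrY' sYpY'; apply/seteqP; split=> //.
  by have [//|sY'm] := dich Y' sY' irrY'; case: plus_not_minus; apply: subset_trans sY'm.
- split=> // Y' sY' irrY' sYmY'; apply/seteqP; split=> //.
  by have [sY'p|//] := dich Y' sY' irrY'; case: minus_not_plus; apply: subset_trans sY'p.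
Qed.

End Components.
End OddComponents.

(** * Lie's theorem *)

Section LieTheorem.
Variables (F : numClosedFieldType) (n' : nat).
Local Notation n := n'.+1.
Implicit Types (x y z : 'M[F]_n) (w : 'rV[F]_n) (X Y : 'M[F]_n) (a b : {vspace 'M[F]_n}).

(** A projection onto the row space of Y. Subspaces are row spaces here, so x acts on vectors by
    right multiplication with its transpose. *)
Definition row_proj Y : 'M[F]_n := pinvmx (row_base Y) *m row_base Y.

Lemma row_proj_sub Y : (row_proj Y <= Y)%MS.
Proof. by rewrite (submx_trans (submxMl _ _)) // eq_row_base. Qed.

Lemma row_proj_id k (Z : 'M[F]_(k, n)) Y : (Z <= Y)%MS -> Z *m row_proj Y = Z.
Proof. by move=> ZY; rewrite /row_proj mulmxA mulmxKpV // eq_row_base. Qed.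

Lemma tr_row_proj Y : \tr (row_proj Y) = (\rank Y)%:R.
Proof. by rewrite /row_proj mxtrace_mulC mulmxVp ?row_base_free // mxtrace1. Qed.

(** On an invariant subspace compression is multiplicative, so the trace is that of a commutator. *)
Lemma tr_proj_commutator Y x y : (Y *m x <= Y)%MS -> (Y *m y <= Y)%MS ->
  \tr (row_proj Y *m (x *m y - y *m x)) = 0.
Proof.
move=> Yx Yy.
have PP z t : (Y *m z <= Y)%MS -> row_proj Y *m (z *m t) = (row_proj Y *m z) *m (row_proj Y *m t).
  move=> Yz; rewrite [RHS]mulmxA row_proj_id ?mulmxA //.
  exact: submx_trans (submxMr _ (row_proj_sub Y)) Yz.
by rewrite mulmxBr (PP _ x) // (PP _ y) // linearB /= mxtrace_mulC subrr.
Qed.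

(** z induces 0 on Y'/Y, which contributes nothing to the trace. *)
Lemma tr_proj_chain Y Y' z : (Y <= Y')%MS -> (Y' *m z <= Y)%MS ->
  \tr (row_proj Y' *m z) = \tr (row_proj Y *m z).
Proof.
move=> sY Yz; rewrite -(@row_proj_id _ (row_proj Y' *m z) Y).
  rewrite mxtrace_mulC mulmxA row_proj_id //.
  exact: submx_trans (row_proj_sub Y) sY.
exact: submx_trans (submxMr _ (row_proj_sub Y')) Yz.
Qed.

Section Invariance.
Variables (X0 : 'M[F]_n) (a : {vspace 'M[F]_n}) (z : 'M[F]_n) (w : 'rV[F]_n).
Hypothesis X0a : forall x, x \in a -> (X0 *m x^T <= X0)%MS.
Hypothesis X0z : (X0 *m z^T <= X0)%MS.
Hypothesis az : forall x, x \in a -> lieb x z \in a.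
Variable chi : 'M[F]_n -> F.
Hypothesis wchi : forall x, x \in a -> (w *m x^T - chi x *: w <= X0)%MS.
Hypothesis w0 : ~~ (w <= X0)%MS.

Fixpoint krylov_chain k : 'M[F]_n :=
  if k is k'.+1 then (krylov_chain k' + w *m (z^T) ^+ k')%MS else X0.
Local Notation Y := krylov_chain.

Lemma krylov_chain_mono k : (Y k <= Y k.+1)%MS.
Proof. exact: addsmxSl. Qed.

Lemma krylov_chain0 k : (X0 <= Y k)%MS.
Proof. by elim: k => // k IHk; apply: submx_trans (krylov_chain_mono k). Qed.

Lemma krylov_chain_z k : (Y k *m z^T <= Y k.+1)%MS.
Proof.
elim: k => [|k IHk]; first exact: submx_trans X0z (krylov_chain_mono 0).
rewrite [Y k.+1]/= addsmxMr addsmx_sub (submx_trans IHk (krylov_chain_mono _)) /=.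
by rewrite -mulmxA -[_ *m z^T]exprSr addsmxSr.
Qed.

(** Moving x past z produces the bracket [x, z], again in a, which acts on w z^k modulo Y_k by a
    scalar; that multiple lies in the next term of the chain. *)
Lemma krylov_chain_weight k x : x \in a ->
  (w *m (z^T) ^+ k *m x^T - chi x *: (w *m (z^T) ^+ k) <= Y k)%MS.
Proof.
elim: k x => [|k IHk] x xa; first by rewrite expr0 !mulmx1 wchi.
have -> : w *m (z^T) ^+ k.+1 *m x^T - chi x *: (w *m (z^T) ^+ k.+1) =
    (w *m (z^T) ^+ k *m x^T - chi x *: (w *m (z^T) ^+ k)) *m z^T +
    (w *m (z^T) ^+ k *m (lieb x z)^T - chi (lieb x z) *: (w *m (z^T) ^+ k)) +
    chi (lieb x z) *: (w *m (z^T) ^+ k).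
  rewrite -[RHS]addrA subrK exprSr -[_ * z^T]/(_ *m z^T) mulmxA.
  move: (w *m _) => u; rewrite mulmxBl -scalemxAl addrAC; congr (_ - _).
  by rewrite /lieb linearB /= !trmx_mul mulmxBr !mulmxA addrC subrK.
apply: addmx_sub; first apply: addmx_sub.
- exact: submx_trans (submxMr _ (IHk x xa)) (krylov_chain_z k).
- exact: submx_trans (IHk _ (az xa)) (krylov_chain_mono k).
- by rewrite scalemx_sub // addsmxSr.
Qed.

Lemma krylov_chain_shift k x : x \in a -> (Y k.+1 *m (x^T - (chi x)%:M) <= Y k)%MS.
Proof.
move=> xa; have wz j : (w *m (z^T) ^+ j *m (x^T - (chi x)%:M) <= Y j)%MS.
  by rewrite mulmxBr mul_mx_scalar; apply: krylov_chain_weight.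
elim: k => [|k IHk]; rewrite [X in (X *m _ <= _)%MS]/= addsmxMr addsmx_sub wz andbT.
  by rewrite mulmxBr mul_mx_scalar addmx_sub ?X0a ?eqmx_opp ?scalemx_sub.
exact: submx_trans IHk (krylov_chain_mono k).
Qed.

Lemma krylov_chain_stationary : exists2 k, (0 < k)%N & (Y k.+1 <= Y k)%MS.
Proof.
have [[k Yk]|nk] := EM (exists k, (Y k.+1 <= Y k)%MS).
  case: k Yk => [|k] Yk; last by exists k.+1.
  case/negP: w0; apply: submx_trans Yk; rewrite /= expr0 mulmx1; exact: addsmxSr.
have rk k : (k <= \rank (Y k))%N.
  elim: k => // k IHk; apply: leq_ltn_trans IHk _.
  rewrite ltnNge; apply/negP => rY; apply: nk; exists k.
  by rewrite -(geq_leqif (mxrank_leqif_sup (krylov_chain_mono k))).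
by have := leq_trans (rk n.+1) (rank_leq_row _); rewrite ltnn.
Qed.

(* The commutator is traceless on Y_k and on X0, and acts on Y_k / X0 with the
   single eigenvalue chi [x, z]. *)
Lemma weight_commutator x : x \in a -> (w *m (lieb x z)^T <= X0)%MS.
Proof.
move=> xa; have ya := az xa; set y := lieb x z in ya *.
have [k k0 Yk] := krylov_chain_stationary.
have tr0 Z : (Z *m x^T <= Z)%MS -> (Z *m z^T <= Z)%MS -> \tr (row_proj Z *m y^T) = 0.
  move=> Zx Zz; rewrite /y /lieb linearB /= !trmx_mul; exact: tr_proj_commutator.
have Yx j u : u \in a -> (Y j *m u^T <= Y j)%MS.
  move=> ua; case: j => [|j]; first exact: X0a.
  have -> : u^T = (u^T - (chi u)%:M) + (chi u)%:M by rewrite subrK.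
  rewrite mulmxDr addmx_sub // ?(submx_trans (krylov_chain_shift j ua)) ?krylov_chain_mono //.
  by rewrite mul_mx_scalar scalemx_sub.
have trN j : \tr (row_proj (Y j) *m (y^T - (chi y)%:M)) = \tr (row_proj X0 *m (y^T - (chi y)%:M)).
  elim: j => // j <-; apply: tr_proj_chain; first exact: krylov_chain_mono.
  exact: krylov_chain_shift.
have trE Z : (Z *m x^T <= Z)%MS -> (Z *m z^T <= Z)%MS ->
    \tr (row_proj Z *m (y^T - (chi y)%:M)) = - (chi y * (\rank Z)%:R).
  by move=> Zx Zz; rewrite mulmxBr linearB /= tr0 // sub0r mul_mx_scalar mxtraceZ tr_row_proj.
have Yz : (Y k *m z^T <= Y k)%MS := submx_trans (krylov_chain_z k) Yk.
have := trN k; rewrite (trE _ (Yx k x xa) Yz) (trE _ (X0a xa) X0z).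
move=> /oppr_inj/eqP; rewrite -subr_eq0 -mulrBr mulf_eq0 => /orP[/eqP c0|].
  by have := wchi ya; rewrite c0 scale0r subr0.
rewrite subr_eq0 eqr_nat => /eqP rY; case/negP: w0.
have sY : (Y k <= X0)%MS.
  by rewrite -(geq_leqif (mxrank_leqif_sup (krylov_chain0 k))) rY.
apply: submx_trans sY; case: k k0 {Yk rY Yz} => // k _.
elim: k => [|k IHk]; first by rewrite /= expr0 mulmx1 addsmxSr.
exact: submx_trans (krylov_chain_mono _).
Qed.

End Invariance.

Lemma trmx_lieb x y : (lieb x y)^T = y^T *m x^T - x^T *m y^T.
Proof. by rewrite /lieb linearB /= !trmx_mul. Qed.

Definition stable_under a X : Prop := forall x, x \in a -> (X *m x^T <= X)%MS.

(** Lie's theorem for every stable subquotient X/X0, stated without quotients; it will be applied to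
    the orthogonal of a partial flag modulo that flag. *)
Definition has_weights a : Prop := forall X0 X, (X0 < X)%MS ->
  stable_under a X0 -> stable_under a X ->
  exists w, [/\ (w <= X)%MS, ~~ (w <= X0)%MS &
    forall x, x \in a -> exists c, (w *m x^T - c *: w <= X0)%MS].

Lemma has_weights0 : has_weights 0%VS.
Proof.
move=> X0 X /andP[_ /row_subPn[i Xi]] _ _; exists (row i X); split=> //.
  exact: row_sub.
move=> x; rewrite memv0 => /eqP->; exists 0.
by rewrite trmx0 mulmx0 scale0r subr0 sub0mx.
Qed.

(** a is an ideal in a + <z>, so by [weight_commutator] its weight vectors of weight chi modulo X0
    are preserved by z. An eigenvector of z among them is what is sought. *)
Lemma has_weights_extend a z : (forall x, x \in a -> lieb x z \in a) ->
  has_weights a -> has_weights (a + <[z]>)%VS.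
Proof.
move=> az wa X0 X XX stX0 stX.
have sub x : x \in a -> x \in (a + <[z]>)%VS by apply/subvP: x; apply: addvSl.
have zin : z \in (a + <[z]>)%VS by rewrite (subvP (addvSr _ _)) // memv_line.
have [w [wX w0 wx]] := wa X0 X XX (fun x xa => stX0 x (sub x xa)) (fun x xa => stX x (sub x xa)).
have [chi chiP] : exists chi, forall x, x \in a -> (w *m x^T - chi x *: w <= X0)%MS.
  have h x : exists c, x \in a -> (w *m x^T - c *: w <= X0)%MS.
    by have [/wx[c wc]|nxa] := boolP (x \in a); [exists c | exists 0].
  by have [chi chiP] := choice h; exists chi.
pose W (u : 'rV[F]_n) := (u <= X)%MS /\ forall x, x \in a -> (u *m x^T - chi x *: u <= X0)%MS.
have Wz u d : ~~ (u <= X0)%MS -> W u -> W (u *m (z^T - d%:M)).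
  move=> u0 [uX uchi]; split.
    rewrite mulmxBr mul_mx_scalar addmx_sub // ?eqmx_opp ?scalemx_sub //.
    exact: submx_trans (submxMr _ uX) (stX z zin).
  move=> x xa; rewrite mulmxBr mul_mx_scalar.
  have -> : (u *m z^T - d *: u) *m x^T - chi x *: (u *m z^T - d *: u) =
      (u *m x^T - chi x *: u) *m z^T + u *m (lieb x z)^T - d *: (u *m x^T - chi x *: u).
    rewrite trmx_lieb !mulmxBl -!scalemxAl [u *m (_ - _)]mulmxBr !mulmxA.
    move: (u *m z^T *m x^T) (u *m z^T) (u *m x^T *m z^T) (u *m x^T) => A1 A2 A3 A4.
    by apply/rowP => i; rewrite !mxE; ring.
  have X0a' y : y \in a -> (X0 *m y^T <= X0)%MS by move=> ya; apply/stX0/sub.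
  apply: addmx_sub; first apply: addmx_sub.
  - exact: submx_trans (submxMr _ (uchi x xa)) (stX0 z zin).
  - exact: (@weight_commutator X0 a z u X0a' (stX0 z zin) az chi uchi u0).
  - by rewrite eqmx_opp scalemx_sub // uchi.
suff [u [c [[uX uchi] u0 uz]]] : exists u c, [/\ W u, ~~ (u <= X0)%MS &
    (u *m (z^T - c%:M) <= X0)%MS].
  exists u; split=> // x /memv_addP[y ya [_ /vlineP[d ->] ->]].
  exists (chi y + d * c).
  have -> : u *m (y + d *: z)^T - (chi y + d * c) *: u =
      (u *m y^T - chi y *: u) + d *: (u *m (z^T - c%:M)).
    rewrite linearD linearZ /= mulmxDr mulmxBr mul_mx_scalar -scalemxAr.
    by move: (u *m _) (u *m _) => A1 A2; apply/rowP => i; rewrite !mxE; ring.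
  by rewrite addmx_sub // ?uchi // scalemx_sub.
(* Apply the linear factors of the characteristic polynomial to w in turn. The whole product kills
   w, so some factor takes a vector outside X0 into X0. *)
have [rs rsE] := closed_field_poly_normal (char_poly z^T).
have : (w *m horner_mx z^T (\prod_(c <- rs) ('X - c%:P)) <= X0)%MS.
  have := rsE; rewrite (monicP (char_poly_monic _)) scale1r => <-.
  by rewrite Cayley_Hamilton mulmx0 sub0mx.
have : W w by split.
elim: rs w w0 {rsE chiP wX wx} => [|c rs IHrs] u u0 Wu.
  by rewrite big_nil rmorph1 mulmx1 (negPf u0).
rewrite big_cons rmorphM /= -[_ * _]/(_ *m _) mulmxA.
rewrite rmorphB /= horner_mx_X horner_mx_C.
have [uz|uz] := boolP (u *m (z^T - c%:M) <= X0)%MS; first by exists u, c.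
exact: (IHrs _ uz (Wz u c u0 Wu)).
Qed.

(** Climb the derived series from 0. Every subspace between D^(i+1) and D^i is an ideal of D^i, so
    basis vectors of D^i can be added one at a time. *)
Lemma lie_theorem b : lie_subalgebra b -> lie_solvable b -> has_weights b.
Proof.
move=> sb [k]; pose D k : {vspace 'M[F]_n} := iter k (fun U => lie_prod U U) b.
rewrite -/(D k) => Dk; have Dmono j : (D j.+1 <= D j)%VS.
  by elim: j => [//|j IHj]; apply: lie_prodS.
suff H j : has_weights (D (k - j)%N) by have := H k; rewrite subnn.
elim: j => [|j IHj]; first by rewrite subn0 Dk; apply: has_weights0.
have [kj|jk] := leqP k j; first by move: IHj; rewrite (_ : k - j = k - j.+1)%N //; lia.
move: IHj; have -> : (k - j = (k - j.+1).+1)%N by lia.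
move: (k - j.+1)%N => i wi.
have step (s : seq 'M[F]_n) : {subset s <= D i} -> has_weights (D i.+1 + <<s>>)%VS.
  elim: s => [|z s IHs] sD; first by rewrite span_nil addv0.
  have sD' : {subset s <= D i} by move=> y ys; apply: sD; rewrite inE ys orbT.
  rewrite span_cons [(<[z]> + _)%VS]addvC addvA; apply: has_weights_extend (IHs sD').
  move=> x; rewrite -[lieb x z \in _]/(_) => xin.
  apply: (subvP (addvSl _ _)); apply: lieb_mem; last by apply: sD; rewrite mem_head.
  by move: xin; apply: subvP; rewrite subv_add Dmono /=; apply/span_subvP.
have := step (vbasis (D i)) (fun y => @vbasis_mem _ _ y _).
by rewrite (span_basis (vbasisP _)) (addv_idPr (Dmono i)).
Qed.

End LieTheorem.

(** * Borel subalgebras *)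

Section Borel.
Variables (F : numClosedFieldType) (p : nat).
Local Notation n := p.+2.
Local Notation B := (@bform F n).
Local Notation m := (m p).
Implicit Types (x y g h : 'M[F]_n) (w : 'cV[F]_n) (b : {vspace 'M[F]_n}).

Definition span_below (i : nat) : 'M[F]_n := diag_mx (\row_(k < n) (k < i)%N%:R).

Lemma span_belowP i w : (w^T <= span_below i)%MS <-> below i w.
Proof.
split=> [/submxP[u wu] k ik|bw].
  have := congr1 (fun t : 'rV[F]_n => t 0 k) wu.
  by rewrite mul_mx_diag mxE mxE mxE ltnNge ik mulr0.
apply/submxP; exists w^T; apply/rowP => k; rewrite mul_mx_diag !mxE.
by case: ltnP => ik; rewrite ?mulr1 // bw // mul0r.
Qed.

Lemma stable_of_columns (X x : 'M[F]_n) :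
  (forall w, (w^T <= X)%MS -> ((x *m w)^T <= X)%MS) -> (X *m x^T <= X)%MS.
Proof.
move=> st; apply/row_subP => k; rewrite row_mul -[row k X]trmxK -trmx_mul.
by apply: st; rewrite trmxK row_sub.
Qed.

Lemma lie_theorem_column b (X0 X : 'M[F]_n) : lie_subalgebra b -> lie_solvable b ->
  (X0 < X)%MS -> (forall x w, x \in b -> (w^T <= X0)%MS -> ((x *m w)^T <= X0)%MS) ->
  (forall x w, x \in b -> (w^T <= X)%MS -> ((x *m w)^T <= X)%MS) ->
  exists w, [/\ (w^T <= X)%MS, ~~ (w^T <= X0)%MS &
    forall x, x \in b -> exists c, ((x *m w - c *: w)^T <= X0)%MS].
Proof.
move=> sb solb XX st0 st.
have [||w [wX w0 wx]] := lie_theorem sb solb XX.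
- by move=> x xb; apply: stable_of_columns => w; apply: st0.
- by move=> x xb; apply: stable_of_columns => w; apply: st.
exists w^T; rewrite trmxK; split=> // x /wx[c wc]; exists c.
by rewrite linearB linearZ /= trmx_mul trmxK.
Qed.

(** A weight vector w1 in the orthogonal of the partial flag may be anisotropic, but then skewness
    forces its weight to be 0 and its orthogonal is stable. A second weight vector w2 found there is
    isotropic or has weight 0 too, and then a combination of w1 and w2 is isotropic. *)
Lemma isotropic_weight b (i : 'I_n) : (b <= so F n)%VS -> lie_subalgebra b ->
  lie_solvable b -> (i < m)%N ->
  (forall x (j : 'I_n), x \in b -> (j < i)%N -> below j.+1 (x *m e j)) ->
  exists w, [/\ below (n - i) w, B w w = 0, ~ below i w &
    forall x, x \in b -> exists c, below i (x *m w - c *: w)].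
Proof.
move=> /subvP bso sb solb im fl; have m2 := mE p.
have st x w : x \in b -> below i w -> below i (x *m w).
  move=> xb; apply: (@below_ind F p (fun w => below i (x *m w))).
  - by rewrite mulmx0; apply: below0.
  - by move=> a c ba bc; rewrite mulmxDr; apply: belowD.
  - by move=> c j ji; rewrite -scalemxAr; apply/belowZ/below_le/fl.
have st' x w : x \in b -> below (n - i) w -> below (n - i) (x *m w).
  move=> xb bw; apply/below_orthP => j ji; rewrite -[LHS]opprK.
  rewrite -(proj1 (mem_so x) (bso x xb)) (below_bform (st x _ xb _) bw) ?oppr0 //.
  exact: below_e.
have perp x w c : x \in b -> below (n - i) w -> B w w != 0 -> below i (x *m w - c *: w) ->
    below i (x *m w).
  move=> xb bw ww bc; suff c0 : c = 0 by rewrite c0 scale0r subr0 in bc.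
  have := below_bform bc bw; rewrite bformBl bformZl so_bform0 ?bso // sub0r.
  by move/eqP; rewrite oppr_eq0 mulf_eq0 (negPf ww) orbF => /eqP.
have strict X : (forall w, below i w -> (w^T <= X)%MS) ->
    (exists2 u : 'cV[F]_n, (u^T <= X)%MS & ~ below i u) -> (span_below i < X)%MS.
  move=> sX [u uX nu]; rewrite /ltmx; apply/andP; split.
    by apply/row_subP => k; rewrite -[row _ _]trmxK; apply/sX/span_belowP; rewrite trmxK row_sub.
  by apply/negP => Xs; apply: nu; apply/span_belowP; apply: submx_trans Xs.
have ei_nb (j : 'I_n) : (i <= j)%N -> ~ below i (e j : 'cV[F]_n).
  by move=> ij /(_ j ij); rewrite eE eqxx => /eqP; rewrite oner_eq0.
have [|||w1 [w1X w10 w1b]] := @lie_theorem_column b (span_below i) (span_below (n - i)) sb solb.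
- apply: strict; first by move=> w bw; apply/span_belowP/below_le/bw; lia.
  by exists (e i); [apply/span_belowP/below_e; lia | apply: ei_nb].
- by move=> x w xb /span_belowP bw; apply/span_belowP/st.
- by move=> x w xb /span_belowP bw; apply/span_belowP/st'.
have {}w1X : below (n - i) w1 by apply/span_belowP.
have {}w10 : ~ below i w1 by move/span_belowP; apply/negP.
have {}w1b x : x \in b -> exists c, below i (x *m w1 - c *: w1).
  by move=> /w1b[c /span_belowP]; exists c.
have [w11|w11] := eqVneq (B w1 w1) 0; first by exists w1.
have xw1 x : x \in b -> below i (x *m w1).
  by move=> xb; have [c] := w1b x xb; apply: perp.
pose X := (span_below (n - i) :&: kermx (skew_mx n *m w1))%MS.
have XP w : (w^T <= X)%MS <-> below (n - i) w /\ B w w1 = 0.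
  rewrite sub_capmx; split=> [/andP[/span_belowP bw /sub_kermxP kw]|[bw kw]].
    by split=> //; rewrite /bform -mulmxA kw mxE.
  apply/andP; split; first exact/span_belowP.
  by apply/sub_kermxP/matrixP => k l; rewrite mulmxA !ord1 -[LHS]/(B w w1) kw mxE.
have [|||w2 [w2X w20 w2b]] := @lie_theorem_column b (span_below i) X sb solb.
- apply: strict.
    move=> w bw; apply/XP; split; first by apply: below_le bw; lia.
    exact: below_bform bw w1X.
  (* Since i < m, both e_i and e_(i+1) are available, and some combination of them outside the flag
     is orthogonal to w1. *)
  have [b0|b0] := eqVneq (B (e i) w1) 0.
    by exists (e i); [apply/XP; split=> //; apply: below_e; lia | apply: ei_nb].
  have i1 : (i.+1 < n)%N by lia.
  pose j := Ordinal i1; exists (B (e i) w1 *: e j - B (e j) w1 *: e i).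
    apply/XP; split; last by rewrite bformBl !bformZl mulrC subrr.
    by apply: belowB; apply: belowZ; apply: below_e => /=; lia.
  move=> /(_ j (leqnSn i)); rewrite !mxE !eqxx -val_eqE /= gtn_eqF // mulr1 mulr0 subr0.
  by move/eqP: b0.
- by move=> x w xb /span_belowP bw; apply/span_belowP/st.
- move=> x w xb /XP[bw kw]; apply/XP; split; first exact: st'.
  by rewrite (proj1 (mem_so x) (bso x xb)) bformC (below_bform (xw1 x xb) bw) oppr0.
have [{}w2X w21] : below (n - i) w2 /\ B w2 w1 = 0 by apply/XP.
have {}w20 : ~ below i w2 by move/span_belowP; apply/negP.
have {}w2b x : x \in b -> exists c, below i (x *m w2 - c *: w2).
  by move=> /w2b[c /span_belowP]; exists c.
have [w22|w22] := eqVneq (B w2 w2) 0; first by exists w2.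
(* Solves B(w1, w1) + s^2 B(w2, w2) = 0. *)
pose s := sqrtC (- (B w1 w1 / B w2 w2)).
exists (w1 + s *: w2); split.
- by apply: belowD => //; apply: belowZ.
- have ss : s * s = - (B w1 w1 / B w2 w2) by rewrite -expr2 sqrtCK.
  rewrite bformDl !bformDr !bformZl !bformZr (bformC w1 w2) w21 !mulr0 addr0 add0r mulrA ss.
  by rewrite mulNr divfK // subrr.
- move=> bw; have := below_bform bw w1X.
  by rewrite bformDl bformZl w21 mulr0 addr0 => /eqP; apply/negP.
- move=> x xb; exists 0; rewrite scale0r subr0 mulmxDr -scalemxAr; apply: belowD.
    exact: xw1.
  by apply: belowZ; have [c] := w2b x xb; apply: perp.
Qed.

Lemma lie_subalgebra_Ad g b : g \in unitmx -> lie_subalgebra b -> lie_subalgebra (Ad g @: b)%VS.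
Proof. by move=> ug sb; rewrite /lie_subalgebra lie_prod_Ad //; apply: Ad_imgS. Qed.

Lemma lie_solvable_Ad g b : g \in unitmx -> lie_solvable b -> lie_solvable (Ad g @: b)%VS.
Proof.
move=> ug [k bk]; exists k.
suff -> : iter k (fun U => lie_prod U U) (Ad g @: b)%VS =
    (Ad g @: iter k (fun U => lie_prod U U) b)%VS by rewrite bk limg0.
by elim: k {bk} => //= k ->; apply: lie_prod_Ad.
Qed.

Lemma Ad_sub_so g b : orth F n g -> (b <= so F n)%VS -> (Ad g @: b <= so F n)%VS.
Proof.
move=> og /subvP bso; apply/subvP => x.
rewrite mem_Ad_img ?orth_unit // => /bso.
by rewrite Ad_so //; apply: orthV.
Qed.

(** Weight vectors supplied by [isotropic_weight] are moved to e_1, e_2, ... in turn; no vector is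
    to be kept fixed, so [witt_step] is taken at v0 = 0. *)
Lemma solvable_sub_borel b : (b <= so F n)%VS -> lie_subalgebra b -> lie_solvable b ->
  exists2 g, orth F n g & (Ad g @: b <= b_plus F n)%VS.
Proof.
move=> bso sb solb.
suff [g og fl] : exists2 g, orth F n g & forall x (j : 'I_n),
    x \in (Ad g @: b)%VS -> (j < m)%N -> below j.+1 (x *m e j).
  exists g => //; apply/subvP => x xb; apply/mem_b_plus.
  have xso : x \in so F n by apply: (subvP (Ad_sub_so og bso)).
  split=> //; apply: upper_of_cols => // i j jm ji.
  by rewrite -mulmx_eE fl.
have : (m <= m)%N by []; move: {1 3}(m) => i; elim: i => [|i IHi] im.
  by exists 1%:M => //; exact: orth1.
have [g og fl] := IHi (ltnW im).
have i_n : (i < n)%N by have := mE p; lia.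
have ug := orth_unit og.
have [w [bw ww nbw wb]] := @isotropic_weight _ (Ordinal i_n) (Ad_sub_so og bso)
  (lie_subalgebra_Ad ug sb) (lie_solvable_Ad ug solb) im fl.
have [h [oh _ he hw]] := @witt_step F p 0 w (Ordinal i_n) (or_introl erefl) im bw (bform0r _) ww nbw.
have uh := orth_unit oh.
have hf z : below i z -> invmx h *m z = z.
  by apply: fix_below => j ji; rewrite orth_fixV ?he.
exists (invmx h *m g); first by apply: orthM => //; apply: orthV.
move=> x j; rewrite Ad_imgM ?unitmx_inv // mem_Ad_img ?unitmx_inv // invmxK.
set y := Ad h x => yb; have -> : x = Ad (invmx h) y by rewrite Ad_unitK.
rewrite ltnS AdE invmxK -!mulmxA leq_eqVlt => /orP[/eqP ji|ji]; last first.
  rewrite he // hf; first exact: fl.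
  by apply: below_le (fl y j yb ji).
have -> : j = Ordinal i_n by apply: val_inj.
rewrite hw; have [c bc] := wb y yb.
have -> : y *m w = (y *m w - c *: w) + c *: w by rewrite subrK.
have hw' : invmx h *m w = e (Ordinal i_n) by rewrite -hw mulKmx.
rewrite mulmxDr hf // -scalemxAr hw'; apply: belowD.
  by apply: below_le bc.
by apply: belowZ; apply: below_e.
Qed.

Lemma b_plus_so : (b_plus F n <= so F n)%VS.
Proof. exact: capvSl. Qed.

Lemma b_plus_subalgebra : lie_subalgebra (b_plus F n).
Proof.
apply/lie_subalgebraP => x y /mem_b_plus[xso ux] /mem_b_plus[yso uy].
by apply/mem_b_plus; split; [exact: lieb_so | exact/strict_upperW/strict_upper_lieb].
Qed.

Lemma b_plus_solvable : lie_solvable (b_plus F n).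
Proof.
exists n; apply/eqP; rewrite -subv0; apply/subvP => x.
suff H k y : y \in iter k.+1 (fun U => lie_prod U U) (b_plus F n) -> shifted k.+1 y.
  move=> /H sx; rewrite memv0; apply/eqP/matrixP => i j; rewrite [RHS]mxE sx //.
  by have := ltn_ord j; lia.
elim: k y => [|k IHk]; rewrite iterS.
  apply: (@lie_prod_ind _ _ (shifted 1)).
  - by move=> i j _; rewrite mxE.
  - by move=> c y z sy sz i j ij; rewrite !mxE sy // sz // mulr0 addr0.
  move=> y z /mem_b_plus[_ uy] /mem_b_plus[_ uz] i j; rewrite addn1.
  exact: strict_upper_lieb.
apply: (@lie_prod_ind _ _ (shifted k.+2)).
- by move=> i j _; rewrite mxE.
- by move=> c y z sy sz i j ij; rewrite !mxE sy // sz // mulr0 addr0.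
move=> y z /IHk sy /IHk sz i j ij; apply: (shifted_lieb sy sz); lia.
Qed.

(** Maximality by dimension: a larger solvable subalgebra would have a conjugate inside b_+. *)
Lemma borel_b_plus : borel (so F n) (b_plus F n).
Proof.
split; [exact: b_plus_so | exact: b_plus_subalgebra | exact: b_plus_solvable |].
move=> c cso sc solc bc; apply/esym/eqP; rewrite eqEdim bc /=.
have [g og /dimvS] := solvable_sub_borel cso sc solc.
by rewrite dimv_Ad ?orth_unit.
Qed.

Lemma borel_Ad g b : orth F n g -> borel (so F n) b -> borel (so F n) (Ad g @: b)%VS.
Proof.
move=> og [bso sb solb maxb]; have ug := orth_unit og; split.
- exact: Ad_sub_so.
- exact: lie_subalgebra_Ad.
- exact: lie_solvable_Ad.
move=> c cso sc solc bc; rewrite -(maxb (Ad (invmx g) @: c)%VS).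
- by rewrite -Ad_imgM ?unitmx_inv // mulmxV // Ad_img1.
- by apply: Ad_sub_so => //; apply: orthV.
- by apply: lie_subalgebra_Ad => //; rewrite unitmx_inv.
- by apply: lie_solvable_Ad => //; rewrite unitmx_inv.
- by rewrite -{1}(Ad_imgV ug (erefl (Ad g @: b)%VS)); apply: Ad_imgS.
Qed.

Lemma borelP b : borel (so F n) b <-> exists2 g, orth F n g & b = (Ad g @: b_plus F n)%VS.
Proof.
split=> [bb|[g og ->]]; last exact/borel_Ad/borel_b_plus.
have [bso sb solb _] := bb; have [g og gb] := solvable_sub_borel bso sb solb.
have ug := orth_unit og; exists (invmx g); first exact: orthV.
have [_ _ _ maxg] := borel_Ad og bb.
rewrite (maxg _ b_plus_so b_plus_subalgebra b_plus_solvable gb).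
by rewrite -Ad_imgM ?unitmx_inv // mulVmx // Ad_img1.
Qed.

End Borel.

(** * Closed orbits in the flag variety *)

Section Grassmannian.
Variables (F : numClosedFieldType) (n : nat).
Implicit Types (x y g : 'M[F]_n) (b : {vspace 'M[F]_n}).

Lemma row_spanP d (M : 'M[F]_(d, n * n)) x :
  x \in row_span M -> exists a : 'rV[F]_d, x = \sum_i a 0 i *: vec_mx (row i M).
Proof.
pose L : 'Hom('rV[F]_d, 'M[F]_n) := linfun (vec_mx \o mulmxr M).
have LE a : L a = \sum_i a 0 i *: vec_mx (row i M).
  by rewrite lfunE /= mulmx_sum_row linear_sum; apply: eq_bigr => i _; rewrite linearZ.
have : (row_span M <= limg L)%VS.
  apply/span_subvP => _ /mapP[i _ ->]; have -> : vec_mx (row i M) = L (delta_mx 0 i).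
    by rewrite lfunE /= rowE.
  exact/memv_img/memvf.
by move=> /subvP sL /sL/memv_imgP[a _ ->]; exists a.
Qed.

Lemma row_span_mem d (M : 'M[F]_(d, n * n)) i : vec_mx (row i M) \in row_span M.
Proof. by apply: memv_span; apply: map_f; rewrite mem_enum. Qed.

Lemma lie_prod_row_spanP d (M : 'M[F]_(d, n * n)) z :
  z \in lie_prod (row_span M) (row_span M) <-> exists c : 'M[F]_d,
    z = \sum_i \sum_j c i j *: lieb (vec_mx (row i M)) (vec_mx (row j M)).
Proof.
split=> [|[c ->]]; last first.
  apply: memv_suml => i _; apply: memv_suml => j _; apply: memvZ.
  by apply: lieb_mem; apply: row_span_mem.
move: z; apply: lie_prod_ind.
- by exists 0; rewrite big1 // => i _; rewrite big1 // => j _; rewrite mxE scale0r.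
- move=> a x y [c ->] [c' ->]; exists (a *: c + c').
  rewrite scaler_sumr -big_split; apply: eq_bigr => i _ /=.
  rewrite scaler_sumr -big_split; apply: eq_bigr => j _ /=.
  by rewrite !mxE scalerDl scalerA.
- move=> x y /row_spanP[a ->] /row_spanP[a' ->]; exists (\matrix_(i, j) (a 0 i * a' 0 j)).
  rewrite lieb_suml; apply: eq_bigr => i _; rewrite liebZl lieb_sumr scaler_sumr.
  by apply: eq_bigr => j _; rewrite liebZr scalerA mxE.
Qed.

(** For a fixed coefficient matrix c the combination of brackets is a polynomial map of the tuple,
    and [b, b] is swept out as c varies. *)
Lemma grass_closed_lie_prod (D : set 'M[F]_n) : zclosed D ->
  grass_closed [set b | forall z, z \in lie_prod b b -> D z].
Proof.
move=> Dc d.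
exists [set M | forall c : 'M[F]_d,
  D (\sum_i \sum_j c i j *: lieb (vec_mx (row i M)) (vec_mx (row j M)))].
  apply: zclosed_bigcap => c; apply: (zclosed_preimage (phi := fun M : 'M[F]_(d, n * n) =>
    \sum_i \sum_j c i j *: lieb (vec_mx (row i M)) (vec_mx (row j M)))) Dc.
  have reg := @regular_algebra F d (n * n).
  have vr i : entries_in (regular F d (n * n)) (fun M => vec_mx (row i M) : 'M[F]_n).
    by move=> k l; under eq_fun do rewrite !mxE; apply: regular_entry.
  apply: entries_sum => // i _; apply: entries_sum => // j _.
  apply: entries_scale => //; first exact: algebra_cst.
  by apply: entries_sub => //; apply: entries_mul.
move=> M _; split=> [DM z /lie_prod_row_spanP[c ->]//|DM c].
by apply: DM; apply/lie_prod_row_spanP; exists c.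
Qed.

(** Transport a basis of b along the curve. It remains free even at s = 0, as every [gam s] is
    invertible, so the limit can be taken on d-tuples. *)
Lemma grass_limit (Z : set {vspace 'M[F]_n}) b (gam : F -> 'M[F]_n) :
  grass_closed Z -> entries_in (@polynomial1 F) gam -> (forall s, orth F n (gam s)) ->
  (forall s, s != 0 -> Z (Ad (gam s) @: b)%VS) -> Z (Ad (gam 0) @: b)%VS.
Proof.
move=> /(_ (\dim b))[A Ac AZ] gamP og Zs.
pose M s : 'M[F]_(\dim b, n * n) := \matrix_i mxvec (Ad (gam s) (tnth (vbasis b) i)).
have rowM s i : vec_mx (row i (M s)) = Ad (gam s) (tnth (vbasis b) i).
  by rewrite rowK mxvecK.
have spanM s : row_span (M s) = (Ad (gam s) @: b)%VS.
  rewrite -{2}(span_basis (vbasisP b)) limg_span /row_span; congr (<<_>>)%VS.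
  by rewrite -[in RHS](map_tnth_enum (vbasis b)) -[RHS]map_comp; apply: eq_map => i /=.
have freeM s : row_free (M s).
  apply: inj_row_free => a aM; have ug := orth_unit (og s).
  have : Ad (gam s) (\sum_i a 0 i *: tnth (vbasis b) i) = 0.
    have := congr1 (@vec_mx F n n) aM; rewrite mulmx_sum_row linear0.
    move=> aM0; apply: etrans aM0; rewrite !linear_sum; apply: eq_bigr => i _.
    by rewrite !linearZ /= rowM.
  move=> /(congr1 (Ad (invmx (gam s)))); rewrite Ad_unitK // linear0 => s0.
  have /freeP/(_ (fun i => a 0 i)) free_b := basis_free (vbasisP b).
  apply/rowP => i; rewrite [RHS]mxE; apply: free_b; apply: etrans s0.
  by apply: eq_bigr => k _; rewrite (tnth_nth 0).
rewrite -spanM; apply/AZ => //; apply: (zclosed_limit (phi := M)) => //; last first.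
  by move=> s s0; apply/AZ => //; rewrite spanM; apply: Zs.
have alg := @polynomial1_algebra F.
move=> i k; case/mxvec_indexP: k => k l.
under eq_fun do rewrite mxE mxvecE AdE orth_inv //.
suff H : entries_in (@polynomial1 F)
    (fun s => gam s *m tnth (vbasis b) i *m (skew_mx n *m (gam s)^T *m skew_mx n)).
  exact: H.
apply: entries_mul => //; first by apply: entries_mul => //; apply: entries_cst.
apply: entries_mul => //; last exact: entries_cst.
by apply: entries_mul => //; [apply: entries_cst | apply: entries_tr].
Qed.

End Grassmannian.

(** * Flags orthogonal to v *)

Section FlagsInW.
Variables (F : numClosedFieldType) (p : nat).
Local Notation n := p.+2.
Local Notation B := (@bform F n).
Local Notation S := (@skew_mx F n).
Local Notation v := (v F p).
Local Notation q := (q F p).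
Local Notation m := (m p).
Local Notation OW := (@OW F p).
Local Notation SOW := (@SOW F p).
Implicit Types (x y g h : 'M[F]_n) (w : 'cV[F]_n) (b : {vspace 'M[F]_n}).

Lemma image_of_e g (i : 'I_n) : orth F n g -> (i < m)%N ->
  (forall j : 'I_n, (j < i)%N -> g *m e j = e j) ->
  [/\ below (n - i) (g *m e i), B (g *m e i) (g *m e i) = 0 & ~ below i (g *m e i)].
Proof.
move=> og im ge; have m2 := mE p; split.
- apply/below_orthP => j ji; rewrite -(ge j ji) orth_bform // bform_ee.
  by case: eqP => // /(congr1 val) /=; lia.
- by rewrite orth_bform // bform_ee; case: eqP => // /(congr1 val) /=; lia.
move=> bi; have := fix_below ge bi.
move=> /(congr1 (mulmx (invmx g))); rewrite !mulKmx ?orth_unit // => gi.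
by have := bi i (leqnn i); rewrite gi eE eqxx => /eqP; rewrite oner_eq0.
Qed.

Lemma witt_align g (i : 'I_n) : orth F n g -> (i < m)%N ->
  (forall j : 'I_n, (j < i)%N -> g *m e j = e j) -> B (g *m e i) v = 0 ->
  exists2 k, OW k & forall j : 'I_n, (j <= i)%N -> invmx k *m g *m e j = e j.
Proof.
move=> og im ge gv; have [bw ww nbw] := image_of_e og im ge.
have [k [ok kv ke ki]] := witt_step (or_intror erefl) im bw gv ww nbw.
exists k => // j; rewrite leq_eqVlt => /orP[/eqP/val_inj->|ji]; rewrite -mulmxA.
  by rewrite -ki mulKmx // orth_unit.
by rewrite ge // orth_fixV ?ke.
Qed.

(** Align the flag vectors with e_1, ..., e_m one at a time by elements of [OW]; the isometry left
    over fixes the half flag and so preserves b_+. *)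
Lemma flag_in_W g : orth F n g -> (forall j : 'I_n, (j < m)%N -> B (g *m e j) v = 0) ->
  exists2 h, OW h & (Ad g @: b_plus F n)%VS = (Ad h @: b_plus F n)%VS.
Proof.
move=> og gv; have ug := orth_unit og.
suff [h oh hg] : exists2 h, OW h & forall j : 'I_n, (j < m)%N -> invmx h *m g *m e j = e j.
  have uh := orth_unit (OW_orth oh); exists h => //.
  rewrite -(mulKVmx uh g) Ad_imgM ?unitmx_mul ?unitmx_inv ?uh // Ad_fixes_flag_b_plus //.
  by split=> //; apply: orthM => //; apply: orthV; case: oh.
have : (m <= m)%N by []; move: {1 3}(m) => i; elim: i => [|i IHi] im.
  by exists 1%:M => //; exact: OW1.
have [h oh hg] := IHi (ltnW im); have i_n : (i < n)%N by have := mE p; lia.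
have [ohV uh] : orth F n (invmx h) /\ h \in unitmx.
  by split; [apply: orthV; case: oh | apply: orth_unit; case: oh].
have gi : B (invmx h *m g *m e (Ordinal i_n)) v = 0.
  by rewrite -mulmxA bform_invl ?(OW_fix oh) ?gv //; case: oh.
have [k ok kg] := @witt_align (invmx h *m g) (Ordinal i_n) (orthM ohV og) im hg gi.
exists (h *m k); first exact: OWM.
move=> j ji; rewrite invmxM ?orth_unit //; [|by case: oh|by case: ok].
by have := kg j; rewrite -!mulmxA; apply.
Qed.

Definition isotropic_image : set 'M[F]_n := [set x | B (x *m v) (x *m v) = 0].

Lemma zclosed_isotropic_image : zclosed isotropic_image.
Proof.
have reg := @regular_algebra F n n.
suff H : entries_in (regular F n n) (fun x => (x *m v)^T *m S *m (x *m v)).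
  by apply: zclosed_eq0; apply: H.
have vR : entries_in (regular F n n) (fun x => x *m v).
  by apply: entries_mul => //; [apply: entries_id | apply: entries_cst].
apply: entries_mul => //; apply: entries_mul => //; last exact: entries_cst.
exact: entries_tr.
Qed.

(* The elements e_j v' - v e_j' of the nilradical detect whether the j-th vector
   of a flag is orthogonal to v; primes denote duals with respect to B. *)
Lemma borel_in_W b :
  (borel (so F n) b /\ forall z, z \in lie_prod b b -> isotropic_image z) <->
  exists2 h, OW h & b = (Ad h @: b_plus F n)%VS.
Proof.
have m2 := mE p; split=> [[/borelP[g og ->] iso]|[h oh ->]]; last first.
  split; first by apply/borelP; exists h => //; case: oh.
  have uh := orth_unit (OW_orth oh).
  move=> z; rewrite lie_prod_Ad // mem_Ad_img // => zn.
  have : nplus (Ad (invmx h) z) by [].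
  rewrite nplusE => -[_ sy]; rewrite /isotropic_image /= -(Ad_unitVK z uh) Ad_mul_v //.
  rewrite orth_bform; last by case: oh.
  have bv := strict_upper_below sy (@below_v F p).
  by apply: (below_bform bv); apply: below_le bv; lia.
apply: flag_in_W => // j jm; have ug := orth_unit og.
pose y : 'M[F]_n := e j *m (v^T *m S) - v *m ((e j)^T *m S).
have yE w : y *m w = B v w *: e j - B (e j) w *: v.
  rewrite mulmxBl -!mulmxA !(mulmxA _ S).
  by rewrite [v^T *m S *m w]mx11_scalar [(e j)^T *m S *m w]mx11_scalar !mul_mx_scalar.
have yso : y \in so F n.
  apply/mem_so => a c; rewrite !yE bformBl bformBr !bformZl !bformZr.
  by rewrite (bformC a v) (bformC a (e j)); ring.
have ysu : strict_upper y.
  move=> i k ki; rewrite -mulmx_eE yE mxE [X in _ + X]mxE [X in X - _]mxE [X in _ - X]mxE.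
  rewrite bform_er bform_ee eE.
  have [km|mk] := ltnP k m; last first.
    have -> : (i == j) = false by apply/negP => /eqP E; move: ki; rewrite E; lia.
    rewrite mulr0 sub0r; case: eqP => kj; last by rewrite mul0r oppr0.
    have -> : v i 0 = 0 by apply: v_supp; move: ki; rewrite kj /=; lia.
    by rewrite mulr0 oppr0.
  have -> : v (rev_ord k) 0 = 0 by apply: v_supp; rewrite /=; have := ltn_ord k; lia.
  rewrite mul0r.
  have -> : (k == rev_ord j) = false by apply/negP => /eqP /(congr1 (@nat_of_ord n)) /=; lia.
  by rewrite mul0r subr0.
have : isotropic_image (Ad g y).
  apply: iso; rewrite lie_prod_Ad //; apply: Ad_img_mem => //.
  by have : nplus y by rewrite nplusE.
rewrite /isotropic_image /= AdE -!mulmxA orth_bform // yE.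
(* With w = g^-1 v the norm of y w reduces to B(e_j, w)^2 q, because e_j is isotropic and orthogonal
   to v. *)
set w := _ *m v; have BE (c d : F) : B (c *: e j - d *: v) (c *: e j - d *: v) =
    c ^+ 2 * B (e j) (e j) - 2 * c * d * B v (e j) + d ^+ 2 * q.
  rewrite (_ : q = B v v) // bformBl [B (c *: _) _]bformBr [B (d *: _) _]bformBr !bformZl !bformZr.
  by rewrite (bformC (e j) v); ring.
rewrite BE bform_ve // bform_ee.
have -> : (j == rev_ord j) = false by apply/negP => /eqP /(congr1 (@nat_of_ord n)) /=; lia.
rewrite mulr0n !mulr0 subr0 add0r => /eqP.
rewrite mulf_eq0 (negPf (q_neq0 F p)) orbF sqrf_eq0 => /eqP.
by rewrite bform_orthl.
Qed.

End FlagsInW.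

(** * Siegel transformations and the torus of a hyperbolic plane *)

Section Degeneration.
Variables (F : numClosedFieldType) (n : nat).
Local Notation B := (@bform F n).
Local Notation S := (@skew_mx F n).
Variables a f z : 'cV[F]_n.
Hypotheses (aa : B a a = 0) (ff : B f f = 0) (af : B a f = 1).
Hypotheses (az : B a z = 0) (fz : B f z = 0).
Implicit Types (w : 'cV[F]_n) (s t : F).

(* The exponential of s (z f' - f z'), where w' denotes B(w, -). *)
Definition siegel s : 'M[F]_n :=
  1%:M + s *: (z *m (f^T *m S) - f *m (z^T *m S)) -
  (s ^+ 2 * B z z / 2) *: (f *m (f^T *m S)).

Lemma siegelE s w : siegel s *m w =
  w + (s * B f w) *: z - (s * B z w + s ^+ 2 * B z z / 2 * B f w) *: f.
Proof.
rewrite /siegel !mulmxBl mulmxDl mul1mx -!scalemxAl mulmxBl -!mulmxA !(mulmxA _ S).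
rewrite [f^T *m S *m w]mx11_scalar [z^T *m S *m w]mx11_scalar !mul_mx_scalar.
rewrite -/(B f w) -/(B z w); move: (B f w) (B z w) (B z z) => c d k.
by apply/colP => i; rewrite !mxE; ring.
Qed.

Lemma siegel0 : siegel 0 = 1%:M.
Proof. by rewrite /siegel scale0r addr0 expr0n /= !mul0r scale0r subr0. Qed.

Lemma orth_siegel s : orth F n (siegel s).
Proof.
apply: orthP => x y; rewrite !siegelE !bformBl !bformDl !bformBr !bformDr !bformZl !bformZr.
rewrite (bformC x z) (bformC x f) (bformC z f) ff fz.
by field.
Qed.

Lemma siegel_fix s w : B f w = 0 -> B z w = 0 -> siegel s *m w = w.
Proof. by move=> fw zw; rewrite siegelE fw zw !mulr0 addr0 !scale0r addr0 subr0. Qed.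

Lemma siegel_a s : siegel s *m a = a + s *: z - (s ^+ 2 * B z z / 2) *: f.
Proof. by rewrite siegelE (bformC f) af (bformC z) az mulr0 add0r !mulr1. Qed.

Lemma entries_siegel : entries_in (@polynomial1 F) siegel.
Proof.
have alg := @polynomial1_algebra F; have idp := @polynomial1_id F.
apply: entries_sub => //.
  apply: entries_add => //; first exact: entries_cst.
  by apply: entries_scale => //; apply: entries_cst.
apply: entries_scale => //; last exact: entries_cst.
apply: algebra_mul => //; last exact: algebra_cst.
apply: algebra_mul => //; last exact: algebra_cst.
exact: algebra_exp.
Qed.

(** For t nonzero it scales a by t and f by t^-1 and fixes the orthogonal of both. As a product of
    two reflections it is visibly orthogonal of determinant 1. *)
Definition hyperbolic t : 'M[F]_n := refl (a - f) *m refl (a - t *: f).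

Lemma hyperbolic_norm t : B (a - t *: f) (a - t *: f) = - 2 * t.
Proof. by rewrite !bformBl !bformBr !bformZl !bformZr aa ff (bformC f a) af; ring. Qed.

Lemma hyperbolicE t w : t != 0 -> hyperbolic t *m w =
  w + ((t - 1) * B f w) *: a + ((t^-1 - 1) * B a w) *: f.
Proof.
move=> t0; rewrite /hyperbolic -mulmxA !refl_mul hyperbolic_norm.
have -> : B (a - f) (a - f) = - 2.
  by have := hyperbolic_norm 1; rewrite scale1r mulr1.
rewrite !bformBr !bformBl !bformZr !bformBr !bformZl !bformZr aa ff af (bformC f a) af.
move: (B f w) (B a w) => c d.
by apply/colP => i; rewrite !mxE; field.
Qed.

Lemma hyperbolic_fix t w : t != 0 -> B a w = 0 -> B f w = 0 -> hyperbolic t *m w = w.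
Proof. by move=> t0 aw fw; rewrite hyperbolicE // aw fw !mulr0 !scale0r !addr0. Qed.

Lemma hyperbolic_unit t : t != 0 -> hyperbolic t \in unitmx.
Proof.
move=> t0; rewrite unitmx_mul !orth_unit //; apply: orth_refl.
  by rewrite hyperbolic_norm mulf_neq0 // oppr_eq0 pnatr_eq0.
by have := hyperbolic_norm 1; rewrite scale1r mulr1 => ->; rewrite oppr_eq0 pnatr_eq0.
Qed.

Lemma invmx_hyperbolic t : t != 0 -> invmx (hyperbolic t) = hyperbolic t^-1.
Proof.
move=> t0; have ut := hyperbolic_unit t0.
apply: (can_inj (mulKmx ut)); rewrite mulmxV //; apply: mx_eq_on_e => k.
rewrite mul1mx -mulmxA !hyperbolicE ?invr_eq0 //; move: (e k) => w.
rewrite !bformDr !bformZr aa ff af (bformC f a) af invrK.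
move: (B f w) (B a w) => c d.
by apply/colP => i; rewrite !mxE; field.
Qed.

(** The torus scales f by t^-1 and fixes z, hence scales the parameter of the transformation. *)
Lemma hyperbolic_siegel s t : t != 0 ->
  hyperbolic t *m siegel s = siegel (s / t) *m hyperbolic t.
Proof.
move=> t0; apply: mx_eq_on_e => k; rewrite -[LHS]mulmxA -[RHS]mulmxA; move: (e k) => w.
rewrite !hyperbolicE // !siegelE !(bformDr, bformNr, bformZr).
rewrite (bformC f a) (bformC z a) (bformC z f) ff af az fz.
move: (B f w) (B a w) (B z w) (B z z) => c d d' k'.
by apply/colP => i; rewrite !mxE; field.
Qed.

End Degeneration.

(** * Degenerating a flag inside a closed orbit *)

Section ClosedOrbits.
Variables (F : numClosedFieldType) (p : nat).
Local Notation n := p.+2.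
Local Notation B := (@bform F n).
Local Notation v := (v F p).
Local Notation q := (q F p).
Local Notation m := (m p).
Local Notation OW := (@OW F p).
Local Notation SOW := (@SOW F p).
Implicit Types (x y g h : 'M[F]_n) (w : 'cV[F]_n) (b : {vspace 'M[F]_n}).

Lemma Ad_flag_b_plus k : orth F n k ->
  (forall j : 'I_n, (j < m)%N -> below j.+1 (k *m e j)) ->
  (forall j : 'I_n, (j < m)%N -> below j.+1 (invmx k *m e j)) ->
  (Ad k @: b_plus F n)%VS = b_plus F n.
Proof.
move=> ok ke kVe; apply: Ad_b_plus_sub => // x /mem_b_plus[xso ux].
apply: upper_of_cols; first by rewrite Ad_so.
move=> i j jm ji; rewrite -mulmx_eE AdE -!mulmxA.
suff H w : below j.+1 w -> below j.+1 (k *m w) by apply: H (upper_below ux (kVe j jm)) _ ji.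
apply: (@below_ind F p (fun w => below j.+1 (k *m w))).
- by rewrite mulmx0; apply: below0.
- by move=> w1 w2 b1 b2; rewrite mulmxDr; apply: belowD.
- move=> c l lj; rewrite -scalemxAr; apply/belowZ/below_le/ke => //.
  by apply: leq_trans lj _.
Qed.

(** Any isotropic vector not orthogonal to w can be rescaled. e_i or its dual serves unless w is
    orthogonal to both; then w is corrected by them to norm 0 and still pairs to B(w, w) with w. *)
Lemma hyperbolic_pair (i : 'I_n) w : (i < m)%N -> below (n - i) w -> B w v = 0 ->
  B w w != 0 -> exists f, [/\ below (n - i) f, B f v = 0, B f f = 0 & B w f = 1].
Proof.
move=> im bw wv ww; have m2 := mE p; have i_n := ltn_ord i.
suff [f [bf fv ff wf]] : exists f,
    [/\ below (n - i) f, B f v = 0, B f f = 0 & B w f != 0].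
  exists ((B w f)^-1 *: f); split; first exact: belowZ.
  - by rewrite bformZl fv mulr0.
  - by rewrite bformZl bformZr ff !mulr0.
  - by rewrite bformZr mulVf.
have nr : (i == rev_ord i) = false by apply/negP => /eqP /(congr1 (@nat_of_ord n)) /=; lia.
have bi : below (n - i) (e i : 'cV[F]_n) by apply: below_e; lia.
have br : below (n - i) (e (rev_ord i) : 'cV[F]_n) by apply: below_e => /=; lia.
have iv : B (e i) v = 0 by rewrite bformC bform_ve.
have rv : B (e (rev_ord i)) v = 0 by rewrite bform_el rev_ordK v_supp ?im.
have ii : B (e i) (e i) = 0 by rewrite bform_ee nr.
have rr : B (e (rev_ord i)) (e (rev_ord i)) = 0 by rewrite bform_ee rev_ordK eq_sym nr.
have ir : B (e i) (e (rev_ord i)) = 1 by rewrite bform_ee eqxx.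
have [wi|wi] := eqVneq (B w (e i)) 0; last by exists (e i).
have [wr|wr] := eqVneq (B w (e (rev_ord i))) 0; last by exists (e (rev_ord i)).
exists (e i + w - (B w w / 2) *: e (rev_ord i)); split.
- by apply: belowB; [apply: belowD | apply: belowZ].
- by rewrite bformBl bformDl bformZl iv wv rv mulr0 subr0 addr0.
- have wi' : B (e i) w = 0 by rewrite bformC.
  have wr' : B (e (rev_ord i)) w = 0 by rewrite bformC.
  have ri : B (e (rev_ord i)) (e i) = 1 by rewrite bformC.
  rewrite bformBl bformDl bformZl !bformBr !bformDr !bformZr.
  by rewrite ii rr ir ri wi wr wi' wr'; field.
- by rewrite bformBr bformDr bformZr wi wr mulr0 subr0 add0r.
Qed.

Section Orbit.
Variable Q : set {vspace 'M[F]_n}.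
Hypothesis Qstable : forall k b, SOW k -> Q b -> Q (Ad k @: b)%VS.
Hypothesis Qclosed : borel_closed (so F n) Q.

Lemma closed_limit g gam : orth F n g -> entries_in (@polynomial1 F) gam ->
  (forall s, orth F n (gam s)) ->
  (forall s, s != 0 -> Q (Ad (gam s *m g) @: b_plus F n)%VS) ->
  Q (Ad (gam 0 *m g) @: b_plus F n)%VS.
Proof.
move=> og gamP ogam Qs; have [Z Zc QE] := Qclosed; have ug := orth_unit og.
rewrite QE; split; first by apply/borelP; exists (gam 0 *m g) => //; apply: orthM.
rewrite Ad_imgM ?(orth_unit (ogam 0)) //; apply: (@grass_limit F n Z (Ad g @: b_plus F n)%VS gam Zc gamP ogam) => s s0.
by rewrite -Ad_imgM ?(orth_unit (ogam s)) //; have := Qs s s0; rewrite QE => -[].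
Qed.

(* If the i-th vector of the flag is not orthogonal to v, it is f = siegel c a with
   a in W, and the one-parameter group fixing v and scaling a degenerates the flag
   to one whose i-th vector is a. *)
Lemma degenerate h g (i : 'I_n) : OW h -> orth F n g -> (i < m)%N ->
  (forall j : 'I_n, (j < i)%N -> g *m e j = e j) -> B (g *m e i) v != 0 ->
  Q (Ad (h *m g) @: b_plus F n)%VS ->
  exists g', [/\ orth F n g', forall j : 'I_n, (j < i)%N -> g' *m e j = e j,
    B (g' *m e i) v = 0 & Q (Ad (h *m g') @: b_plus F n)%VS].
Proof.
move=> oh og im ge gv Qg; have m2 := mE p; have q0 := q_neq0 F p.
have [bg gg nbg] := image_of_e og im ge.
set fl := g *m e i in gv bg gg nbg *.
have qE' : q = B v v by [].
pose c := B fl v / q; have c0 : c != 0 by rewrite mulf_neq0 // invr_eq0.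
have bq : B fl v = c * q by rewrite divfK.
clearbody c.
pose w := fl - c *: v.
have wv : B w v = 0 by rewrite /w bformBl bformZl -qE' bq subrr.
have ww : B w w = - (c ^+ 2 * q).
  rewrite {2}/w bformBr bformZr wv mulr0 subr0 /w bformBl bformZl gg (bformC v).
  by rewrite sub0r bq; ring.
have ww0 : B w w != 0 by rewrite ww oppr_eq0 mulf_neq0 // expf_neq0.
have bv : below (n - i) v by apply: below_le (@below_v F p); lia.
have bw : below (n - i) w by apply: belowB => //; apply: belowZ.
have [f [bf fv ff wf]] := hyperbolic_pair im bw wv ww0.
have flE : fl = w + c *: v by rewrite subrK.
clearbody w.
pose a := w - (B w w / 2) *: f.
have aa : B a a = 0.
  by rewrite /a bformBl !bformBr !bformZl !bformZr ff (bformC f) wf; field.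
have af : B a f = 1 by rewrite /a bformBl bformZl ff mulr0 subr0.
have av : B a v = 0 by rewrite /a bformBl bformZl fv wv mulr0 subr0.
have fle (j : 'I_n) : (j < i)%N -> [/\ B a (e j) = 0, B f (e j) = 0 & B v (e j) = 0].
  move=> ji; have ej : below i (e j : 'cV[F]_n) by apply: below_e.
  have fe : B f (e j) = 0 by rewrite bformC (below_bform ej bf).
  split=> //; last by apply: bform_ve; lia.
  by rewrite /a bformBl bformZl fe mulr0 subr0 bformC (below_bform ej bw).
(* The terms in f cancel because B(w, w) = - c^2 q. *)
have sa : siegel f v c *m a = fl.
  rewrite siegel_a // flE /a -qE' ww; apply/eqP; rewrite -subr_eq0.
  by move: (v) => v0; apply/eqP/colP => k; rewrite !mxE; field.
clearbody a.
have os s := orth_siegel ff fv s : orth F n (siegel f v s).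
pose g' := invmx (siegel f v c) *m g; have us := orth_unit (os c).
have og' : orth F n g' by apply: orthM => //; apply: orthV.
have ug' := orth_unit og'; have uh := orth_unit (OW_orth oh).
have g'i : g' *m e i = a by rewrite /g' -mulmxA -/(fl) -sa mulKmx.
have g'e (j : 'I_n) : (j < i)%N -> g' *m e j = e j.
  move=> ji; rewrite /g' -mulmxA ge //; have [_ fj vj] := fle j ji.
  by rewrite orth_fixV // siegel_fix.
have ge' : g = siegel f v c *m g' by rewrite mulKVmx.
have g'V (j : 'I_n) : (j < i)%N -> invmx g' *m e j = e j.
  by move=> ji; rewrite orth_fixV ?g'e.
have g'Vi : invmx g' *m a = e i by rewrite -g'i mulKmx.
clearbody g'.
(* Seen through g', the torus adds to e_j with j >= i only a multiple of e_i: the f-term carries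
   B(a, g' e_j) = B(e_i, e_j) = 0. *)
have hypE t (j : 'I_n) : t != 0 -> (j < m)%N ->
    below j.+1 (invmx g' *m hyperbolic a f t *m g' *m e j).
  move=> t0 jm; rewrite -mulmxA -mulmxA; have [ji|ij] := ltnP j i.
    have [aj fj _] := fle j ji.
    by rewrite g'e // hyperbolic_fix // g'V //; apply: below_e.
  rewrite hyperbolicE // -{2}g'i orth_bform // bform_ee.
  have -> : (j == rev_ord i) = false by apply/negP => /eqP /(congr1 (@nat_of_ord n)) /=; lia.
  rewrite mulr0 scale0r addr0 mulmxDr mulKmx // -scalemxAr g'Vi.
  by apply: belowD; [apply: below_e | apply/belowZ/below_e].
have hypS t : t != 0 -> SOW (hyperbolic a f t).
  have n1 := hyperbolic_norm aa ff af 1; rewrite scale1r mulr1 in n1.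
  move=> t0; have nt := hyperbolic_norm aa ff af t.
  have n10 : B (a - f) (a - f) != 0 by rewrite n1 oppr_eq0 pnatr_eq0.
  have nt0 : B (a - t *: f) (a - t *: f) != 0 by rewrite nt mulf_neq0 // oppr_eq0 pnatr_eq0.
  split; last by rewrite det_mulmx !det_refl // mulrNN mulr1.
  by apply: OWM; apply: OW_refl; rewrite // bformBl ?bformZl av fv ?mulr0 subrr.
have hypB t : t != 0 -> (Ad (hyperbolic a f t *m g') @: b_plus F n = Ad g' @: b_plus F n)%VS.
  move=> t0; have [[ot _] _] := hypS t t0; have ut := orth_unit ot.
  have -> : hyperbolic a f t *m g' = g' *m (invmx g' *m hyperbolic a f t *m g').
    by rewrite -(mulmxA (invmx g')) mulKVmx.
  have uV : invmx g' \in unitmx by rewrite unitmx_inv.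
  have uVt : invmx g' *m hyperbolic a f t \in unitmx by rewrite unitmx_mul uV.
  have uk : invmx g' *m hyperbolic a f t *m g' \in unitmx.
    by rewrite unitmx_mul uVt.
  rewrite Ad_imgM // Ad_flag_b_plus //.
  - by apply: orthM => //; apply: orthM => //; apply: orthV.
  - by move=> j jm; apply: hypE.
  move=> j jm; rewrite (invmxM uVt ug') (invmxM uV ut) invmxK invmx_hyperbolic //.
  by rewrite mulmxA; apply: hypE; rewrite ?invr_eq0.
exists g'; split=> //; first by rewrite g'i.
have gam0 : h *m siegel f v 0 = h by rewrite siegel0 mulmx1.
rewrite -{1}gam0; apply: (@closed_limit g' (fun s => h *m siegel f v s)) => //.
- have alg := @polynomial1_algebra F.
  by apply: entries_mul => //; [apply: entries_cst | apply: entries_siegel].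
- by move=> s; apply: orthM => //; case: oh.
(* The torus at t = c / s turns the parameter c into s and preserves the flag of g', so the flag of
   siegel(s) g' stays in the orbit for every nonzero s. *)
move=> s s0; have t0 : c / s != 0 by rewrite mulf_neq0 // invr_eq0.
have St := hypS _ t0; have ut : hyperbolic a f (c / s) \in unitmx.
  by apply: orth_unit; case: St => -[].
have key (H : 'M[F]_n) : H *m siegel f v c = siegel f v s *m H ->
    h *m H *m invmx h *m (h *m g) = (h *m siegel f v s) *m (H *m g').
  by move=> HS; rewrite ge' -!mulmxA mulKmx // (mulmxA H) HS !mulmxA.
have uconj : h *m hyperbolic a f (c / s) *m invmx h \in unitmx.
  by apply: orth_unit; case: (SOW_conj oh St) => -[].
have uhg : h *m g \in unitmx by rewrite unitmx_mul uh orth_unit.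
have uhs : h *m siegel f v s \in unitmx by rewrite unitmx_mul uh orth_unit.
have uHg : hyperbolic a f (c / s) *m g' \in unitmx by rewrite unitmx_mul ut.
have := Qstable (SOW_conj oh St) Qg; rewrite -(Ad_imgM _ uconj uhg) key.
  by rewrite (Ad_imgM _ uhs uHg) hypB // -(Ad_imgM _ uhs ug').
by rewrite hyperbolic_siegel // (_ : c / (c / s) = s) //; field; rewrite s0.
Qed.

(** For each i, [degenerate] makes the i-th vector orthogonal to v, and [witt_align] then moves it
    to e_i by an element of [OW] that is absorbed into h. *)
Lemma closed_contains_OW b : Q b -> exists2 h, OW h & Q (Ad h @: b_plus F n)%VS.
Proof.
move=> Qb; have [g og bg] : exists2 g, orth F n g & b = (Ad g @: b_plus F n)%VS.
  by apply/borelP; have [Z _ QE] := Qclosed; move: Qb; rewrite QE => -[].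
suff [h [g' [oh og' ge Qh]]] : exists h g', [/\ OW h, orth F n g',
    forall j : 'I_n, (j < m)%N -> g' *m e j = e j & Q (Ad (h *m g') @: b_plus F n)%VS].
  exists h => //; move: Qh; rewrite Ad_imgM ?(orth_unit (OW_orth oh)) ?(orth_unit og') //.
  by rewrite Ad_fixes_flag_b_plus.
have : (m <= m)%N by []; move: {1 3}(m) => i; elim: i => [|i IHi] im.
  by exists 1%:M, g; rewrite mul1mx -bg; split=> //; exact: OW1.
have [h [g' [oh og' ge Qh]]] := IHi (ltnW im).
have i_n : (i < n)%N by have := mE p; lia.
have {h g' oh og' ge Qh} [h [g' [oh og' ge gv Qh]]] : exists h g', [/\ OW h, orth F n g',
    forall j : 'I_n, (j < i)%N -> g' *m e j = e j, B (g' *m e (Ordinal i_n)) v = 0 &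
    Q (Ad (h *m g') @: b_plus F n)%VS].
  have [gv|gv] := eqVneq (B (g' *m e (Ordinal i_n)) v) 0; first by exists h, g'.
  have [g'' [og'' ge'' gv'' Qh'']] := @degenerate h g' (Ordinal i_n) oh og' im ge gv Qh.
  by exists h, g''.
have [k ok ke] := @witt_align F p g' (Ordinal i_n) og' im ge gv.
have uk := orth_unit (OW_orth ok); exists (h *m k), (invmx k *m g'); split=> //.
- exact: OWM.
- by apply: orthM => //; apply: orthV; case: ok.
- by rewrite -mulmxA mulKVmx.
Qed.

End Orbit.
End ClosedOrbits.

(** * Classification of the closed orbits *)

Section OrbitDescription.
Variables (F : numClosedFieldType) (p : nat).
Local Notation n := p.+2.
Local Notation OW := (@OW F p).
Local Notation SOW := (@SOW F p).
Local Notation bplus := (b_plus F n).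
Local Notation bminus := (bminus F p).
Local Notation nplus := (@nplus F p).
Implicit Types (x y g h : 'M[F]_n) (b : {vspace 'M[F]_n}) (Q : set {vspace 'M[F]_n}).

Lemma orbit_vsM b h : SOW h -> orbit_vs SOW (Ad h @: b)%VS = orbit_vs SOW b.
Proof.
move=> sh; have uh := orth_unit (OW_orth (SOW_OW sh)).
apply/seteqP; split=> _ [g sg ->]; have ug := orth_unit (OW_orth (SOW_OW sg)).
  by exists (g *m h); [exact: SOWM | rewrite Ad_imgM].
exists (g *m invmx h); first by apply: SOWM => //; apply: SOWV.
by rewrite -Ad_imgM ?unitmx_mul ?unitmx_inv ?ug // mulmxKV.
Qed.

Lemma orbit_vs_refl b : orbit_vs SOW b b.
Proof. by exists 1%:M; [exact: SOW1 | rewrite Ad_img1]. Qed.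

Lemma closed_orbit_contains Q : closed_orbit SOW (so F n) Q ->
  exists2 h, OW h & Q = orbit_vs SOW (Ad h @: bplus)%VS.
Proof.
move=> [Qc [b bb QE]].
have Qst k c : SOW k -> Q c -> Q (Ad k @: c)%VS.
  rewrite QE => sk [g sg ->]; exists (k *m g); first exact: SOWM.
  by rewrite Ad_imgM ?orth_unit //; [case: sk => -[] | case: sg => -[]].
have Qb : Q b by rewrite QE; apply: orbit_vs_refl.
have [h oh Qh] := closed_contains_OW Qst Qc Qb; exists h => //.
by move: Qh; rewrite QE => -[g sg ->]; rewrite orbit_vsM.
Qed.

Lemma closed_orbit_of (D : set 'M[F]_n) b : zclosed D -> borel (so F n) b ->
  orbit_vs SOW b = [set c | borel (so F n) c /\ forall z, z \in lie_prod c c -> D z] ->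
  closed_orbit SOW (so F n) (orbit_vs SOW b).
Proof.
move=> Dc bb bE; split; last by exists b.
exists [set c | forall z, z \in lie_prod c c -> D z]; first exact: grass_closed_lie_prod.
by rewrite bE.
Qed.

Section Even.
Hypothesis en : ~~ odd n.

Lemma OW_orbit_even h : OW h -> orbit_vs SOW bplus (Ad h @: bplus)%VS.
Proof.
move=> oh; have [dh|dh] := OW_det oh; first by exists h.
have [t [ot dt ft]] := even_reflection F en.
exists (h *m t); first by split; [exact: OWM | rewrite det_mulmx dh dt mulrNN mulr1].
have [uh ut] := (orth_unit (OW_orth oh), orth_unit (OW_orth ot)).
by rewrite Ad_imgM // (Ad_fixes_flag_b_plus ft).
Qed.

Lemma closed_orbits_even Q :
  closed_orbit SOW (so F n) Q <-> Q = orbit_vs SOW bplus.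
Proof.
split=> [/closed_orbit_contains[h oh ->]|->].
  by have [g sg ->] := OW_orbit_even oh; rewrite orbit_vsM.
apply: (closed_orbit_of (zclosed_isotropic_image F p) (borel_b_plus F p)).
apply/seteqP; split=> c.
  by move=> [g sg ->]; apply/borel_in_W; exists g => //; case: sg.
by move=> /borel_in_W[h oh ->]; apply: OW_orbit_even.
Qed.

End Even.

Section Odd.
Hypothesis on : odd n.
Local Notation r := (swap_refl F p).

Lemma orbit_minusP c : orbit_vs SOW bminus c <->
  exists h, [/\ OW h, \det h = -1 & c = (Ad h @: bplus)%VS].
Proof.
have or := OW_swap F on; have ur := orth_unit (OW_orth or).
split=> [[g sg ->]|[h [oh dh ->]]].
  have [og dg] := sg; have ug := orth_unit (OW_orth og).
  exists (g *m r); split; first exact: OWM.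
    by rewrite det_mulmx dg det_swap // mul1r.
  by rewrite Ad_imgM.
have uh := orth_unit (OW_orth oh); exists (h *m r).
  by split; [exact: OWM | rewrite det_mulmx dh det_swap // mulrNN mulr1].
rewrite /bminus -Ad_imgM ?unitmx_mul ?uh //; congr (Ad _ @: _)%VS.
by rewrite -mulmxA -[X in r *m X]mulmx1 swapK // mulmx1.
Qed.

Lemma regular_not_minus h : OW h -> \det h = 1 ->
  ~ minus_closed (Ad h (regular_nilpotent F p)).
Proof.
move=> oh dh; have uh := orth_unit (OW_orth oh).
have sV : SOW (invmx h) by apply: SOWV.
move=> /(_ _ sV); rewrite -AdM ?unitmx_inv // mulVmx // Ad1 => /eqP.
by rewrite (negPf (regular_krylov_test F on)).
Qed.

Lemma regular_mem h : OW h ->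
  Ad h (regular_nilpotent F p) \in lie_prod (Ad h @: bplus)%VS (Ad h @: bplus)%VS.
Proof.
move=> /OW_orth/orth_unit uh; rewrite lie_prod_Ad //; apply: Ad_img_mem => //.
exact: (regular_nplus F on).
Qed.

(** Equality would give b_+ = Ad(h) b_+ with det h = -1, which puts the regular nilpotent element
    into Ad(K) n_-. *)
Lemma orbits_neq : orbit_vs SOW bplus <> orbit_vs SOW bminus.
Proof.
move=> E; have : orbit_vs SOW bminus bplus by rewrite -E; apply: orbit_vs_refl.
move=> /orbit_minusP[h [oh dh bE]]; have uh := orth_unit (OW_orth oh).
have : nplus (regular_nilpotent F p) by apply: regular_nplus.
rewrite /nplus /nilrad /= {1 2}bE lie_prod_Ad // mem_Ad_img // => yn.
apply: (@regular_not_minus 1%:M (OW1 F p) (det1 _ _)); rewrite Ad1; apply: minus_sub_closed => //.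
apply/Ad_sat_minusP => //; exists h, (Ad (invmx h) (regular_nilpotent F p)); split=> //.
by rewrite Ad_unitVK.
Qed.

Lemma zclosed_plus : zclosed [set x | minus_closed (Ad r x)].
Proof.
apply: (zclosed_preimage (phi := fun x => Ad r x)) (zclosed_minus F p).
have reg := @regular_algebra F n n.
have -> : (fun x => Ad r x) = (fun x => r *m x *m invmx r) by apply: funext => x; rewrite AdE.
apply: entries_mul => //; last exact: entries_cst.
by apply: entries_mul => //; [apply: entries_cst | apply: entries_id].
Qed.

(** Flags orthogonal to v form one [OW]-orbit. Requiring [b, b] to lie in [minus_closed], or in its
    conjugate by the swap, cuts out one of the two [SOW]-orbits, since each nilradical contains a
    conjugate of the regular nilpotent element that violates the other condition. *)
Lemma closed_orbits_odd Q : closed_orbit SOW (so F n) Q <->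
  Q = orbit_vs SOW bplus \/ Q = orbit_vs SOW bminus.
Proof.
have or := OW_swap F on; have ur := orth_unit (OW_orth or).
split=> [/closed_orbit_contains[h oh ->]|[->|->]].
- have [dh|dh] := OW_det oh; first by left; rewrite orbit_vsM.
  right; suff [g sg ->] : orbit_vs SOW bminus (Ad h @: bplus)%VS by rewrite orbit_vsM.
  by apply/orbit_minusP; exists h.
- apply: (closed_orbit_of (zclosed_setI (zclosed_isotropic_image F p) zclosed_plus)).
    exact: borel_b_plus.
  apply/seteqP; split=> c.
    move=> [g sg ->]; have [og dg] := sg; have ug := orth_unit (OW_orth og).
    have [bc ic] := proj2 (borel_in_W (Ad g @: bplus)%VS) (ex_intro2 _ _ g og erefl).
    split=> // z zc; split; first exact: ic.
    apply: minus_sub_closed => //; apply/Ad_swap_sat => //; exists g => //.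
    move: zc; rewrite lie_prod_Ad // mem_Ad_img // => zc.
    by exists (Ad (invmx g) z); rewrite ?Ad_unitVK.
  move=> [bc ic]; have [|h oh cE] := proj1 (borel_in_W c).
    by split=> // z /ic[].
  have [dh|dh] := OW_det oh; first by rewrite cE; exists h.
  rewrite cE in ic; have [_ /=] := ic _ (regular_mem oh).
  rewrite -AdM ?(orth_unit (OW_orth oh)) // => /regular_not_minus[]; first exact: OWM.
  by rewrite det_mulmx dh det_swap // mulrNN mulr1.
- apply: (closed_orbit_of (zclosed_setI (zclosed_isotropic_image F p) (zclosed_minus F p))).
    by apply: borel_Ad; [case: or | apply: borel_b_plus].
  apply/seteqP; split=> c.
    move=> /orbit_minusP[h [oh dh ->]]; have uh := orth_unit (OW_orth oh).
    have [bc ic] := proj2 (borel_in_W (Ad h @: bplus)%VS) (ex_intro2 _ _ h oh erefl).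
    split=> // z zc; split; first exact: ic.
    apply: minus_sub_closed => //; apply/Ad_sat_minusP => //.
    move: zc; rewrite lie_prod_Ad // mem_Ad_img // => zc.
    by exists h, (Ad (invmx h) z); split; rewrite ?Ad_unitVK.
  move=> [bc ic]; have [|h oh cE] := proj1 (borel_in_W c).
    by split=> // z /ic[].
  apply/orbit_minusP; exists h; split=> //; have [dh|//] := OW_det oh.
  rewrite cE in ic; have [_ /=] := ic _ (regular_mem oh).
  by move=> /regular_not_minus[].
Qed.

End Odd.
End OrbitDescription.

Theorem theorem4p23 (R : realType) (n : nat) (hn : (1 < n)%N)
    (fk : 'I_(rk n.-1) -> 'M[R[i]]_n -> R[i])
    (f : 'I_(rk n) -> 'M[R[i]]_n -> R[i])
    (hfk : basic_invariants (kalg R[i] n) (Kgrp R[i] n) fk)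
    (hf : basic_invariants (so R[i] n) (SO R[i] n) f) :
  (forall l : nat, n = (2 * l)%N ->
    let K := Kgrp R[i] n in
    let b := b_plus R[i] n in
    [/\ Phi_fiber0 fk f = Ad_sat K (nilrad b),
        zirreducible (Phi_fiber0 fk f) &
        forall Q, closed_orbit K (so R[i] n) Q <-> Q = orbit_vs K b])
  /\
  (forall l : nat, n = (2 * l + 1)%N ->
    forall w : 'M[R[i]]_n, represents_s_short w ->
    let K := Kgrp R[i] n in
    let bp := b_plus R[i] n in
    let bm := b_minus w in
    [/\ Phi_fiber0 fk f = Ad_sat K (nilrad bp) `|` Ad_sat K (nilrad bm),
        Ad_sat K (nilrad bp) <> Ad_sat K (nilrad bm),
        forall Y, zirr_component (Phi_fiber0 fk f) Y <->
          Y = Ad_sat K (nilrad bp) \/ Y = Ad_sat K (nilrad bm),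
        orbit_vs K bp <> orbit_vs K bm &
        forall Q, closed_orbit K (so R[i] n) Q <->
          Q = orbit_vs K bp \/ Q = orbit_vs K bm]).
Proof.
case: n hn fk f hfk hf => [|[|p]] // _ fk f hfk hf.
have KE : Kgrp R[i] p.+2 = @SOW R[i] p := KgrpE _ _.
split=> l nl.
  have en : ~~ odd p.+2 by rewrite nl oddM.
  move=> K b; rewrite /K KE; split; first exact: fiber_even.
    by rewrite (fiber_even hfk hf en); apply: zirreducible_Ad_sat.
  exact: closed_orbits_even.
have on : odd p.+2 by rewrite nl oddD oddM.
move=> w /(represents_b_minus on) wE K bp bm; rewrite /K /bm wE KE; split.
- exact: fiber_odd.
- by move=> E; apply: (@plus_not_minus R[i] p on) => x; rewrite /nplus E.
- exact: fiber_components.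
- exact: orbits_neq.
- exact: closed_orbits_odd.
Qed.
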